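(* Suppose that: (a) for any $L$ there exists $L_0$ such that $\lim_{L\to\infty}L_0/L=c>0$ and $\max_{1\le\ell\le L_0}\gamma_\ell\le1-\delta$ for some $\delta>0$; (b) for all $\ell$, $0<\underline c\le\gamma_\ell\le\overline c<\infty$, and for every dimension $p$, $0<\underline c^{(\ell)}\le\lambda_{\min}(\Sigma^{(\ell)})\le\lambda_{\max}(\Sigma^{(\ell)})\le\bar c^{(\ell)}<\infty$ with $\sup_\ell\bar c^{(\ell)}\le\bar c_{\rm op}$ and $\inf_\ell\underline c^{(\ell)}>\underline c_{\rm op}$, where $\underline c_{\rm op},\bar c_{\rm op}\in(0,\infty)$ are constants; (c) the vectors $\sqrt p\,\bar\beta^{(\ell)}$ are independent, zero mean and sub-Gaussian with parameter $\tau_\beta$, and the vectors $\varepsilon^{(\ell)}$ are independent, zero mean and sub-Gaussian with parameter $\tau_\varepsilon$. Let $$\hat\Omega=\arg\min_{\tilde\Omega\in\mathbb S_p^+}\frac1L\sum_{\ell=1}^L\Big\|y^{(\ell)}y^{(\ell)\top}-\frac1pX^{(\ell)}\tilde\Omega X^{(\ell)\top}-\sigma^2I\Big\|_F^2.$$ Then $$\|\hat\Omega-\Omega\|=\mathcal O_P\Big(\sqrt{p^2/L}\Big).$$ Hence $\|\hat\Omega-\Omega\|\xrightarrow{p}0$ when $L,p,n_\ell\to\infty$ such that $p^2/L\to0$ and $p/n_\ell\to\gamma_\ell$. In addition: (i) if $L_0/L\to0$ (instead of $L_0/L\to c>0$), then the condition $p^2/L\to0$ is to be replaced by $\frac{L}{L_0}\cdot\frac{p^2}{L}\to0$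 to guarantee $\|\hat\Omega-\Omega\|\xrightarrow{p}0$; (ii) if $\gamma_\ell=\gamma$ for all $\ell=1,\dots,L$, then $\|\hat\Omega-\Omega\|=\mathcal O_P\Big(\frac{(1+\sqrt\gamma)^2\gamma^2}{(1-\sqrt\gamma)^2}\sqrt{p^2/L}\Big)$.
   Context: Model: for $\ell=1,\dots,L$, $y^{(\ell)}=X^{(\ell)}\bar\beta^{(\ell)}+\varepsilon^{(\ell)}\in\mathbb R^{n_\ell}$, where $X^{(\ell)}=Z^{(\ell)}(\Sigma^{(\ell)})^{1/2}\in\mathbb R^{n_\ell\times p}$, $Z^{(\ell)}$ has i.i.d. entries with mean $0$, variance $1$ and $12$th moments bounded uniformly in $p$ and $\ell$, and $\Sigma^{(\ell)}$ is deterministic positive definite; $\bar\beta^{(\ell)}$ are i.i.d. with mean $0$ and $\mathbb E\bar\beta^{(\ell)}\bar\beta^{(\ell)\top}=\frac1p\Omega$; $\varepsilon^{(\ell)}$ has mean $0$ and covariance $\sigma^2I_{n_\ell}$ with $\sigma^2$ known; the $X^{(\ell)},\bar\beta^{(\ell)},\varepsilon^{(\ell)}$ are mutually independent. $\Omega$ is positive definite with $C_0<\lambda_{\min}(\Omega)\le\lambda_{\max}(\Omega)<C_1$ for constants $0<C_0<C_1$ not depending on $p$. Asymptotic regime: $L,p,n_\ell\to\infty$ with $p/n_\ell\to\gamma_\ell$. A random vector $x\in\mathbb R^d$ with mean $\mu$ is sub-Gaussian with parameter $\tau$ if $\mathbb E\exp(\lambda v^\top(x-\mu))\le\exp(\lambda^2\tau^2/2)$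 for all unit vectors $v$ and all $\lambda\in\mathbb R$. $\mathbb S_p^+$ is the set of symmetric positive definite $p\times p$ matrices, $\|\cdot\|$ the operator norm, $\|\cdot\|_F$ the Frobenius norm. $X_n=\mathcal O_P(b_n)$ means $X_n/b_n$ is bounded in probability.
   Formalization: The limits n_ℓ→∞ and p/n_ℓ→γ_ℓ are taken uniformly over ℓ=1,…,L (read pointwise in ℓ, one study with huge n_L breaks the claim); the O_P bounds are stated on the event that the argmin over the open cone S_p^+ exists. *)

(* Defs.v *)
From HB Require Import structures.
From mathcomp Require Import all_boot all_order all_algebra.
From mathcomp Require Import all_classical all_reals all_analysis.

Set Implicit Arguments.
Unset Strict Implicit.
Unset Printing Implicit Defensive.

Import Order.TTheory GRing.Theory Num.Theory.
Import numFieldNormedType.Exports.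

Local Open Scope classical_set_scope.
Local Open Scope ring_scope.

Section matrices.
Context {R : realType}.

Definition l2norm n (v : 'cV[R]_n) : R := Num.sqrt (\sum_i v i 0 ^+ 2).

Definition frobenius m n (A : 'M[R]_(m, n)) : R :=
  Num.sqrt (\sum_i \sum_j A i j ^+ 2).

(* The library norm on matrices is the entrywise maximum, hence: *)
Definition opnorm m n (A : 'M[R]_(m, n)) : R :=
  sup [set l2norm (A *m v) | v in [set v : 'cV[R]_n | l2norm v <= 1]].

Definition posdefmx n (A : 'M[R]_n) : Prop :=
  A^T = A /\ forall v : 'cV[R]_n, v != 0 -> 0 < (v^T *m A *m v) 0 0.

(* Only used on symmetric matrices, whose eigenvalues are all real. *)
Definition lambda_min n (A : 'M[R]_n) : R := inf [set a | eigenvalue A a].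
Definition lambda_max n (A : 'M[R]_n) : R := sup [set a | eigenvalue A a].

(* S is the positive definite square root of A. *)
Definition is_sqrtmx n (A S : 'M[R]_n) : Prop := posdefmx S /\ S *m S = A.

End matrices.

(* The Borel structure on matrices is the one generated by the coordinates. *)

Definition mx_display (d : measure_display) : measure_display.
Proof. exact: d. Qed.

Section measurable_matrix.
Context {R : realType} (m n : nat).

Definition mx_cylinders : set (set 'M[R]_(m, n)) :=
  [set A | exists i j (B : set R),
     measurable B /\ A = [set M : 'M[R]_(m, n) | B (M i j)]].

HB.instance Definition _ := @isMeasurable.Build (mx_display default_measure_display)
  'M[R]_(m, n) <<s mx_cylinders >> (@sigma_algebra0 _ setT mx_cylinders)
  (@sigma_algebraC _ mx_cylinders) (@sigma_algebra_bigcup _ setT mx_cylinders).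

End measurable_matrix.

Section probability.
Context {R : realType} {d : measure_display} {T : measurableType d}.
Variable P : probability T R.

(* Mutual independence of a finite family of set systems; with F i the
   sigma-algebra generated by X i, mutual independence of the X i. *)
Definition mutually_independent (I : finType) (F : I -> set (set T)) : Prop :=
  forall (J : {set I}) (A : I -> set T), (forall i, i \in J -> F i (A i)) ->
    P (\bigcap_(i in [set` J]) A i) = (\prod_(i in J) P (A i))%E.

Definition generated {d'} {U : measurableType d'} (X : T -> U) : set (set T) :=
  preimage_set_system setT X measurable.

Definition same_law {d'} {U : measurableType d'} (X Y : T -> U) : Prop :=
  forall B : set U, measurable B -> P (X @^-1` B) = P (Y @^-1` B).

Definition mean_vec n (x : T -> 'cV[R]_n) : 'cV[R]_n :=
  \col_i fine 'E_P[fun w => (x w i 0)%R]%E.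

Definition sub_gaussian n (x : T -> 'cV[R]_n) (tau : R) : Prop :=
  forall v : 'cV[R]_n, l2norm v = 1 -> forall lambda : R,
    ('E_P[fun w => expR (lambda * (v^T *m (x w - mean_vec x)) 0 0)%R]
      <= (expR (lambda ^+ 2 * tau ^+ 2 / 2)%R)%:E)%E.

End probability.

(* Stochastic orders along a sequence of probability spaces. The outer
   probability (which is P k on events) dispenses with the measurability of
   X k, needed below because a selection of minimizers may fail to be
   measurable. *)
Section stochastic_order.
Context {R : realType} {d : measure_display} {T : nat -> measurableType d}.
Variable P : forall k, probability (T k) R.
Implicit Types (X : forall k, T k -> R) (b : nat -> R).

Definition bigO_P X b : Prop :=
  forall e : R, 0 < e -> exists2 M : R, 0 < M &
    \forall k \near \oo,
      (mu_ext (P k) [set w | (M < `|X k w / b k|)%R] <= e%:E)%E.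

Definition cvg_P0 X : Prop :=
  forall e : R, 0 < e ->
    mu_ext (P k) [set w | e < `|X k w|] @[k --> \oo] --> 0%E.

End stochastic_order.

(* The data sets are numbered from 0 to L - 1. *)
Record multi_study (R : realType) (d : measure_display) := MultiStudy {
  space : measurableType d;
  Pr : probability space R;
  nL : nat;
  dim : nat;
  nobs : 'I_nL -> nat;
  Sigma : 'I_nL -> 'M[R]_dim;
  Sigma_half : 'I_nL -> 'M[R]_dim;
  Omega : 'M[R]_dim;
  Zmx : forall l, {RV Pr >-> 'M[R]_(nobs l, dim)};
  beta : 'I_nL -> {RV Pr >-> 'cV[R]_dim};
  noise : forall l, {RV Pr >-> 'cV[R]_(nobs l)}
}.

Section model.
Context {R : realType} {d : measure_display}.
Variables (s : multi_study R d) (sigma : R).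
Implicit Types (l : 'I_(nL s)) (w : space s) (A B : 'M[R]_(dim s)).

Definition Xmx l w : 'M[R]_(nobs l, dim s) := Zmx l w *m Sigma_half l.

Definition response l w : 'cV[R]_(nobs l) := Xmx l w *m beta l w + noise l w.

Definition source_sigma (i : 'I_(nL s) + 'I_(nL s) + 'I_(nL s)) :
    set (set (space s)) :=
  match i with
  | inl (inl l) => generated (Xmx l)
  | inl (inr l) => generated (beta l)
  | inr l => generated (noise l)
  end.

Record model_assumptions (M12 : R) : Prop := {
  Sigma_posdef : forall l, posdefmx (Sigma l);
  Sigma_halfP : forall l, is_sqrtmx (Sigma l) (Sigma_half l);
  Omega_posdef : posdefmx (Omega s);
  Z_independent : forall l, mutually_independent (Pr s)
    (fun ij : 'I_(nobs l) * 'I_(dim s) =>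
       generated (fun w => Zmx l w ij.1 ij.2));
  Z_same_law : forall l (i i' : 'I_(nobs l)) (j j' : 'I_(dim s)),
    same_law (Pr s) (fun w => Zmx l w i j) (fun w => Zmx l w i' j');
  Z_mean : forall l (i : 'I_(nobs l)) (j : 'I_(dim s)),
    'E_(Pr s)[fun w => Zmx l w i j]%E = 0%E;
  Z_variance : forall l (i : 'I_(nobs l)) (j : 'I_(dim s)),
    'V_(Pr s)[fun w => Zmx l w i j]%E = 1%E;
  Z_moment12 : forall l (i : 'I_(nobs l)) (j : 'I_(dim s)),
    ('E_(Pr s)[fun w => (Zmx l w i j ^+ 12)%R] <= M12%:E)%E;
  beta_same_law : forall l l', same_law (Pr s) (beta l) (beta l');
  beta_mean : forall l (i : 'I_(dim s)),
    'E_(Pr s)[fun w => (beta l w i 0)%R]%E = 0%E;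
  beta_second_moment : forall l (i j : 'I_(dim s)),
    'E_(Pr s)[fun w => (beta l w i 0 * beta l w j 0)%R]%E
      = ((dim s)%:R^-1 * Omega s i j)%:E;
  noise_mean : forall l (i : 'I_(nobs l)),
    'E_(Pr s)[fun w => (noise l w i 0)%R]%E = 0%E;
  noise_covariance : forall l (i j : 'I_(nobs l)),
    covariance (Pr s) (fun w => noise l w i 0) (fun w => noise l w j 0)
      = ((sigma ^+ 2)%:M i j)%:E;
  sources_independent : mutually_independent (Pr s) source_sigma
}.

Definition loss w A : R :=
  (nL s)%:R^-1 * \sum_l frobenius (response l w *m (response l w)^T
     - (dim s)%:R^-1 *: (Xmx l w *m A *m (Xmx l w)^T) - (sigma ^+ 2)%:M) ^+ 2.

Definition argmin_loss w : set 'M[R]_(dim s) :=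
  [set A | posdefmx A /\ forall B, posdefmx B -> loss w A <= loss w B].

(* The cone of positive definite matrices is open, so the minimum need not be
   attained. *)
Definition attained : set (space s) := [set w | argmin_loss w !=set0].

Definition is_estimator (Omega_hat : space s -> 'M[R]_(dim s)) : Prop :=
  forall w, attained w -> argmin_loss w (Omega_hat w).

Definition est_error (Omega_hat : space s -> 'M[R]_(dim s)) w : R :=
  opnorm (Omega_hat w - Omega s).

End model.

Section asymptotics.
Context {R : realType} {d : measure_display}.
Variables (s : nat -> multi_study R d) (gamma : nat -> R).

(* Since the number L of ratios p / n_l itself grows, their convergence to
   gamma_l is uniform over l < L: pointwise convergence in l would leave the
   sample sizes of most data sets unconstrained. *)
Definition asymptotic_regime : Prop :=
  [/\ (fun k => nL (s k)) @ \oo --> \oo,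
      (fun k => dim (s k)) @ \oo --> \oo,
      forall N, \forall k \near \oo, forall l : 'I_(nL (s k)), (N <= nobs l)%N &
      forall e, 0 < e -> \forall k \near \oo, forall l : 'I_(nL (s k)),
        `|(dim (s k))%:R / (nobs l)%:R - gamma l| < e].

(* p ^ 2 / L *)
Definition rate k : R := (dim (s k))%:R ^+ 2 / (nL (s k))%:R.

End asymptotics.

(* Main.v *)
(** Write X_l, S_l = X_l^T X_l and D = Omega_hat - Omega. A minimiser lies in an open cone,
    hence is stationary: H D = G, where H A = L^-1 sum_l p^-2 S_l A S_l is the Hessian
    and the score G is an average of L independent centred matrices. Fourth moments of
    ||S_l||_F are of order p^6, so E ||G||_F^2 is of order p^2 / L. If p^2 / L is small,
    H is within a small Hilbert-Schmidt distance of its mean, which is coercive because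
    distinct rows of X_l are independent; then ||D||_F <= ||G||_F / c, and the minimum is
    attained. If p^2 / L is bounded below, it suffices to bound the largest eigenvalue a
    of Omega_hat, with unit eigenvector u: a <u, S_l u>^2 <= <S_l u, Omega_hat S_l u>
    (Cauchy-Schwarz), and averaging over l bounds a L^-1 sum_l (<u, S_l u> / p)^2 by
    <u, G u> + <u, (H Omega) u>. The average of <u, S_l u> / p is bounded below uniformly
    in u: replace the square by a clipped Lipschitz function, and compare the maximum over
    a net with that of a linear process by a contraction argument. *)
From HB Require Import structures.
From mathcomp Require Import all_boot all_order all_algebra.
From mathcomp Require Import all_classical all_reals all_analysis.
From mathcomp Require Import measurable_realfun ring lra.
Require Import Defs.

Set Implicit Arguments.
Unset Strict Implicit.
Unset Printing Implicit Defensive.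

Import Order.TTheory GRing.Theory Num.Theory.
Import numFieldNormedType.Exports.

Local Open Scope classical_set_scope.
Local Open Scope ring_scope.

(** * Euclidean and operator norms *)

(** The entries have finitely many moments, so exponential inequalities and union bounds over a net
    are out of reach: every probability below comes from Markov's inequality. The fluctuation of the
    Hessian is therefore measured over all its p^4 coefficients at once, at a cost of order p^2 / L,
    and this forces the separate treatment of rates that are not small. There the target is weak: an
    error at most a constant plus a multiple of ||G||_F is already a multiple of sqrt(p^2 / L). The
    contraction argument replaces the union bound: after linearisation, the maximum over the net is
    at most a multiple of the Euclidean norm of one random vector, of relative size 1 / sqrt L
    whatever the cardinality of the net, which can thus be refined at will. All estimates concern a
    single study, with constants that see the sizes only through a bound [kap] on n / p and p / n;
    sequences enter at the very end. Exceptional events are measurable and do not depend on the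
    minimiser, so that any selection of minimisers is covered. *)

Lemma ler_of_eq (R : numDomainType) (x y : R) : x = y -> x <= y.
Proof. by move=> ->. Qed.

Lemma sum_ord_const (R : pzSemiRingType) n (c : R) : \sum_(i < n) c = n%:R * c.
Proof. by rewrite sumr_const card_ord mulr_natl. Qed.

Section euclidean.
Context {R : realType}.

Definition dot n (u v : 'cV[R]_n) : R := \sum_i u i 0 * v i 0.

Definition nrm2 n (v : 'cV[R]_n) : R := \sum_i v i 0 ^+ 2.

Definition mdot m n (A B : 'M[R]_(m, n)) : R := \sum_i \sum_j A i j * B i j.

Definition fro2 m n (A : 'M[R]_(m, n)) : R := \sum_i \sum_j A i j ^+ 2.

Lemma nrm2_ge0 n (v : 'cV[R]_n) : 0 <= nrm2 v.
Proof. by apply: sumr_ge0 => i _; exact: sqr_ge0. Qed.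

Lemma fro2_ge0 m n (A : 'M[R]_(m, n)) : 0 <= fro2 A.
Proof. by apply: sumr_ge0 => i _; apply: sumr_ge0 => j _; exact: sqr_ge0. Qed.

Lemma sqr_frobenius m n (A : 'M[R]_(m, n)) : frobenius A ^+ 2 = fro2 A.
Proof. by rewrite sqr_sqrtr ?fro2_ge0. Qed.

Lemma sqr_l2norm n (v : 'cV[R]_n) : l2norm v ^+ 2 = nrm2 v.
Proof. by rewrite sqr_sqrtr ?nrm2_ge0. Qed.

Lemma dot_nrm2 n (v : 'cV[R]_n) : dot v v = nrm2 v.
Proof. by apply: eq_bigr => i _; rewrite expr2. Qed.

Lemma mdot_fro2 m n (A : 'M[R]_(m, n)) : mdot A A = fro2 A.
Proof. by apply: eq_bigr => i _; apply: eq_bigr => j _; rewrite expr2. Qed.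

Lemma dotC n (u v : 'cV[R]_n) : dot u v = dot v u.
Proof. by apply: eq_bigr => i _; rewrite mulrC. Qed.

Lemma dotE n (u v : 'cV[R]_n) : dot u v = (u^T *m v) 0 0.
Proof. by rewrite mxE; apply: eq_bigr => i _; rewrite mxE. Qed.

Lemma mdotE m n (A B : 'M[R]_(m, n)) : mdot A B = \tr (A^T *m B).
Proof.
rewrite /mdot exchange_big; apply: eq_bigr => j _; rewrite mxE.
by apply: eq_bigr => i _; rewrite mxE.
Qed.

Lemma dotDr n (u v w : 'cV[R]_n) : dot u (v + w) = dot u v + dot u w.
Proof. by rewrite -big_split; apply: eq_bigr => i _; rewrite mxE mulrDr. Qed.

Lemma dotZr n a (u v : 'cV[R]_n) : dot u (a *: v) = a * dot u v.
Proof. by rewrite mulr_sumr; apply: eq_bigr => i _; rewrite mxE mulrCA. Qed.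

Lemma dotDl n (u v w : 'cV[R]_n) : dot (v + w) u = dot v u + dot w u.
Proof. by rewrite !(dotC _ u) dotDr. Qed.

Lemma dotZl n a (u v : 'cV[R]_n) : dot (a *: v) u = a * dot v u.
Proof. by rewrite !(dotC _ u) dotZr. Qed.

Lemma dot_mulmx m n (A : 'M[R]_(m, n)) (u : 'cV[R]_m) (v : 'cV[R]_n) :
  dot u (A *m v) = dot (A^T *m u) v.
Proof. by rewrite !dotE trmx_mul trmxK mulmxA. Qed.

Lemma quadE n (A : 'M[R]_n) (v : 'cV[R]_n) :
  (v^T *m A *m v) 0 0 = dot v (A *m v).
Proof. by rewrite dotE mulmxA. Qed.

Lemma nrm2Z n a (v : 'cV[R]_n) : nrm2 (a *: v) = a ^+ 2 * nrm2 v.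
Proof. by rewrite -!dot_nrm2 dotZl dotZr mulrA expr2. Qed.

Lemma nrm2D_le n (u v : 'cV[R]_n) : nrm2 (u + v) <= 2 * (nrm2 u + nrm2 v).
Proof.
rewrite mulrDr !mulr_sumr -big_split; apply: ler_sum => i _; rewrite mxE /=.
by have := sqr_ge0 (u i 0 - v i 0); nra.
Qed.

Lemma nrm2N n (v : 'cV[R]_n) : nrm2 (- v) = nrm2 v.
Proof. by apply: eq_bigr => i _; rewrite mxE sqrrN. Qed.

Lemma nrm2_eq0 n (v : 'cV[R]_n) : nrm2 v = 0 -> v = 0.
Proof.
move=> v0; apply/matrixP => i j; rewrite (ord1 j) mxE; apply/eqP.
have := v0; move=> /eqP; rewrite psumr_eq0 => [/allP|k _]; last exact: sqr_ge0.
by move=> /(_ i (mem_index_enum _)); rewrite sqrf_eq0.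
Qed.

Lemma nrm2_gt0 n (v : 'cV[R]_n) : v != 0 -> 0 < nrm2 v.
Proof. by move=> v0; rewrite lt_def nrm2_ge0 andbT; apply: contra_neq v0; exact: nrm2_eq0. Qed.

Lemma nrm2_eq1 n (v : 'cV[R]_n) : nrm2 v = 1 -> v != 0.
Proof.
move=> v1; apply: contra_eq_neq v1 => ->.
by rewrite -[X in nrm2 X](scale0r 0) nrm2Z expr0n mul0r eq_sym oner_eq0.
Qed.

Lemma nrm2_sqr n (v : 'cV[R]_n) : nrm2 v ^+ 2 = \sum_q (v q.1 0 * v q.2 0) ^+ 2.
Proof.
rewrite -(pair_bigA _ (fun i j => (v i 0 * v j 0) ^+ 2)) expr2 /= big_distrlr.
by apply: eq_bigr => i _; apply: eq_bigr => j _ /=; rewrite exprMn.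
Qed.

Lemma fro2_eq0 m n (A : 'M[R]_(m, n)) : fro2 A = 0 -> A = 0.
Proof.
move=> /eqP; rewrite psumr_eq0 => [/allP A0|i _]; last first.
  by apply: sumr_ge0 => j _; exact: sqr_ge0.
apply/matrixP => i j; rewrite mxE; apply/eqP.
have := A0 i (mem_index_enum _); rewrite /= psumr_eq0 => [/allP|k _]; last exact: sqr_ge0.
by move=> /(_ j (mem_index_enum _)); rewrite sqrf_eq0.
Qed.

Lemma cauchy_schwarz_sum (I : finType) (a b : I -> R) :
  (\sum_i a i * b i) ^+ 2 <= (\sum_i a i ^+ 2) * (\sum_i b i ^+ 2).
Proof.
set A := \sum_i a i ^+ 2; set B := \sum_i b i ^+ 2; set C := \sum_i _.
have A0 : 0 <= A by apply: sumr_ge0 => i _; exact: sqr_ge0.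
have H t : 0 <= A - 2 * t * C + t ^+ 2 * B.
  have -> : A - 2 * t * C + t ^+ 2 * B = \sum_i (a i - t * b i) ^+ 2.
    rewrite /A /B /C !mulr_sumr -sumrB -big_split; apply: eq_bigr => i _ /=; ring.
  by apply: sumr_ge0 => i _; exact: sqr_ge0.
have B0 : 0 <= B by apply: sumr_ge0 => i _; exact: sqr_ge0.
have [Bp|] := ltP 0 B; last first.
  move=> B1; have {B1}B_0 : B = 0 by apply/eqP; rewrite eq_le B1.
  have [->|C0] := eqVneq C 0; first by rewrite expr0n mulr_ge0.
  (* With B = 0 the quadratic in t is affine, and this value of t makes it equal to -1. *)
  have := H ((A + 1) / (2 * C)); rewrite B_0 mulr0 addr0.
  have -> : 2 * ((A + 1) / (2 * C)) * C = A + 1 by field.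
  lra.
have := H (C / B).
have -> : A - 2 * (C / B) * C + (C / B) ^+ 2 * B = A - C ^+ 2 / B.
  by field; exact: lt0r_neq0.
by rewrite subr_ge0 ler_pdivrMr.
Qed.

Lemma cauchy_schwarz_dot n (u v : 'cV[R]_n) : dot u v ^+ 2 <= nrm2 u * nrm2 v.
Proof. exact: cauchy_schwarz_sum. Qed.

Lemma cauchy_schwarz_mdot m n (A B : 'M[R]_(m, n)) :
  mdot A B ^+ 2 <= fro2 A * fro2 B.
Proof.
rewrite /mdot /fro2 !pair_big_dep /=.
exact: (cauchy_schwarz_sum (fun ij : 'I_m * 'I_n => A ij.1 ij.2)).
Qed.

Lemma nrm2_mulmx m n (A : 'M[R]_(m, n)) (v : 'cV[R]_n) :
  nrm2 (A *m v) <= fro2 A * nrm2 v.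
Proof.
rewrite mulr_suml; apply: ler_sum => i _; rewrite mxE.
exact: (cauchy_schwarz_sum (fun j => A i j)).
Qed.

Lemma fro2_col m n (A : 'M[R]_(m, n)) : fro2 A = \sum_j nrm2 (col j A).
Proof.
rewrite /fro2 exchange_big; apply: eq_bigr => j _.
by apply: eq_bigr => i _; rewrite mxE.
Qed.

Lemma fro2_tr m n (A : 'M[R]_(m, n)) : fro2 A^T = fro2 A.
Proof.
rewrite /fro2 exchange_big; apply: eq_bigr => j _.
by apply: eq_bigr => i _; rewrite mxE.
Qed.

(** The squared Frobenius norm is the sum over columns, and A acts on each column of B
    separately. *)
Lemma fro2_mulmx_le c m n k (A : 'M[R]_(m, n)) (B : 'M[R]_(n, k)) :
  (forall v, nrm2 (A *m v) <= c * nrm2 v) -> fro2 (A *m B) <= c * fro2 B.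
Proof.
move=> Ac; rewrite !fro2_col mulr_sumr; apply: ler_sum => j _.
by rewrite colE -mulmxA -colE; exact: Ac.
Qed.

Lemma fro2_mulmx m n k (A : 'M[R]_(m, n)) (B : 'M[R]_(n, k)) :
  fro2 (A *m B) <= fro2 A * fro2 B.
Proof. by apply: fro2_mulmx_le => v; exact: nrm2_mulmx. Qed.

Lemma opnorm_ge0 m n (A : 'M[R]_(m, n)) : 0 <= opnorm A.
Proof.
rewrite /opnorm; set S := [set _ | _ in _].
(* [sup] is 0 on a set without supremum; otherwise the set contains the value 0, taken at the zero
   vector. *)
have [[_ [x Sx]]|h] := pselect (has_sup S); last by rewrite sup_out.
apply: le_trans (ub_le_sup _ (_ : S 0)) => //.
  by exists x.
exists 0; first by rewrite /= /l2norm big1 ?sqrtr0// => i _; rewrite mxE expr0n.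
by rewrite mulmx0 /l2norm big1 ?sqrtr0// => i _; rewrite mxE expr0n.
Qed.

Lemma opnorm_le m n (A : 'M[R]_(m, n)) c : 0 <= c ->
  (forall v, nrm2 (A *m v) <= c ^+ 2 * nrm2 v) -> opnorm A <= c.
Proof.
move=> c0 Ac; apply: ge_sup.
  exists (l2norm (A *m 0)); exists 0 => //=.
  by rewrite /l2norm big1 ?sqrtr0// => i _; rewrite mxE expr0n.
move=> _ [v /= v1 <-].
rewrite -(@ler_pXn2r _ 2) ?nnegrE ?sqrtr_ge0// sqr_l2norm (le_trans (Ac v))//.
rewrite ler_piMr ?sqr_ge0// -sqr_l2norm expr_le1// sqrtr_ge0//.
Qed.

Lemma opnorm_fro2 m n (A : 'M[R]_(m, n)) c : 0 <= c -> fro2 A <= c ^+ 2 ->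
  opnorm A <= c.
Proof.
move=> c0 Ac; apply: opnorm_le => // v; rewrite (le_trans (nrm2_mulmx _ _))//.
by rewrite ler_wpM2r// nrm2_ge0.
Qed.

End euclidean.

(** * Rayleigh quotients and positive semidefinite matrices *)

Section rayleigh.
Context {R : realType}.

(** First-order optimality condition: for t small with the sign opposite to a, the linear term
    dominates the quadratic one. It serves for the maximiser of the Rayleigh quotient and for the
    minimiser of the loss. *)
Lemma lin_coef_eq0 (a b e : R) : 0 < e ->
  (forall t, `|t| <= e -> 0 <= a * t + b * t ^+ 2) -> a = 0.
Proof.
move=> e0 H; apply/eqP; apply/negP => /negP a0.
have b0 : 0 < `|b| + 1 by rewrite ltr_pwDr.
pose t := Num.min e (`|a| / (2 * (`|b| + 1))).
have t0 : 0 < t by rewrite lt_min e0 divr_gt0 ?normr_gt0// mulr_gt0.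
have te : t <= e by rewrite ge_min lexx.
have ta : t * (2 * (`|b| + 1)) <= `|a|.
  by rewrite -ler_pdivlMr ?mulr_gt0// ge_min lexx orbT.
have := H t; have := H (- t); rewrite normrN gtr0_norm// => /(_ te) + /(_ te).
have bt : b * t ^+ 2 < `|a| * t.
  rewrite expr2 mulrA ltr_pM2r// (lt_le_trans _ ta)// mulrC ltr_pM2l//.
  by rewrite (le_lt_trans (ler_norm b))//; have := normr_ge0 b; lra.
by rewrite sqrrN; move: bt; case: (ger0P a) => ? bt; nra.
Qed.

Lemma rayleigh n (A : 'M[R]_n.+1) : A^T = A -> exists u : 'cV[R]_n.+1,
  exists2 m : R, nrm2 u = 1 /\ A *m u = m *: u &
  forall v, dot v (A *m v) <= m * nrm2 v.
Proof.
move=> AT.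
pose q (v : 'rV[R]_n.+1) : R := \sum_i v 0 i ^+ 2.
pose f (v : 'rV[R]_n.+1) : R := \sum_i v 0 i * \sum_j A i j * v 0 j.
have ccoord i : continuous (fun v : 'rV[R]_n.+1 => v 0 i) by exact: coord_continuous.
have csum (g : 'I_n.+1 -> 'rV[R]_n.+1 -> R) :
    (forall i, continuous (g i)) -> continuous (fun v => \sum_i g i v).
  move=> cg; have cadd : continuous (fun z : R * R => z.1 + z.2).
    exact: (@add_continuous R^o).
  exact: (continuous_big cadd (fun i _ => cg i)).
have cM (g h : 'rV[R]_n.+1 -> R) : continuous g -> continuous h ->
    continuous (fun v => g v * h v).
  by move=> cg ch v; exact: (cvgM (cg v) (ch v)).
have cq : continuous q.
  have -> : q = (fun v => \sum_i v 0 i * v 0 i).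
    by apply/funext => v; apply: eq_bigr => i _; rewrite expr2.
  by apply: csum => i; apply: cM; exact: ccoord.
have cf : continuous f.
  have cA i : continuous (fun v : 'rV[R]_n.+1 => \sum_j A i j * v 0 j).
    by apply: csum => j; apply: cM; [exact: cst_continuous|exact: ccoord].
  by apply: csum => i; apply: cM; [exact: ccoord|exact: cA].
pose S := [set v | q v = 1].
have S0 : S !=set0.
  exists (delta_mx 0 0); rewrite /S /= /q (bigD1 ord0)//= !mxE !eqxx expr1n.
  by rewrite big1 ?addr0// => i i0; rewrite mxE (negbTE i0) andbF expr0n.
have Sc : compact S.
  apply: (@subclosed_compact _ _
    [set v : 'rV[R]_n.+1 | forall i, v ord0 i \in `[(- 1), 1]]).
  - by apply: (@preimage_closed _ _ q [set 1]) => //; exact: closed_eq.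
    have := @rV_compact R n.+1 (fun=> `[(- 1 : R), 1]%classic) (fun=> @segment_compact R _ _).
    by [].
  - move=> v qv i; rewrite in_itv /= -ler_norml -(@ler_pXn2r _ 2) ?nnegrE//.
    rewrite real_normK ?num_real// expr1n -qv /q (bigD1 i)//= lerDl.
    by apply: sumr_ge0 => j _; exact: sqr_ge0.
have [c] := compact_EVT_max S0 Sc (continuous_subspaceT cf).
rewrite inE => qc cmax.
have fE v : f v = dot v^T (A *m v^T).
  apply: eq_bigr => i _; rewrite !mxE; congr (_ * _).
  by apply: eq_bigr => j _; rewrite mxE.
have qE v : q v = nrm2 v^T by apply: eq_bigr => i _; rewrite mxE.
have max v : dot v (A *m v) <= f c * nrm2 v.
  have [v0|v0] := eqVneq (nrm2 v) 0.
    by rewrite (nrm2_eq0 v0) mulmx0 dot_nrm2 -[X in nrm2 X](scale0r 0) nrm2Z expr0n mul0r mulr0.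
  have vp : 0 < nrm2 v by rewrite lt_def v0 nrm2_ge0.
  pose s := Num.sqrt (nrm2 v).
  have s0 : 0 < s by rewrite sqrtr_gt0.
  have ss : s ^+ 2 = nrm2 v by rewrite sqr_sqrtr// ltW.
  have := cmax (s^-1 *: v)^T; rewrite inE /S /= qE trmxK nrm2Z exprVn ss mulVf// => /(_ erefl).
  rewrite fE trmxK -scalemxAr dotZl dotZr mulrA -expr2 exprVn ss.
  by rewrite ler_pdivrMl// mulrC.
exists c^T; exists (f c) => //; split; first by rewrite -qE.
apply/eqP; rewrite -subr_eq0; apply/eqP; apply: nrm2_eq0.
(* The residual k of the eigenvector equation is also the direction of perturbation: along it the
   gap to the maximum has linear coefficient -2 |k|^2. The existential keeps k opaque during the
   expansion. *)
have [k kE] : exists k, k = A *m c^T - f c *: c^T by eexists.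
rewrite -kE; have : 2 * - nrm2 k = 0; last by lra.
have mc : dot c^T (A *m c^T) = f c * nrm2 c^T by rewrite -fE -qE qc mulr1.
apply: (@lin_coef_eq0 _ (f c * nrm2 k - dot k (A *m k)) 1) => // t _.
have := max (c^T + t *: k); rewrite -subr_ge0.
rewrite -!dot_nrm2 mulmxDr -scalemxAr !(dotDl, dotDr, dotZl, dotZr).
rewrite mc dot_nrm2.
have -> : dot c^T (A *m k) = dot k (A *m c^T) by rewrite dot_mulmx AT dotC.
have -> : dot k (A *m c^T) = dot k k + f c * dot k c^T.
  have -> : A *m c^T = k + f c *: c^T by rewrite kE subrK.
  by rewrite dotDr dotZr.
rewrite (dotC c^T k) !dot_nrm2 => h; apply: le_trans h _.
by apply: ler_of_eq; ring.
Qed.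

Lemma eigenvalueP_sym n (A : 'M[R]_n.+1) (u : 'cV[R]_n.+1) m : A^T = A ->
  nrm2 u = 1 -> A *m u = m *: u -> eigenvalue A m.
Proof.
move=> AT u1 Au; apply/eigenvalueP; exists u^T.
  by rewrite -[A in LHS]AT -trmx_mul Au linearZ.
by apply: contra_neq (nrm2_eq1 u1) => /(congr1 trmx); rewrite trmxK trmx0.
Qed.

Lemma rayleigh_min n (A : 'M[R]_n.+1) : A^T = A -> exists u : 'cV[R]_n.+1,
  exists2 m : R, nrm2 u = 1 /\ A *m u = m *: u &
  forall v, m * nrm2 v <= dot v (A *m v).
Proof.
move=> AT; have [|u [m [u1 um] mP]] := @rayleigh _ (- A).
  by rewrite linearN/= AT.
exists u, (- m); first by rewrite scaleNr -um mulNmx opprK.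
move=> v; have := mP v.
by rewrite mulNmx -scaleN1r dotZr mulN1r mulNr; lra.
Qed.

Lemma eigenvalue_quad n (A : 'M[R]_n) a : A^T = A -> eigenvalue A a ->
  exists2 v : 'cV[R]_n, 0 < nrm2 v & dot v (A *m v) = a * nrm2 v.
Proof.
move=> AT /eigenvalueP[v vA v0]; exists v^T.
  rewrite lt_def nrm2_ge0 andbT; apply: contra_neq v0 => /nrm2_eq0 v0.
  by rewrite -[v]trmxK v0 trmx0.
by rewrite -[A in LHS]AT -trmx_mul vA linearZ/= dotZr dot_nrm2.
Qed.

(** The Rayleigh minimum is an eigenvalue and bounds the spectrum below, so the infimum is not a
    default value. In dimension zero both sides vanish. *)
Lemma lambda_min_quad n (A : 'M[R]_n) (v : 'cV[R]_n) : A^T = A ->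
  lambda_min A * nrm2 v <= dot v (A *m v).
Proof.
case: n A v => [|n] A v AT; first by rewrite /nrm2 /dot !big_ord0 mulr0.
have [u [m [u1 um] mP]] := rayleigh_min AT.
apply: le_trans (mP v); rewrite ler_wpM2r ?nrm2_ge0//.
apply: ge_inf; last exact: eigenvalueP_sym AT u1 um.
exists m => a /(eigenvalue_quad AT)[w w0 wa].
by have := mP w; rewrite wa ler_pM2r.
Qed.

Lemma lambda_max_quad n (A : 'M[R]_n) (v : 'cV[R]_n) : A^T = A ->
  dot v (A *m v) <= lambda_max A * nrm2 v.
Proof.
case: n A v => [|n] A v AT; first by rewrite /nrm2 /dot !big_ord0 mulr0.
have [u [m [u1 um] mP]] := rayleigh AT.
apply: le_trans (mP v) _; rewrite ler_wpM2r ?nrm2_ge0//.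
apply: ub_le_sup; last exact: eigenvalueP_sym AT u1 um.
exists m => a /(eigenvalue_quad AT)[w w0 wa].
by have := mP w; rewrite wa ler_pM2r.
Qed.

Lemma posdefmx_quad_lb n (A : 'M[R]_n) : posdefmx A ->
  exists2 m : R, 0 < m & forall v, m * nrm2 v <= dot v (A *m v).
Proof.
case: n A => [|n] A [AT Ap].
  by exists 1 => // v; rewrite /nrm2 /dot !big_ord0 mulr0.
have [u [m [u1 um] mP]] := rayleigh_min AT.
exists m => //; have := Ap u.
by rewrite quadE um dotZr dot_nrm2 u1 mulr1; apply; exact: nrm2_eq1.
Qed.

Lemma posdefmx_ge0 n (A : 'M[R]_n) (v : 'cV[R]_n) : posdefmx A ->
  0 <= dot v (A *m v).
Proof.
move=> /posdefmx_quad_lb[m m0 mP].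
by rewrite (le_trans _ (mP v))// mulr_ge0 ?nrm2_ge0// ltW.
Qed.

Lemma psd_cauchy_schwarz n (A : 'M[R]_n) (u v : 'cV[R]_n) : A^T = A ->
  (forall w, 0 <= dot w (A *m w)) ->
  dot u (A *m v) ^+ 2 <= dot u (A *m u) * dot v (A *m v).
Proof.
move=> AT A0; set a := dot u (A *m u); set b := dot v (A *m v).
set c := dot u (A *m v).
have H t : 0 <= a - 2 * t * c + t ^+ 2 * b.
  have := A0 (u - t *: v).
  rewrite -scaleN1r scalerA mulN1r mulmxDr -scalemxAr !(dotDl, dotDr, dotZl, dotZr).
  rewrite (_ : dot v (A *m u) = c); last by rewrite dot_mulmx AT dotC.
  rewrite -/a -/b -/c => h; apply: le_trans h _.
  by apply: ler_of_eq; ring.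
have a0 : 0 <= a := A0 u; have b0 : 0 <= b := A0 v.
have [bp|b1] := ltP 0 b.
  have := H (c / b).
  have -> : a - 2 * (c / b) * c + (c / b) ^+ 2 * b = a - c ^+ 2 / b.
    by field; exact: lt0r_neq0.
  by rewrite subr_ge0 ler_pdivrMr.
have {b1}b_0 : b = 0 by apply/eqP; rewrite eq_le b1.
have [->|c0] := eqVneq c 0; first by rewrite expr0n mulr_ge0.
have := H ((a + 1) / (2 * c)); rewrite b_0 mulr0 addr0.
have -> : 2 * ((a + 1) / (2 * c)) * c = a + 1 by field.
lra.
Qed.

(** Cauchy-Schwarz for the form of A, applied to A v and v, gives |A v|^4 <= (m |A v|^2) (m
    |v|^2). *)
Lemma psd_nrm2_le n (A : 'M[R]_n) (v : 'cV[R]_n) m : A^T = A ->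
  (forall w, 0 <= dot w (A *m w) <= m * nrm2 w) ->
  nrm2 (A *m v) <= m ^+ 2 * nrm2 v.
Proof.
move=> AT Am; have [/andP[a0 a1] /andP[b0 b1]] := (Am v, Am (A *m v)).
have := psd_cauchy_schwarz (A *m v) v AT (fun w => proj1 (andP (Am w))).
rewrite dot_nrm2 => h.
have n0 := nrm2_ge0 (A *m v); have v0 := nrm2_ge0 v.
have [np|] := ltP 0 (nrm2 (A *m v)); last first.
  by move=> n1; rewrite (le_trans n1)// mulr_ge0 ?sqr_ge0.
have : nrm2 (A *m v) ^+ 2 <= (m * nrm2 (A *m v)) * (m * nrm2 v).
  by apply: le_trans h _; exact: ler_pM.
rewrite expr2 [X in _ <= X](_ : _ = nrm2 (A *m v) * (m ^+ 2 * nrm2 v)).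
  by rewrite ler_pM2l.
by ring.
Qed.

End rayleigh.

(** * Independence and decoupling *)

Section decoupling.
Local Open Scope ereal_scope.
Context {R : realType} {d d1 d2 : measure_display} {T : measurableType d}
  {U : measurableType d1} {V : measurableType d2}.
Variables (P : probability T R) (X : {mfun T >-> U}) (Y : {mfun T >-> V}).
Hypothesis XY_indep : forall A B, measurable A -> measurable B ->
  P (X @^-1` A `&` Y @^-1` B) = P (X @^-1` A) * P (Y @^-1` B).

Let XY w := (X w, Y w).
Let mXY : measurable_fun setT XY.
Proof. exact: measurable_fun_pair. Qed.
HB.instance Definition _ := isMeasurableFun.Build _ _ _ _ XY mXY.

Lemma joint_distribution (S : set (U * V)) : measurable S ->
  distribution P XY S = (distribution P X \x distribution P Y) S.
Proof.
move=> mS; apply/esym/product_measure_unique => // A B mA mB.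
Qed.

(** Tonelli for the joint law, pulled back to T: the variable w' plays the role of an independent
    copy, so no product space appears in later statements. *)
Lemma ge0_decoupling (f : U * V -> \bar R) :
  measurable_fun [set: U * V] f -> (forall z, 0 <= f z) ->
  \int[P]_w f (X w, Y w) = \int[P]_w \int[P]_w' f (X w, Y w').
Proof.
move=> mf f0.
transitivity (\int[distribution P XY]_z f z).
  by rewrite ge0_integral_distribution.
rewrite (eq_measure_integral (distribution P X \x distribution P Y)); last first.
  by move=> S mS _; exact: joint_distribution.
rewrite fubini_tonelli1// ge0_integral_distribution//=; last 2 first.
- exact: measurable_fun_fubini_tonelli_F.
- by move=> x; apply: integral_ge0.
apply: eq_integral => w _; rewrite /fubini_F ge0_integral_distribution//.
by apply: measurableT_comp => //; exact: pair1_measurable.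
Qed.

Lemma integrable_decoupling (f : U * V -> \bar R) :
  measurable_fun [set: U * V] f -> P.-integrable setT (fun w => f (X w, Y w)) ->
  (distribution P X \x distribution P Y).-integrable [set: U * V] f.
Proof.
move=> mf intf; apply/integrable12ltyP => //.
have mabs : measurable_fun [set: U * V] (abse \o f) by exact: measurableT_comp.
case/integrableP: intf => _; rewrite (ge0_decoupling mabs) => [|z]; last first.
  exact: abse_ge0.
rewrite ge0_integral_distribution; last 2 first.
- by apply: (measurable_fun_fubini_tonelli_F (abse \o f) mabs) => z; exact: abse_ge0.
- by move=> x; apply: integral_ge0.
rewrite [X in _ -> X < _](eq_integral
    (fun w => \int[P]_w' (abse \o f) (X w, Y w')))//.
move=> w _ /=; rewrite ge0_integral_distribution//.
by apply: (measurableT_comp mabs); exact: pair1_measurable.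
Qed.

Lemma decoupling (f : U * V -> \bar R) :
  measurable_fun [set: U * V] f -> P.-integrable setT (fun w => f (X w, Y w)) ->
  P.-integrable setT (fun w => \int[distribution P Y]_y f (X w, y)) /\
  \int[P]_w f (X w, Y w) = \int[P]_w \int[distribution P Y]_y f (X w, y).
Proof.
move=> mf intf; have intf2 := integrable_decoupling mf intf.
have intF : P.-integrable setT
    ((fun x => \int[distribution P Y]_y f (x, y)) \o X).
  have := integrable_fubini_F intf2.
  case/integrableP => mF; rewrite ge0_integral_distribution//; last first.
    exact: measurableT_comp.
  by move=> ?; apply/integrableP; split => //; exact: measurableT_comp.
split => //.
transitivity (\int[distribution P XY]_z f z).
  by rewrite integral_distribution.
rewrite (eq_measure_integral (distribution P X \x distribution P Y)); last first.
  by move=> S mS _; exact: joint_distribution.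
rewrite -integral12_prod_meas1// integral_distribution//.
by case/integrableP: (integrable_fubini_F intf2).
Qed.

End decoupling.

(** * Sigma-algebras generated by groups of independent sources *)

Section independent_family.
Context {R : realType} {d : measure_display} {T : measurableType d}
  (P : probability T R) {K : finType} (F : K -> set (set T)).
Hypothesis F_measurable : forall k, F k `<=` measurable.
Hypothesis F_setT : forall k, F k setT.
Hypothesis F_setI : forall k, setI_closed (F k).
Hypothesis F_indep : mutually_independent P F.

(** These sets form a pi-system that generates the sigma-algebra of the sources in J, as the
    uniqueness theorem for measures requires. *)
Definition cylinders (J : {set K}) : set (set T) :=
  [set A | exists2 B : K -> set T, (forall k, k \in J -> F k (B k)) &
    A = \bigcap_(k in [set` J]) B k].

Lemma cylinders_setI J : setI_closed (cylinders J).
Proof.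
move=> _ _ [A FA ->] [B FB ->]; exists (fun k => A k `&` B k).
  by move=> k kJ; apply: F_setI; [exact: FA|exact: FB].
by rewrite bigcapI.
Qed.

Lemma cylinders_setT J : cylinders J setT.
Proof.
exists (fun=> setT) => // ; apply/esym; rewrite -subTset => x _ k _; exact: I.
Qed.

Lemma cylinders_measurable J : cylinders J `<=` measurable.
Proof.
move=> _ [A FA ->]; apply: fin_bigcap_measurable => // k kJ.
by apply/F_measurable/FA.
Qed.

Lemma sub_cylinders (J J' : {set K}) : J \subset J' -> cylinders J `<=` cylinders J'.
Proof.
move=> /fintype.subsetP sJ _ [A FA ->].
exists (fun k => if k \in J then A k else setT).
  by move=> k _; case: ifPn => // kJ; exact: FA.
apply/seteqP; split=> x Ax k /= kJ; first by case: ifPn => // ?; exact: Ax.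
by have := Ax k; rewrite /= kJ; apply; exact: sJ.
Qed.

Lemma cylinders1 (J : {set K}) k A : k \in J -> F k A -> cylinders J A.
Proof.
move=> kJ FA; exists (fun k' => if k' == k then A else setT).
  by move=> k' _; case: eqVneq => [->//|].
apply/seteqP; split=> x; first by move=> Ax k' _ /=; case: eqVneq.
by move=> /(_ k kJ); rewrite eqxx.
Qed.

Lemma cylinders_indep (J J' : {set K}) A A' : [disjoint J & J']%B ->
  cylinders J A -> cylinders J' A' -> (P (A `&` A') = P A * P A')%E.
Proof.
move=> dJ [B FB ->] [B' FB' ->].
pose C k := if k \in J then B k else B' k.
have CJ : \bigcap_(k in [set` J]) B k = \bigcap_(k in [set` J]) C k.
  by apply: eq_bigcapr => k /= kJ; rewrite /C kJ.
have CJ' : \bigcap_(k in [set` J']) B' k = \bigcap_(k in [set` J']) C k.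
  apply: eq_bigcapr => k /= kJ; rewrite /C; case: ifPn => // kJ'.
  by have := disjointFr dJ kJ'; rewrite kJ.
have FC k : k \in J :|: J' -> F k (C k).
  by rewrite inE /C; case: ifPn => [kJ _|_ /= kJ]; [exact: FB|exact: FB'].
rewrite CJ CJ'.
have -> : \bigcap_(k in [set` J]) C k `&` \bigcap_(k in [set` J']) C k =
    \bigcap_(k in [set` J :|: J']) C k.
  rewrite -bigcap_setU; congr (\bigcap_(k in _) C k).
  apply/seteqP; split => k /=; first by case=> kJ; rewrite inE kJ ?orbT.
  by rewrite inE => /orP[]; [left|right].
rewrite F_indep// F_indep => [|k kJ]; last by apply: FC; rewrite inE kJ.
rewrite F_indep => [|k kJ]; last by apply: FC; rewrite inE kJ orbT.
rewrite -bigU//; apply: eq_bigl => k; by rewrite !inE.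
Qed.

Lemma sigma_cylinders_measurable J : <<s cylinders J >> `<=` measurable.
Proof.
apply: smallest_sub; first exact: sigma_algebra_measurable.
exact: cylinders_measurable.
Qed.

(** As functions of A, both sides are finite measures, and they agree on a generating pi-system.
    Used once for each of the two groups, it lifts independence from cylinders to sigma-algebras. *)
Lemma indep_cylinders_sigma J A B : measurable B ->
  (forall C, cylinders J C -> (P (C `&` B) = P C * P B)%E) ->
  <<s cylinders J >> A -> (P (A `&` B) = P A * P B)%E.
Proof.
move=> mB CB sA.
have PB0 : (0 <= fine (P B))%R by rewrite fine_ge0.
have EB : P B = (fine (P B))%:E by rewrite fineK// fin_num_measure.
have -> : (P A * P B = mscale (NngNum PB0) P A)%E by rewrite /mscale/= muleC -EB.
have -> : P (A `&` B) = mrestr P mB A by [].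
apply: (g_sigma_algebra_measure_unique (cylinders J) _ (fun=> setT)) => //.
- exact: cylinders_measurable.
- by move=> _; exact: cylinders_setT.
- by rewrite bigcup_const.
- exact: cylinders_setI.
- by move=> C cC; rewrite /= /mrestr /mscale/= -EB muleC; exact: CB.
- by move=> _; rewrite /= /mrestr setTI (le_lt_trans (probability_le1 _ mB))// ltry.
Qed.

Lemma sigma_cylinders_indep (J J' : {set K}) A A' : [disjoint J & J']%B ->
  <<s cylinders J >> A -> <<s cylinders J' >> A' ->
  (P (A `&` A') = P A * P A')%E.
Proof.
move=> dJ sA sA'; apply: (indep_cylinders_sigma _ _ sA) => [|C cC].
  exact: sigma_cylinders_measurable sA'.
rewrite setIC muleC; apply: (indep_cylinders_sigma _ _ sA') => [|C' cC'].
  exact: cylinders_measurable cC.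
by rewrite setIC muleC; exact: (cylinders_indep dJ).
Qed.

End independent_family.

(** * Real-valued expectations and one-sided moment bounds *)

Section real_expectation.
Context {R : realType} {d : measure_display} {T : measurableType d}.
Variable P : probability T R.
Implicit Types (f g : T -> R) (c : R).

Definition integ f := P.-integrable setT (EFin \o f).

Definition Ex f : R := \int[P]_w f w.

(** The real-valued [Ex] takes a default value when the integral is infinite, so a bound on it means
    nothing without integrability; the two are carried together. *)
Definition mean_le f c := [/\ forall w, 0 <= f w, integ f & Ex f <= c].

Lemma integ_measurable f : integ f -> measurable_fun setT f.
Proof. by move=> /measurable_int/measurable_EFinP. Qed.

Lemma integD f g : integ f -> integ g -> integ (fun w => f w + g w).
Proof. by move=> fi gi; exact: (integrableD measurableT fi gi). Qed.

Lemma integZ c f : integ f -> integ (fun w => c * f w).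
Proof. by move=> fi; exact: (integrableZl measurableT c fi). Qed.

Lemma integZr c f : integ f -> integ (fun w => f w * c).
Proof.
move=> fi; under eq_fun do rewrite mulrC.
exact: integZ.
Qed.

Lemma integB f g : integ f -> integ g -> integ (fun w => f w - g w).
Proof. by move=> fi gi; exact: (integrableB measurableT fi gi). Qed.

Lemma integ_cst c : integ (fun=> c).
Proof.
exact: finite_measure_integrable_cst.
Qed.

Lemma integ_sum (I : Type) (r : seq I) (Q : pred I) (f : I -> T -> R) :
  (forall i, Q i -> integ (f i)) -> integ (fun w => \sum_(i <- r | Q i) f i w).
Proof.
move=> fi; elim: r => [|i r IH].
  by under eq_fun do rewrite big_nil; exact: integ_cst.
under eq_fun do rewrite big_cons.
case: (boolP (Q i)) => // Qi; by apply: integD => //; exact: fi.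
Qed.

Lemma integ_le f g : measurable_fun setT f -> (forall w, `|f w| <= g w) ->
  integ g -> integ f.
Proof.
move=> mf fg gi; apply: (le_integrable measurableT _ _ gi).
  exact/measurable_EFinP.
by move=> w _; rewrite /= lee_fin (le_trans (fg w))// ler_norm.
Qed.

Lemma integ_abs f : integ f -> integ (fun w => `|f w|).
Proof.
move=> fi; have mf := integ_measurable fi.
by move/(integrable_abse): fi.
Qed.

Lemma ExE f : integ f -> (\int[P]_w (f w)%:E = (Ex f)%:E)%E.
Proof. by move=> fi; rewrite /Ex /Rintegral fineK//; exact: integrable_fin_num. Qed.

Lemma ExD f g : integ f -> integ g -> Ex (fun w => f w + g w) = Ex f + Ex g.
Proof. exact: RintegralD. Qed.

Lemma ExB f g : integ f -> integ g -> Ex (fun w => f w - g w) = Ex f - Ex g.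
Proof. exact: RintegralB. Qed.

Lemma ExZ c f : integ f -> Ex (fun w => c * f w) = c * Ex f.
Proof. by move=> fi; exact: RintegralZl. Qed.

Lemma ExZr c f : integ f -> Ex (fun w => f w * c) = Ex f * c.
Proof. by move=> fi; exact: RintegralZr. Qed.

Lemma Ex_cst c : Ex (fun=> c) = c.
Proof.
rewrite /Ex Rintegral_cst// -[RHS]mulr1; congr (_ * _).
by rewrite [X in fine X](_ : _ = 1%E)//; exact: probability_setT.
Qed.

Lemma Ex_sum (I : Type) (r : seq I) (Q : pred I) (f : I -> T -> R) :
  (forall i, Q i -> integ (f i)) ->
  Ex (fun w => \sum_(i <- r | Q i) f i w) = \sum_(i <- r | Q i) Ex (f i).
Proof.
move=> fi; elim: r => [|i r IH].
  under [in LHS]eq_fun do rewrite big_nil.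
  by rewrite big_nil Ex_cst.
under [in LHS]eq_fun do rewrite big_cons.
rewrite big_cons; case: (boolP (Q i)) => // Qi.
by rewrite ExD ?IH//; [exact: fi|exact: integ_sum].
Qed.

Lemma Ex_le f g : integ f -> integ g -> (forall w, f w <= g w) -> Ex f <= Ex g.
Proof. by move=> fi gi fg; apply: le_Rintegral => // w _; exact: fg. Qed.

Lemma Ex_ge0 f : (forall w, 0 <= f w) -> 0 <= Ex f.
Proof. by move=> f0; apply: Rintegral_ge0 => w _. Qed.

Lemma mean_leP f c : measurable_fun setT f -> (forall w, 0 <= f w) ->
  (\int[P]_w (f w)%:E <= c%:E)%E -> mean_le f c.
Proof.
move=> mf f0 fc.
have fi : integ f.
  apply/integrableP; split; first exact/measurable_EFinP.
  rewrite (eq_integral (EFin \o f)) => [|w _] /=; last by rewrite ger0_norm.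
  by rewrite (le_lt_trans fc)// ltry.
by split => //; rewrite -lee_fin -ExE.
Qed.

Lemma mean_le_ge0 f c : mean_le f c -> 0 <= c.
Proof. by case=> f0 _; apply: le_trans; exact: Ex_ge0. Qed.

Lemma mean_leD f g c c' : mean_le f c -> mean_le g c' ->
  mean_le (fun w => f w + g w) (c + c').
Proof.
case=> f0 fi fc [g0 gi gc]; split; first by move=> w; exact: addr_ge0.
  exact: integD.
by rewrite ExD// lerD.
Qed.

Lemma mean_leZ a f c : 0 <= a -> mean_le f c ->
  mean_le (fun w => a * f w) (a * c).
Proof.
move=> a0 [f0 fi fc]; split; first by move=> w; exact: mulr_ge0.
  exact: integZ.
by rewrite ExZ// ler_wpM2l.
Qed.

Lemma mean_le_cst c : 0 <= c -> mean_le (fun=> c) c.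
Proof. by move=> c0; split => //; [exact: integ_cst|rewrite Ex_cst]. Qed.

Lemma mean_le_sum (I : Type) (r : seq I) (Q : pred I) (f : I -> T -> R)
    (c : I -> R) : (forall i, Q i -> mean_le (f i) (c i)) ->
  mean_le (fun w => \sum_(i <- r | Q i) f i w) (\sum_(i <- r | Q i) c i).
Proof.
move=> fc; split; first by move=> w; apply: sumr_ge0 => i /fc[].
  by apply: integ_sum => i /fc[].
by rewrite Ex_sum => [|i /fc[]//]; apply: ler_sum => i /fc[].
Qed.

Lemma mean_le_mono f g c c' : measurable_fun setT f ->
  (forall w, 0 <= f w <= g w) -> mean_le g c -> c <= c' -> mean_le f c'.
Proof.
move=> mf fg [g0 gi gc] cc'.
have fi : integ f.
  by apply: integ_le mf _ gi => w; have /andP[f0 ?] := fg w; rewrite ger0_norm.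
split => //; first by move=> w; have /andP[] := fg w.
rewrite (le_trans _ cc')// (le_trans _ gc)//; apply: Ex_le => // w.
by have /andP[] := fg w.
Qed.

Lemma measurable_gt f t : measurable_fun setT f -> measurable [set w | t < f w].
Proof.
move=> mf; rewrite (_ : [set w | _] = setT `&` f @^-1` `]t, +oo[).
  exact: mf.
by rewrite setTI; apply/seteqP; split => w /=; rewrite in_itv/= andbT.
Qed.

Lemma markov_mean f c t : 0 < t -> mean_le f c ->
  (P [set w | (t < f w)%R] <= (c / t)%:E)%E.
Proof.
move=> t0 [f0 fi fc]; have mf := integ_measurable fi.
have mA := measurable_gt t mf.
have := integral_indic P measurableT mA; rewrite setIT => <-.
pose g w : R := t^-1 * f w.
apply: (@le_trans _ _ (\int[P]_w (g w)%:E)%E); last first.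
  by rewrite (ExE (integZ _ fi)) lee_fin ExZ// mulrC ler_wpM2r// invr_ge0 ltW.
apply: ge0_le_integral => //.
- exact/measurable_EFinP/measurable_indic.
- by apply/measurable_EFinP; apply: measurable_funM.
- move=> w _; rewrite lee_fin indicE /g.
  case: (boolP (w \in _)) => [|_]; last by rewrite mulr_ge0// invr_ge0 ltW.
  by rewrite inE /= => tf; rewrite ler_pdivlMl// mulr1 ltW.
Qed.

End real_expectation.

Section independent_variables.
Context {R : realType} {d : measure_display} {T : measurableType d}.
Variables (P : probability T R) (K : finType) (F : K -> set (set T)).
Implicit Types (J : {set K}) (f g : T -> R) (c : R).

Record independent_sigma : Prop := {
  fam_measurable : forall k, F k `<=` measurable;
  fam_setT : forall k, F k setT;
  fam_setI : forall k, setI_closed (F k);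
  fam_indep : mutually_independent P F
}.

(** The same points as T, with the smaller sigma-algebra: being a function of the sources in J
    becomes measurability on this space, and the identity map [to_gen] is the random variable that
    collects these sources. *)
Definition gen J := g_sigma_algebraType (cylinders F J).

(* f is a function of the sources in J *)
Definition dep J f := measurable_fun [set: gen J] (f : gen J -> R).

Hypothesis FP : independent_sigma.

Definition to_gen J (w : T) : gen J := w.

Lemma measurable_to_gen J : measurable_fun setT (to_gen J).
Proof.
move=> _ A mA; rewrite setTI.
exact: (sigma_cylinders_measurable (fam_measurable FP) mA).
Qed.
Arguments measurable_to_gen J : clear implicits.

HB.instance Definition _ J :=
  isMeasurableFun.Build _ _ _ _ (to_gen J) (measurable_to_gen J).

Lemma to_gen_indep J J' : [disjoint J & J']%B ->
  forall (A : set (gen J)) (B : set (gen J')), measurable A -> measurable B ->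
  (P (to_gen J @^-1` A `&` to_gen J' @^-1` B) =
   P (to_gen J @^-1` A) * P (to_gen J' @^-1` B))%E.
Proof.
move=> dJ A B; case: FP => Fm FT FI Fi.
exact: (sigma_cylinders_indep Fm FT FI Fi dJ).
Qed.

Lemma dep_measurable J f : dep J f -> measurable_fun setT f.
Proof. by move=> fJ; exact: (measurableT_comp fJ (measurable_to_gen J)). Qed.

Lemma sub_dep J J' f : J \subset J' -> dep J f -> dep J' f.
Proof.
move=> sJ fJ _ A mA; have := fJ measurableT A mA.
exact: (sub_sigma_algebra2 (sub_cylinders (fam_setT FP) sJ)).
Qed.

Lemma dep1 J k f : k \in J ->
  (forall A, measurable A -> F k (f @^-1` A)) -> dep J f.
Proof.
move=> kJ Ff _ A mA; rewrite setTI; apply: sub_sigma_algebra.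
exact: (cylinders1 (fam_setT FP) kJ (Ff _ mA)).
Qed.

Section pair.
Variables (J J' : {set K}) (f : T * T -> R).
Hypothesis dJ : [disjoint J & J']%B.
Hypothesis mf : measurable_fun [set: gen J * gen J'] f.

Lemma measurable_diag : measurable_fun setT (fun w => f (w, w)).
Proof.
apply: (measurableT_comp mf).
exact: (measurable_fun_pair (measurable_to_gen J) (measurable_to_gen J')).
Qed.

(** Conditioning: freeze the sources in J, bound the mean over those in J', then average.
    Integrability on the diagonal is part of the conclusion, by Tonelli. *)
Lemma mean_le_decoupling (g : T -> R) c : (forall z, 0 <= f z) ->
  (forall w, mean_le P (fun w' => f (w, w')) (g w)) -> mean_le P g c ->
  mean_le P (fun w => f (w, w)) c.
Proof.
move=> f0 fg [g0 gi gc]; apply: mean_leP => //; first exact: measurable_diag.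
have mEf : measurable_fun [set: gen J * gen J'] (fun z => (f z)%:E).
  exact/measurable_EFinP.
have -> : (\int[P]_w (f (w, w))%:E = \int[P]_w \int[P]_w' (f (w, w'))%:E)%E.
  apply: (ge0_decoupling (to_gen_indep dJ) mEf) => z.
  by rewrite lee_fin.
apply: (@le_trans _ _ (\int[P]_w (g w)%:E)%E); last by rewrite ExE// lee_fin.
apply: ge0_le_integral => //.
- by move=> w _; apply: integral_ge0 => w' _; rewrite lee_fin.
- have := measurable_fun_fubini_tonelli_F
    (m2 := distribution P (to_gen J')) _ mEf (fun z => f0 z).
  move=> /measurableT_comp /(_ (measurable_to_gen J)).
  apply: eq_measurable_fun => w _ /=; rewrite /fubini_F.
  rewrite ge0_integral_distribution//= => [|y]; last by rewrite lee_fin.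
  by apply/measurable_EFinP/(measurableT_comp mf); exact: pair1_measurable.
- by apply/measurable_EFinP; exact: integ_measurable gi.
- by move=> w _; have [_ fi fw] := fg w; rewrite (ExE fi) lee_fin.
Qed.

Lemma Ex_decoupling : integ P (fun w => f (w, w)) ->
  (forall w, integ P (fun w' => f (w, w'))) ->
  integ P (fun w => Ex P (fun w' => f (w, w'))) /\
  Ex P (fun w => f (w, w)) = Ex P (fun w => Ex P (fun w' => f (w, w'))).
Proof.
move=> fi fwi.
have mEf : measurable_fun [set: gen J * gen J'] (fun z => (f z)%:E).
  exact/measurable_EFinP.
have [] := decoupling (to_gen_indep dJ) mEf fi.
have E w : (\int[distribution P (to_gen J')]_y (f (to_gen J w, y))%:E =
            (Ex P (fun w' => f (w, w')))%:E)%E.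
  rewrite integral_distribution; first exact: (ExE (fwi w)).
    apply/measurable_EFinP/(measurableT_comp mf); exact: pair1_measurable.
  exact: fwi.
under [X in _.-integrable _ X -> _]eq_fun do rewrite E.
under [X in _ -> _ = X -> _]eq_integral do rewrite E.
move=> Efi EE; split => //; apply: EFin_inj; rewrite -!ExE//.
Qed.

End pair.

(** Integrability of the product comes first, by conditioning applied to |f| |g|; only then can
    Fubini be used for the value. *)
Lemma Ex_mul J J' f g : [disjoint J & J']%B -> dep J f -> dep J' g ->
  integ P f -> integ P g ->
  integ P (fun w => f w * g w) /\ Ex P (fun w => f w * g w) = Ex P f * Ex P g.
Proof.
move=> dJ fJ gJ fi gi.
have m1 : measurable_fun [set: gen J * gen J'] (fun z => f z.1).
  exact: (measurableT_comp fJ).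
have m2 : measurable_fun [set: gen J * gen J'] (fun z => g z.2).
  exact: (measurableT_comp gJ).
have fgi : integ P (fun w => f w * g w).
  have [] // : mean_le P (fun w => `|f w| * `|g w|)
      (Ex P (fun w => `|f w| * Ex P (fun w => `|g w|))).
    apply: (@mean_le_decoupling J J' (fun z => `|f z.1| * `|g z.2|) dJ _
        (fun w => `|f w| * Ex P (fun w => `|g w|))) => //.
    - by apply: measurable_funM; exact: measurableT_comp.
    - move=> w /=; apply: mean_leZ => //; split => //; exact: integ_abs.
    - split => //; first by move=> w; apply: mulr_ge0 => //; exact: Ex_ge0.
      by apply: integZr; exact: integ_abs.
  move=> _ absi _; apply: integ_le absi.
    by apply: measurable_funM; [exact: integ_measurable fi|exact: integ_measurable gi].
  by move=> w; rewrite normrM.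
split=> //.
have [] := @Ex_decoupling J J' (fun z => f z.1 * g z.2) dJ.
- exact: measurable_funM.
- exact: fgi.
- by move=> w /=; exact: integZ.
move=> _ /= ->; rewrite -ExZr//; congr (Ex P _).
by apply/funext => w; rewrite ExZ.
Qed.

End independent_variables.

(** * Moments of sums of independent variables *)

Lemma norm_pow_le (R : realDomainType) (n m : nat) (x : R) : (n <= m)%N -> ~~ odd m ->
  `|x ^+ n| <= 1 + x ^+ m.
Proof.
move=> nm om; rewrite normrX; have [x1|x1] := lerP `|x| 1.
  by rewrite (@le_trans _ _ 1) ?exprn_ile1// lerDl exprn_even_ge0.
rewrite -[X in _ <= 1 + X]ger0_norm ?exprn_even_ge0// normrX.
by rewrite (@le_trans _ _ (`|x| ^+ m)) ?lerDr// ler_weXn2l// ltW.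
Qed.

Section moments.
Context {R : realType} {d : measure_display} {T : measurableType d}.
Variable P : probability T R.
Implicit Types (f g : T -> R) (c : R).

Lemma mean_le_integ f c : mean_le P f c -> integ P f.
Proof. by case. Qed.

Lemma integ_pow_le (n m : nat) f : (n <= m)%N -> ~~ odd m ->
  measurable_fun setT f -> integ P (fun w => f w ^+ m) ->
  integ P (fun w => f w ^+ n).
Proof.
move=> nm om mf fm; apply: (integ_le (g := fun w => 1 + f w ^+ m)).
- exact: measurable_funX.
- by move=> w; exact: norm_pow_le.
- by apply: integD => //; exact: integ_cst.
Qed.

(** Pointwise, f <= f^2 / (2 b) + b / 2 for every b > 0; take b = c + e and let e tend to 0, which
    covers c = 0. *)
Lemma mean_le_sqrt f c : measurable_fun setT f -> (forall w, 0 <= f w) ->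
  0 <= c -> mean_le P (fun w => f w ^+ 2) (c ^+ 2) -> mean_le P f c.
Proof.
move=> mf f0 c0 f2.
have fi : integ P f.
  by have := @integ_pow_le 1 2 f isT isT mf; apply; exact: mean_le_integ f2.
split => //; apply/ler_addgt0Pr => e e0.
have ce : 0 < c + e by rewrite ltr_wpDl.
have fle w : f w <= (2 * (c + e))^-1 * f w ^+ 2 + (c + e) / 2.
  rewrite -subr_ge0.
  have -> : (2 * (c + e))^-1 * f w ^+ 2 + (c + e) / 2 - f w =
    (2 * (c + e))^-1 * (f w - (c + e)) ^+ 2.
    by field; exact: lt0r_neq0.
  by rewrite mulr_ge0 ?sqr_ge0// invr_ge0 mulr_ge0// ltW.
have [_ i2 Ef2] := f2.
apply: (@le_trans _ _ (Ex P (fun w => (2 * (c + e))^-1 * f w ^+ 2 + (c + e) / 2))).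
  apply: Ex_le => //; apply: integD; [exact: integZ i2|exact: integ_cst].
rewrite (ExD (integZ _ i2) (integ_cst _ _)) (ExZ _ i2) Ex_cst.
apply: (@le_trans _ _ ((2 * (c + e))^-1 * (c + e) ^+ 2 + (c + e) / 2)).
  rewrite lerD2r ler_wpM2l ?invr_ge0 ?mulr_ge0 ?(ltW ce)//.
  by rewrite (le_trans Ef2)// lerXn2r ?nnegrE ?(ltW ce)// lerDl ltW.
by apply: ler_of_eq; field; exact: lt0r_neq0.
Qed.

Lemma coord_integ (Q : finType) (f : Q -> T -> R) q c : measurable_fun setT (f q) ->
  mean_le P (fun w => \sum_q f q w ^+ 2) c ->
  integ P (fun w => f q w ^+ 2) /\ integ P (f q).
Proof.
move=> mf [_ i _]; have i2 : integ P (fun w => f q w ^+ 2).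
  apply: (integ_le _ _ i); first exact: measurable_funX.
  move=> w; rewrite ger0_norm ?sqr_ge0// (bigD1 q)//= lerDl.
  by apply: sumr_ge0 => ? _; exact: sqr_ge0.
by split=> //; have := @integ_pow_le 1 2 (f q) isT isT mf; exact.
Qed.

Lemma integ_mul f g : measurable_fun setT f -> measurable_fun setT g ->
  integ P (fun w => f w ^+ 2) -> integ P (fun w => g w ^+ 2) ->
  integ P (fun w => f w * g w).
Proof.
move=> mf mg fi gi; apply: (integ_le (g := fun w => f w ^+ 2 + g w ^+ 2)).
- exact: measurable_funM.
- move=> w; rewrite normrM -[f w ^+ 2]real_normK ?num_real//.
  rewrite -[g w ^+ 2]real_normK ?num_real//.
  have := sqr_ge0 (`|f w| - `|g w|).
  have := normr_ge0 (f w); have := normr_ge0 (g w); nra.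
- exact: integD.
Qed.

Lemma mean_le_center f c : integ P f -> mean_le P (fun w => f w ^+ 2) c ->
  mean_le P (fun w => (f w - Ex P f) ^+ 2) c.
Proof.
move=> fi [_ i2 f2].
have E : (fun w => (f w - Ex P f) ^+ 2) =
    (fun w => f w ^+ 2 + (- (2 * Ex P f) * f w + Ex P f ^+ 2)).
  by apply/funext => w; ring.
have ci : integ P (fun w => - (2 * Ex P f) * f w + Ex P f ^+ 2).
  by apply: integD; [exact: integZ fi|exact: integ_cst].
split; first by move=> w; exact: sqr_ge0.
  by rewrite E; exact: integD.
rewrite E (ExD i2 ci) (ExD (integZ _ fi) (integ_cst _ _)) (ExZ _ fi) Ex_cst.
by rewrite (le_trans _ f2)//; have := sqr_ge0 (Ex P f); nra.
Qed.

(* Minkowski's inequality in L^2, for nonnegative variables *)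
Lemma mean_le_sum_sqr (I : finType) (f : I -> T -> R) (c : I -> R) :
  (forall i, measurable_fun setT (f i)) -> (forall i w, 0 <= f i w) ->
  (forall i, 0 < c i) ->
  (forall i, mean_le P (fun w => f i w ^+ 2) (c i ^+ 2)) ->
  mean_le P (fun w => (\sum_i f i w) ^+ 2) ((\sum_i c i) ^+ 2).
Proof.
move=> mf f0 c0 fc.
(* Cauchy-Schwarz with weights c i: the square of the sum is at most the sum of the c i times the
   sum of the f i ^ 2 / c i, whose mean is again controlled by the sum of the c i. *)
apply: (mean_le_mono (g := fun w => (\sum_i c i) * \sum_i (c i)^-1 * f i w ^+ 2)
  (c := (\sum_i c i) * \sum_i (c i)^-1 * c i ^+ 2)).
- by apply: measurable_funX; apply: measurable_sum => i; exact: mf.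
- move=> w; rewrite sqr_ge0/=.
  rewrite expr2 !big_distrlr/= -subr_ge0.
  have sw : \sum_i \sum_j c i * ((c j)^-1 * f j w ^+ 2) =
    \sum_i \sum_j c j * ((c i)^-1 * f i w ^+ 2) by rewrite exchange_big.
  set A := (X in X = _) in sw *; set B := (X in _ = X) in sw *.
  set C := \sum_i \sum_j f i w * f j w.
  suff : 0 <= B + A - (C + C).
    rewrite -sw => h; have : 0 <= A - C by move: h; clear; lra.
    exact.
  rewrite /A /B /C -!big_split/= -sumrB; apply: sumr_ge0 => i _.
  rewrite -!big_split/= -sumrB; apply: sumr_ge0 => j _.
  have := c0 i; have := c0 j; set ci := c i; set cj := c j => cj0 ci0.
  have -> : cj * (ci^-1 * f i w ^+ 2) + ci * (cj^-1 * f j w ^+ 2) -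
     (f i w * f j w + f i w * f j w) = (ci * cj)^-1 * (cj * f i w - ci * f j w) ^+ 2.
    by field; rewrite !gt_eqF.
  by rewrite mulr_ge0 ?sqr_ge0// invr_ge0 mulr_ge0// ltW.
- apply: mean_leZ; first by apply: sumr_ge0 => i _; exact: ltW.
  by apply: mean_le_sum => i _; apply: mean_leZ => //; rewrite invr_ge0 ltW.
- rewrite expr2 ler_wpM2l//; first by apply: sumr_ge0 => i _; exact: ltW.
  apply: ler_sum => i _; rewrite expr2 mulrA mulVf ?mul1r//.
  by rewrite gt_eqF.
Qed.

End moments.

Section independent_sums.
Context {R : realType} {d : measure_display} {T : measurableType d}.
Variables (P : probability T R) (K : finType) (F : K -> set (set T)).
Hypothesis FP : independent_sigma P F.
Implicit Types (J : {set K}) (f g : T -> R) (c : R).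

Lemma dep_cst J c : dep F J (fun=> c).
Proof. exact: measurable_cst. Qed.

Lemma depD J f g : dep F J f -> dep F J g -> dep F J (fun w => f w + g w).
Proof. exact: measurable_funD. Qed.

Lemma depB J f g : dep F J f -> dep F J g -> dep F J (fun w => f w - g w).
Proof. exact: measurable_funB. Qed.

Lemma depM J f g : dep F J f -> dep F J g -> dep F J (fun w => f w * g w).
Proof. exact: measurable_funM. Qed.

Lemma depX J n f : dep F J f -> dep F J (fun w => f w ^+ n).
Proof. exact: measurable_funX. Qed.

Lemma dep_sum (I : Type) (r : seq I) J (f : I -> T -> R) :
  (forall i, dep F J (f i)) -> dep F J (fun w => \sum_(i <- r) f i w).
Proof. by move=> fJ; apply: measurable_sum. Qed.

Lemma disjointsU J J' J2 : [disjoint J & J2]%B -> [disjoint J' & J2]%B ->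
  [disjoint (J :|: J')%SET & J2]%B.
Proof. by rewrite !finset.disjoints_subset finset.subUset => -> ->. Qed.

Lemma disjoint_bigcup (I : eqType) (r : seq I) (J : I -> {set K}) i :
  (forall i j, i != j -> [disjoint J i & J j]%B) -> i \notin r ->
  [disjoint \bigcup_(j <- r) J j & J i]%B.
Proof.
move=> dJ; elim: r => [|j r IH]; first by rewrite big_nil finset.disjoints_subset finset.sub0set.
rewrite inE negb_or eq_sym => /andP[ji ir].
by rewrite big_cons; apply: disjointsU; [exact: dJ|exact: IH].
Qed.

Lemma dep_sum_bigcup (I : eqType) (r : seq I) (J : I -> {set K}) (f : I -> T -> R) :
  (forall i, dep F (J i) (f i)) ->
  dep F (\bigcup_(j <- r) J j)%SET (fun w => \sum_(i <- r) f i w).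
Proof.
move=> fJ; elim: r => [|i r IH].
  rewrite (_ : (fun w => _) = fun=> 0); first exact: dep_cst.
  by apply/funext => w; rewrite big_nil.
have -> : (fun w => \sum_(j <- i :: r) f j w) =
    (fun w => f i w + \sum_(j <- r) f j w).
  by apply/funext => w; rewrite big_cons.
rewrite big_cons; apply: depD.
  by apply: (sub_dep FP) (fJ i); exact: finset.subsetUl.
by apply: (sub_dep FP) IH; exact: finset.subsetUr.
Qed.

Section sums.
Variables (I : eqType) (J : I -> {set K}) (a : I -> T -> R) (c : I -> R).
Hypothesis dJ : forall i j, i != j -> [disjoint J i & J j]%B.
Hypothesis aJ : forall i, dep F (J i) (a i).
Hypothesis a0 : forall i, Ex P (a i) = 0.

Let ma i : measurable_fun setT (a i).
Proof. exact: (dep_measurable FP (@aJ i)). Qed.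

(** Adding one term at a time, the cross term has mean zero, since the remaining sum depends on a
    disjoint group of sources. *)
Lemma mean_le_sqr_sum (r : seq I) : uniq r ->
  (forall i, mean_le P (fun w => a i w ^+ 2) (c i)) ->
  [/\ Ex P (fun w => \sum_(i <- r) a i w) = 0,
    integ P (fun w => \sum_(i <- r) a i w) &
    mean_le P (fun w => (\sum_(i <- r) a i w) ^+ 2) (\sum_(i <- r) c i)].
Proof.
move=> ur ac.
have ai i : integ P (a i).
  by have := @integ_pow_le _ _ _ P 1 2 (a i) isT isT (@ma i); apply; case: (ac i).
elim: r ur => [|i r IH].
  move=> _; under eq_fun do rewrite big_nil.
  rewrite Ex_cst; split => //; first exact: integ_cst.
  rewrite (_ : (fun w => _) = fun=> 0); first by rewrite big_nil; exact: mean_le_cst.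
  by apply/funext => w; rewrite big_nil expr0n.
rewrite cons_uniq => /andP[ir ur]; have [ES iS S2] := IH ur.
under eq_fun do rewrite big_cons.
split; first by rewrite ExD// a0 ES addr0.
  exact: integD.
set S := fun w => \sum_(j <- r) a j w.
have [iaS EaS] : integ P (fun w => a i w * S w) /\
    Ex P (fun w => a i w * S w) = Ex P (a i) * Ex P S.
  apply: (Ex_mul FP _ (@aJ i) (dep_sum_bigcup (r := r) aJ)) => //.
  by rewrite disjoint_sym; exact: disjoint_bigcup.
rewrite (_ : (fun w => _) =
    fun w => (a i w ^+ 2 + S w ^+ 2) + 2 * (a i w * S w)); last first.
  by apply/funext => w; rewrite big_cons -/(S w); ring.
rewrite big_cons; have [_ i2 E2] := ac i; have [_ iS2 ES2] := S2.
split.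
- by move=> w; have := sqr_ge0 (a i w + S w); nra.
- by apply: integD; [exact: integD|exact: integZ].
- rewrite (ExD (integD i2 iS2) (integZ 2 iaS)) (ExD i2 iS2) (ExZ 2 iaS).
  by rewrite EaS a0 mul0r mulr0 addr0 lerD.
Qed.

(** In the expansion of (a + S)^4 the terms of odd degree in a or S have mean zero. What is left
    closes the induction because c^2 + 6 c D + 3 D^2 <= 3 (c + D)^2. *)
Lemma mean_le_pow4_sum (r : seq I) : uniq r -> (forall i, 0 <= c i) ->
  (forall i, mean_le P (fun w => a i w ^+ 4) (c i ^+ 2)) ->
  mean_le P (fun w => (\sum_(i <- r) a i w) ^+ 4) (3 * (\sum_(i <- r) c i) ^+ 2).
Proof.
move=> ur c0 ac.
have a2 i : mean_le P (fun w => a i w ^+ 2) (c i).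
  apply: mean_le_sqrt => //; first exact: measurable_funX.
    by move=> w; exact: sqr_ge0.
  by under eq_fun do rewrite -exprM.
elim: r ur => [|i r IH].
  move=> _; rewrite (_ : (fun w => _) = fun=> 0).
    by rewrite big_nil expr0n mulr0; exact: mean_le_cst.
  by apply/funext => w; rewrite big_nil expr0n.
rewrite cons_uniq => /andP[ir ur]; have S4 := IH ur.
have [ES iS S2] := mean_le_sqr_sum ur a2.
set S := fun w => \sum_(j <- r) a j w.
have SJ : dep F (\bigcup_(j <- r) J j)%SET S := dep_sum_bigcup (r := r) aJ.
have mS := dep_measurable FP SJ.
have dS : [disjoint J i & (\bigcup_(j <- r) J j)%SET]%B.
  by rewrite disjoint_sym; exact: disjoint_bigcup.
have ip n : (n <= 4)%N -> integ P (fun w => a i w ^+ n).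
  by move=> n4; apply: (@integ_pow_le _ _ _ P n 4) => //; case: (ac i).
have iSp n : (n <= 4)%N -> integ P (fun w => S w ^+ n).
  by move=> n4; apply: (@integ_pow_le _ _ _ P n 4) => //; case: S4.
have prod n m : (n <= 4)%N -> (m <= 4)%N ->
    integ P (fun w => a i w ^+ n * S w ^+ m) /\
    Ex P (fun w => a i w ^+ n * S w ^+ m) =
    Ex P (fun w => a i w ^+ n) * Ex P (fun w => S w ^+ m).
  by move=> n4 m4; apply: (Ex_mul FP dS); [exact: depX|exact: depX|exact: ip|exact: iSp].
have [i13 E13] := prod 1 3 isT isT.
have [i22 E22] := prod 2 2 isT isT.
have [i31 E31] := prod 3 1 isT isT.
rewrite (_ : (fun w => _) = fun w => (a i w ^+ 4 + S w ^+ 4) +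
   ((4 * (a i w ^+ 1 * S w ^+ 3) + 4 * (a i w ^+ 3 * S w ^+ 1)) +
    6 * (a i w ^+ 2 * S w ^+ 2))); last first.
  by apply/funext => w; rewrite big_cons -/(S w); ring.
have [_ _ Ea4] := ac i; have [_ _ ES4] := S4.
have [_ _ Ea2] := a2 i; have [_ _ ES2] := S2.
have I1 := integD (ip 4 isT) (iSp 4 isT).
have I2 := integD (integZ 4 i13) (integZ 4 i31).
have I3 := integD I2 (integZ 6 i22).
split.
- move=> w; have /(_ (a i w + S w)) : forall x : R, 0 <= x ^+ 4.
    by move=> x; rewrite exprn_even_ge0.
  by move=> h; apply: (le_trans h); apply: ler_of_eq; ring.
- exact: integD I1 I3.
- rewrite (ExD I1 I3) (ExD (ip 4 isT) (iSp 4 isT)) (ExD I2 (integZ 6 i22)).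
  rewrite (ExD (integZ 4 i13) (integZ 4 i31)) (ExZ 4 i13) (ExZ 4 i31) (ExZ 6 i22).
  rewrite E13 E22 E31.
  have -> : Ex P (fun w => a i w ^+ 1) = 0 by rewrite -[RHS](a0 i).
  have -> : Ex P (fun w => S w ^+ 1) = 0 by rewrite -[RHS]ES.
  rewrite mul0r mulr0 !mulr0 !add0r big_cons.
  have A0 : 0 <= Ex P (fun w => a i w ^+ 2) by apply: Ex_ge0 => w; exact: sqr_ge0.
  have B0 : 0 <= Ex P (fun w => S w ^+ 2) by apply: Ex_ge0 => w; exact: sqr_ge0.
  have C0 := c0 i.
  have D0 : 0 <= \sum_(j <- r) c j by apply: sumr_ge0 => j _.
  have : Ex P (fun w => a i w ^+ 2) * Ex P (fun w => S w ^+ 2) <=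
     c i * \sum_(j <- r) c j by exact: ler_pM.
  move: Ea4 ES4 C0 D0; rewrite -/S.
  move: (Ex _ _) (Ex _ _) (_ * _) (c i) (\sum_(j <- r) c j) => x y z u v.
  nra.
Qed.

End sums.

End independent_sums.

(** * Contraction *)

Section pointed_maximum.
Context {R : realType} {I : finType}.
Variable i0 : I.
Implicit Types (h : I -> R).

(** The fold starts from the value at [i0], so that the maximum is always attained and no artificial
    bottom value interferes. *)
Definition maxf h : R := \big[Num.max/h i0]_i h i.

Lemma maxf_ge h i : h i <= maxf h.
Proof. exact: le_bigmax_cond. Qed.

Lemma maxf_leP h b : (forall i, h i <= b) -> maxf h <= b.
Proof. by move=> hb; apply: bigmax_le. Qed.

Lemma maxf_ex h : exists i, maxf h = h i.
Proof.
rewrite /maxf; elim/big_ind: _ => [|x y [i ->] [j ->]|i _]; first by exists i0.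
  by case: (leP (h i) (h j)) => _; [exists j|exists i].
by exists i.
Qed.

Lemma normr_maxf h : `|maxf h| <= \sum_i `|h i|.
Proof.
have [i ->] := maxf_ex h; rewrite (bigD1 i)//= lerDl.
by apply: sumr_ge0.
Qed.

Lemma measurable_maxf d (T : measurableType d) (h : I -> T -> R) :
  (forall i, measurable_fun setT (h i)) ->
  measurable_fun setT (fun w => maxf (h ^~ w)).
Proof.
move=> mh; rewrite /maxf; elim: (index_enum I) => [|i r IH].
  under eq_fun do rewrite big_nil.
  exact: mh.
under eq_fun do rewrite big_cons.
by apply: measurable_maxr => //; exact: mh.
Qed.

End pointed_maximum.

Section contraction.
Context {R : realType} {d : measure_display} {T : measurableType d}.
Variables (P : probability T R) (K : finType) (F : K -> set (set T)).
Hypothesis FP : independent_sigma P F.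
Variables (I : finType) (i0 : I) (phi : R -> R).
Hypothesis phi_measurable : measurable_fun setT phi.
Hypothesis phi_lipschitz : forall x y, `|phi x - phi y| <= `|x - y|.
Implicit Types (J : {set K}) (h l : I -> T -> R).

Lemma integ_maxf h : (forall i, integ P (h i)) ->
  integ P (fun w => maxf i0 (h ^~ w)).
Proof.
move=> hi; apply: (@integ_le _ _ _ P _ (fun w => \sum_i `|h i w|)).
- by apply: measurable_maxf => i; exact: integ_measurable (hi i).
- by move=> w; exact: normr_maxf.
- by apply: integ_sum => i _; exact: integ_abs.
Qed.

Lemma integ_phi f : integ P f -> integ P (fun w => phi (f w)).
Proof.
move=> fi; apply: (@integ_le _ _ _ P _ (fun w => `|phi 0| + `|f w|)).
- by apply: measurableT_comp => //; exact: integ_measurable fi.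
- move=> w; have := phi_lipschitz (f w) 0; rewrite subr0 => h.
  rewrite -[phi (f w)](subrK (phi 0)) (le_trans (ler_normD _ _))//.
  by rewrite addrC lerD2l.
- by apply: integD; [exact: integ_cst|exact: integ_abs].
Qed.

Lemma dep_phi J f : dep F J f -> dep F J (fun w => phi (f w)).
Proof. by move=> fJ; exact: measurableT_comp. Qed.

Section step.
Variables (J0 J1 : {set K}) (h l : I -> T -> R).
Hypothesis dJ : [disjoint J0 & J1]%B.
Hypothesis hJ : forall i, dep F J0 (h i).
Hypothesis lJ : forall i, dep F J1 (l i).
Hypothesis hi : forall i, integ P (h i).
Hypothesis li : forall i, integ P (l i).

Let psi i w := phi (l i w).
Let c i := Ex P (psi i).
Let psii i : integ P (psi i) := integ_phi (li i).

(** Conditionally on the sources of h, the maximum of the means is at most the mean of the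
    maximum. *)
Lemma Ex_maxf_jensen :
  Ex P (fun w => maxf i0 (fun i => h i w + 2 * c i)) <=
  Ex P (fun w => maxf i0 (fun i => h i w + 2 * psi i w)).
Proof.
pose f z := maxf i0 (fun i => h i z.1 + 2 * psi i z.2).
have mf : measurable_fun [set: gen F J0 * gen F J1] f.
  apply: measurable_maxf => i; apply: measurable_funD.
    exact: (measurableT_comp (@hJ i)).
  apply: measurable_funM => //.
  exact: (measurableT_comp (dep_phi (@lJ i))).
have fi : integ P (fun w => f (w, w)).
  by apply: integ_maxf => i; apply: integD => //; exact: integZ.
have fwi w : integ P (fun w' => f (w, w')).
  apply: (@integ_maxf (fun i w' => h i w + 2 * psi i w')) => i.
  by apply: integD; [exact: integ_cst|exact: integZ].
have [Efi ->] := Ex_decoupling FP dJ mf fi fwi.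
apply: Ex_le => //.
  by apply: integ_maxf => i; apply: integD => //; exact: integ_cst.
move=> w; apply: maxf_leP => i.
have -> : h i w + 2 * c i = Ex P (fun w' => h i w + 2 * psi i w').
  by rewrite (ExD (integ_cst _ _) (integZ 2 (psii i))) Ex_cst (ExZ _ (psii i)).
apply: Ex_le => //; first by apply: integD; [exact: integ_cst|exact: integZ].
by move=> w'; exact: (maxf_ge i0 (fun i => h i w + 2 * psi i w')).
Qed.

(* Averaging [h + 2 c] and [h - 2 psi] replaces the centred variable
   [c - psi] by [+- 2 psi]; the pair of signs then absorbs the Lipschitz
   function phi. *)
Lemma Ex_maxf_step : exists b : bool,
  Ex P (fun w => maxf i0 (fun i => h i w + (c i - psi i w))) <=
  Ex P (fun w => maxf i0 (fun i => h i w + (-1) ^+ b * 2 * l i w)).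
Proof.
pose m (g : I -> T -> R) w := maxf i0 (fun i => h i w + g i w).
pose u i w := 2 * psi i w; pose e i w := c i - psi i w.
pose v (b : bool) i w := (-1) ^+ b * 2 * l i w.
have im g : (forall i, integ P (g i)) -> integ P (m g).
  by move=> gi; apply: integ_maxf => i; exact: integD.
have ic : integ P (m (fun i _ => 2 * c i)) by apply: im => i; exact: integ_cst.
have ie : integ P (m e) by apply: im => i; apply: integB => //; exact: integ_cst.
have iu : integ P (m u) by apply: im => i; exact: integZ.
have iN : integ P (m (fun i w => - u i w)).
  by apply: integ_maxf => i; apply: integB => //; exact: integZ.
have iv b : integ P (m (v b)) by apply: im => i; exact: integZ.
have h1 : 2 * Ex P (m e) <=
    Ex P (m (fun i _ => 2 * c i)) + Ex P (m (fun i w => - u i w)).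
  rewrite -ExD// -ExZ//; apply: Ex_le; [exact: integZ|exact: integD|move=> w].
  rewrite /m; have [i ->] := maxf_ex i0 (fun i => h i w + e i w).
  have := maxf_ge i0 (fun i => h i w + 2 * c i) i.
  have := maxf_ge i0 (fun i => h i w - u i w) i.
  rewrite /u /e => A B; lra.
(* Let i and j be the two maximisers. By the Lipschitz bound, 2 (psi i - psi j) <= 2 |l i - l j|,
   and the sign of l i - l j decides which of the two signed maxima is tested at i and which at
   j. *)
have h2 : Ex P (m u) + Ex P (m (fun i w => - u i w)) <=
    Ex P (m (v false)) + Ex P (m (v true)).
  rewrite -!ExD//; apply: Ex_le; [exact: integD|exact: integD|move=> w].
  rewrite /m; have [i ->] := maxf_ex i0 (fun i => h i w + u i w).
  have [j ->] := maxf_ex i0 (fun i => h i w - u i w).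
  have mv b k := maxf_ge i0 (fun i => h i w + v b i w) k.
  move: (mv false i) (mv false j) (mv true i) (mv true j).
  have := phi_lipschitz (l i w) (l j w).
  rewrite /u /v expr0 expr1 -/(psi i w) -/(psi j w).
  have := ler_norm (psi i w - psi j w).
  case: (ger0P (l i w - l j w)) => ? /= *; lra.
have h3 : Ex P (m (fun i _ => 2 * c i)) <= Ex P (m u) := Ex_maxf_jensen.
have [le|lt] := leP (Ex P (m (v false))) (Ex P (m (v true))).
  by exists true; rewrite -[leLHS]/(Ex P (m e)) -[leRHS]/(Ex P (m (v true))); lra.
by exists false; rewrite -[leLHS]/(Ex P (m e)) -[leRHS]/(Ex P (m (v false))); lra.
Qed.

End step.

Variables (Q : eqType) (J : Q -> {set K}) (l : Q -> I -> T -> R).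
Hypothesis dJ : forall q q', q != q' -> [disjoint J q & J q']%B.
Hypothesis lJ : forall q i, dep F (J q) (l q i).
Hypothesis li : forall q i, integ P (l q i).

Let psi q i w := phi (l q i w).
Let c q i := Ex P (psi q i).

(** The summands are linearised one at a time, g collecting those already treated. At each step the
    better of the two signs is kept, so that the signs are deterministic and no Rademacher variables
    need to be adjoined to the space. *)
Lemma contraction (s : seq Q) (J0 : {set K}) (g : I -> T -> R) : uniq s ->
  (forall q, q \in s -> [disjoint J0 & J q]%B) ->
  (forall i, dep F J0 (g i)) -> (forall i, integ P (g i)) ->
  exists eps : Q -> bool,
  Ex P (fun w => maxf i0 (fun i => g i w + \sum_(q <- s) (c q i - psi q i w))) <=
  Ex P (fun w => maxf i0 (fun i =>
    g i w + \sum_(q <- s) (-1) ^+ eps q * 2 * l q i w)).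
Proof.
elim: s J0 g => [|q s IH] J0 g.
  exists (fun=> false); apply: ler_of_eq; congr (Ex P _).
  by apply/funext => w; congr maxf; apply/funext => i; rewrite !big_nil.
rewrite cons_uniq => /andP[qs us] dJ0 gJ gi.
have psiJ q' i : dep F (J q') (fun w => c q' i - psi q' i w).
  by apply: depB; [exact: dep_cst|exact: dep_phi].
have psii q' i : integ P (fun w => c q' i - psi q' i w).
  by apply: integB; [exact: integ_cst|exact: integ_phi].
pose h i w := g i w + \sum_(q <- s) (c q i - psi q i w).
pose J0' := (J0 :|: \bigcup_(q <- s) J q)%SET.
have [b hb] : exists b : bool,
  Ex P (fun w => maxf i0 (fun i => h i w + (c q i - psi q i w))) <=
  Ex P (fun w => maxf i0 (fun i => h i w + (-1) ^+ b * 2 * l q i w)).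
  apply: (@Ex_maxf_step J0' (J q)) => //.
  - by apply: disjointsU; [rewrite dJ0 ?mem_head|exact: disjoint_bigcup].
  - move=> i; apply: depD.
      by apply: (sub_dep FP) (gJ i); exact: finset.subsetUl.
    apply: (sub_dep FP) (dep_sum_bigcup FP (r := s) (psiJ ^~ i)).
    exact: finset.subsetUr.
  - by move=> i; apply: integD => //; exact: integ_sum.
have [q' q's|i|i|eps heps] :=
    IH (J0 :|: J q)%SET (fun i w => g i w + (-1) ^+ b * 2 * l q i w) us.
- apply: disjointsU; first by rewrite dJ0// inE q's orbT.
  by apply: dJ; apply: contraNneq qs => ->.
- apply: depD; first by apply: (sub_dep FP) (gJ i); exact: finset.subsetUl.
  apply: (sub_dep FP (finset.subsetUr _ _)).
  by apply: depM => //; exact: dep_cst.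
- by apply: integD => //; exact: integZ.
exists (fun q' => if q' == q then b else eps q').
have -> : (fun w => maxf i0 (fun i =>
    g i w + \sum_(q <- q :: s) (c q i - psi q i w))) =
    (fun w => maxf i0 (fun i => h i w + (c q i - psi q i w))).
  apply/funext => w; congr maxf; apply/funext => i.
  by rewrite /h big_cons; ring.
apply: (le_trans hb); move: heps; congr (Ex P _ <= Ex P _).
  by apply/funext => w; congr maxf; apply/funext => i; rewrite /h; ring.
apply/funext => w; congr maxf; apply/funext => i; rewrite big_cons eqxx addrA.
congr (_ + _); apply: eq_big_seq => q' q's.
by case: eqVneq qs q's => // -> /negP.
Qed.

End contraction.

(** * The loss function *)

Section frobenius_product.
Context {R : realType}.

Lemma mdotC m n (A B : 'M[R]_(m, n)) : mdot A B = mdot B A.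
Proof. by apply: eq_bigr => i _; apply: eq_bigr => j _; rewrite mulrC. Qed.

Lemma mdotDr m n (A B C : 'M[R]_(m, n)) : mdot A (B + C) = mdot A B + mdot A C.
Proof.
rewrite /mdot -big_split; apply: eq_bigr => i _; rewrite -big_split.
by apply: eq_bigr => j _; rewrite mxE mulrDr.
Qed.

Lemma mdotZr m n a (A B : 'M[R]_(m, n)) : mdot A (a *: B) = a * mdot A B.
Proof.
rewrite /mdot mulr_sumr; apply: eq_bigr => i _; rewrite mulr_sumr.
by apply: eq_bigr => j _; rewrite mxE mulrCA.
Qed.

Lemma mdotBr m n (A B C : 'M[R]_(m, n)) : mdot A (B - C) = mdot A B - mdot A C.
Proof. by rewrite mdotDr -scaleN1r mdotZr mulN1r. Qed.

Lemma mdot0r m n (A : 'M[R]_(m, n)) : mdot A 0 = 0.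
Proof. by rewrite -(scale0r 0) mdotZr mul0r. Qed.

Lemma fro20 m n : fro2 (0 : 'M[R]_(m, n)) = 0.
Proof. by rewrite -mdot_fro2 mdot0r. Qed.

Lemma mdot_sumr m n (I : Type) (r : seq I) (A : 'M[R]_(m, n)) (B : I -> 'M[R]_(m, n)) :
  mdot A (\sum_(i <- r) B i) = \sum_(i <- r) mdot A (B i).
Proof.
elim: r => [|i r IH]; first by rewrite !big_nil mdot0r.
by rewrite !big_cons mdotDr IH.
Qed.

Lemma fro2_subZ m n t (A B : 'M[R]_(m, n)) :
  fro2 (A - t *: B) = fro2 A - 2 * t * mdot A B + t ^+ 2 * fro2 B.
Proof.
rewrite -!mdot_fro2 mdotBr mdotZr !(mdotC (A - _)) !mdotBr !mdotZr (mdotC B A).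
ring.
Qed.

Lemma fro2Z m n t (B : 'M[R]_(m, n)) : fro2 (t *: B) = t ^+ 2 * fro2 B.
Proof. by rewrite -!mdot_fro2 mdotZr mdotC mdotZr mulrA expr2. Qed.

Lemma mdot_congr m n (X : 'M[R]_(m, n)) (K : 'M[R]_n) (M : 'M[R]_m) :
  mdot (X *m K *m X^T) M = mdot K (X^T *m M *m X).
Proof.
rewrite !mdotE !trmx_mul trmxK -mulmxA mxtrace_mulC !mulmxA.
by rewrite -(mulmxA (M *m X)) mxtrace_mulC !mulmxA.
Qed.

Lemma dot_congr n (S A : 'M[R]_n) (u : 'cV[R]_n) : S^T = S ->
  dot u (S *m A *m S *m u) = dot (S *m u) (A *m (S *m u)).
Proof. by move=> ST; rewrite -!mulmxA dot_mulmx ST. Qed.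

Lemma rayleigh_gt0 n (A : 'M[R]_n) : (0 < n)%N -> A^T = A ->
  exists u : 'cV[R]_n, exists2 m : R, nrm2 u = 1 /\ A *m u = m *: u &
    forall v, dot v (A *m v) <= m * nrm2 v.
Proof. by case: n A => // n A _; exact: rayleigh. Qed.

Lemma trmx_congr m n (X : 'M[R]_(m, n)) (M : 'M[R]_m) : M^T = M ->
  (X^T *m M *m X)^T = X^T *m M *m X.
Proof. by move=> MT; rewrite !trmx_mul trmxK MT mulmxA. Qed.

Lemma mdot_rank1 n (u : 'cV[R]_n) (A : 'M[R]_n) :
  mdot (u *m u^T) A = dot u (A *m u).
Proof.
by rewrite mdotE trmx_mul trmxK -mulmxA mxtrace_mulC -mulmxA dotE /mxtrace big_ord1.
Qed.

Lemma sqr_mean_le (I : finType) (a : I -> R) : (0 < #|I|)%N ->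
  (#|I|%:R^-1 * \sum_i a i) ^+ 2 <= #|I|%:R^-1 * \sum_i a i ^+ 2.
Proof.
move=> I0; have := cauchy_schwarz_sum (fun=> 1) a.
under eq_bigr do rewrite mul1r.
under [X in _ <= X * _]eq_bigr do rewrite expr1n.
rewrite sumr_const => h; rewrite exprMn expr2 -mulrA ler_wpM2l ?invr_ge0//.
by rewrite ler_pdivrMl ?ltr0n.
Qed.

End frobenius_product.

(** * Stationarity, coercivity and deterministic error bounds *)

Section loss_function.
Context {R : realType} {d : measure_display}.
Variables (s : multi_study R d) (sigma : R) (w : space s).
Local Notation p := (dim s).
Local Notation L := (nL s).
Implicit Types (l : 'I_(nL s)) (A B K : 'M[R]_(dim s)).

Definition gram l (w : space s) : 'M[R]_(dim s) := (Xmx l w)^T *m Xmx l w.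

(** Half of the second derivative of the loss, as a linear map on matrices. The loss is quadratic,
    so this map does not depend on the point. *)
Definition hess (w : space s) A : 'M[R]_(dim s) :=
  L%:R^-1 *: \sum_l p%:R^-2 *: (gram l w *m A *m gram l w).

Definition moment_mx (w : space s) : 'M[R]_(dim s) :=
  L%:R^-1 *: \sum_l p%:R^-1 *: ((Xmx l w)^T *m
    (response l w *m (response l w)^T - (sigma ^+ 2)%:M) *m Xmx l w).

(** Minus half of the gradient of the loss at [Omega]. *)
Definition score (w : space s) : 'M[R]_(dim s) :=
  moment_mx w - hess w (Omega s).

(** This is [hess] at the identity. Since Omega <= C1 I, it controls the quadratic form of [hess] at
    [Omega]. *)
Definition gram2 (w : space s) : 'M[R]_(dim s) :=
  L%:R^-1 *: \sum_l p%:R^-2 *: (gram l w *m gram l w).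

Lemma gramT l : (gram l w)^T = gram l w.
Proof. by rewrite /gram trmx_mul trmxK. Qed.

Lemma hessB A B : hess w (A - B) = hess w A - hess w B.
Proof.
rewrite /hess -scalerBr -sumrB; congr (_ *: _); apply: eq_bigr => l _.
by rewrite -scalerBr mulmxBr mulmxBl.
Qed.

Lemma hessZ a A : hess w (a *: A) = a *: hess w A.
Proof.
rewrite /hess [RHS]scalerA [X in _ = X *: _]mulrC -[RHS]scalerA.
rewrite [X in _ = _ *: X]scaler_sumr; congr (_ *: _).
apply: eq_bigr => l _.
by rewrite -scalemxAr -scalemxAl !scalerA mulrC.
Qed.

Lemma hessD A B : hess w (A + B) = hess w A + hess w B.
Proof. by rewrite -[B in LHS]opprK hessB -(scaleN1r B) hessZ scaleN1r opprK. Qed.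

Lemma hessT A : (hess w A)^T = hess w A^T.
Proof.
rewrite /hess linearZ linear_sum/=; congr (_ *: _); apply: eq_bigr => l _.
by rewrite linearZ/= trmx_mul gramT trmx_mul gramT mulmxA.
Qed.

Lemma moment_mxT : (moment_mx w)^T = moment_mx w.
Proof.
rewrite /moment_mx linearZ linear_sum/=; congr (_ *: _); apply: eq_bigr => l _.
rewrite linearZ/= trmx_congr// linearB/= tr_scalar_mx; congr (_ - _).
by rewrite [LHS]trmx_mul trmxK.
Qed.

Lemma hess_quad K : mdot K (hess w K) =
  L%:R^-1 * \sum_l p%:R^-2 * fro2 (Xmx l w *m K *m (Xmx l w)^T).
Proof.
rewrite mdotZr mdot_sumr; congr (_ * _); apply: eq_bigr => l _.
rewrite mdotZr -mdot_fro2 mdot_congr; congr (_ * mdot _ _).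
by rewrite /gram !mulmxA.
Qed.

Lemma hess_quad_ge0 K : 0 <= mdot K (hess w K).
Proof.
rewrite hess_quad mulr_ge0 ?invr_ge0//; apply: sumr_ge0 => l _.
by rewrite mulr_ge0 ?fro2_ge0// exprn_ge0// invr_ge0.
Qed.

Lemma loss_expand A K t : loss sigma w (A + t *: K) =
  loss sigma w A + 2 * t * mdot K (hess w A - moment_mx w)
  + t ^+ 2 * mdot K (hess w K).
Proof.
rewrite hess_quad mdotBr /loss mdotZr mdotZr !mdot_sumr.
rewrite !mulrBr !mulr_sumr -!sumrB -!big_split /=; apply: eq_bigr => l _.
rewrite !sqr_frobenius !mdotZr.
set M := (X in _ = _ * fro2 X + _ + _).
set X := Xmx l w; set p1 := p%:R^-1.
rewrite [X in _ * fro2 X = _](_ : _ = M - t *: (p1 *: (X *m K *m X^T))); last first.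
  have -> : p1 *: (X *m (A + t *: K) *m X^T) =
      p1 *: (X *m A *m X^T) + t *: (p1 *: (X *m K *m X^T)).
    by rewrite mulmxDr mulmxDl -scalemxAr -scalemxAl scalerDr !scalerA (mulrC t).
  by rewrite /M opprD addrA [LHS]addrAC /p1 /X.
rewrite fro2_subZ fro2Z mdotZr mdotC mdot_congr.
have -> : X^T *m M *m X = X^T *m (response l w *m (response l w)^T - (sigma ^+ 2)%:M) *m X
    - p1 *: (gram l w *m A *m gram l w).
  rewrite /M addrAC mulmxBr mulmxBl -scalemxAr -scalemxAl.
  by rewrite /gram !mulmxA.
rewrite mdotBr mdotZr /p1 -exprVn; ring.
Qed.

Lemma stationary_argmin A : posdefmx A -> hess w A = moment_mx w ->
  argmin_loss sigma w A.
Proof.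
move=> Ap HA; split=> // B _.
have := loss_expand A (B - A) 1; rewrite scale1r addrC subrK HA subrr mdot0r.
by rewrite mulr0 addr0 expr1n mul1r => ->; rewrite lerDl hess_quad_ge0.
Qed.

(* The minimum is interior, the cone of positive definite matrices being open. *)
Lemma argmin_stationary A : argmin_loss sigma w A -> hess w A = moment_mx w.
Proof.
move=> [Ap Amin]; have AT := Ap.1.
pose K := hess w A - moment_mx w.
have KT : K^T = K by rewrite /K linearB/= hessT moment_mxT AT.
have [m m0 mP] := posdefmx_quad_lb Ap.
suff : fro2 K = 0 by move/fro2_eq0/eqP; rewrite subr_eq0 => /eqP.
suff : 2 * fro2 K = 0 by lra.
have f0 := fro2_ge0 K.
(* Since x <= (x + 1)^2 for x >= 0, [fro2 K + 1] bounds the operator norm of K and is positive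
   besides. Within this radius the perturbation changes the quadratic form of A by at most m / 2,
   which preserves positive definiteness. *)
apply: (@lin_coef_eq0 _ _ (mdot K (hess w K)) (m / (2 * (fro2 K + 1)))).
  by rewrite divr_gt0// mulr_gt0// ltr_wpDl.
move=> t tm; have : posdefmx (A + t *: K).
  split; first by rewrite linearD/= linearZ/= AT KT.
  move=> v v0; rewrite quadE mulmxDl dotDr -scalemxAl dotZr.
  have vp := nrm2_gt0 v0.
  have h1 := mP v.
  have h2 : (dot v (K *m v)) ^+ 2 <= ((fro2 K + 1) * nrm2 v) ^+ 2.
    rewrite (le_trans (cauchy_schwarz_dot _ _))//.
    have := nrm2_mulmx K v; have := nrm2_ge0 (K *m v) => n0 n1.
    rewrite exprMn [X in _ <= _ * X]expr2 mulrA mulrC ler_pM2r//.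
    by rewrite (le_trans n1)// ler_pM2r//; nra.
  have h3 : `|dot v (K *m v)| <= (fro2 K + 1) * nrm2 v.
    rewrite -(@ler_pXn2r _ 2) ?nnegrE ?real_normK ?num_real//.
    by rewrite mulr_ge0 ?nrm2_ge0// addr_ge0.
  have h4 : `|t * dot v (K *m v)| <= m / 2 * nrm2 v.
    rewrite normrM; apply: (@le_trans _ _ (m / (2 * (fro2 K + 1)) * ((fro2 K + 1) * nrm2 v))).
      exact: ler_pM.
    by apply: ler_of_eq; field; apply: lt0r_neq0; rewrite ltr_wpDl.
  rewrite ler_norml in h4.
  have /andP[h5 _] := h4.
  have := mulr_gt0 m0 vp; lra.
move=> /Amin; rewrite loss_expand -/K mdot_fro2 => h.
rewrite (_ : _ + _ = 2 * t * fro2 K + t ^+ 2 * mdot K (hess w K)); last by ring.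
by move: h; rewrite -addrA lerDl.
Qed.

Lemma argmin_score A : argmin_loss sigma w A -> hess w (A - Omega s) = score w.
Proof. by move=> /argmin_stationary HA; rewrite hessB HA. Qed.

Section coercive_hessian.
Variable c : R.
Hypothesis c0 : 0 < c.
Hypothesis hess_coercive : forall K, c * fro2 K <= mdot K (hess w K).

Lemma hess_lower K : c ^+ 2 * fro2 K <= fro2 (hess w K).
Proof.
have [->|K0] := eqVneq (fro2 K) 0; first by rewrite mulr0 fro2_ge0.
have Kp : 0 < fro2 K by rewrite lt_def K0 fro2_ge0.
have h := hess_coercive K; have h2 := cauchy_schwarz_mdot K (hess w K).
have : (c * fro2 K) ^+ 2 <= fro2 K * fro2 (hess w K).
  apply: le_trans h2; rewrite lerXn2r ?nnegrE//.
    by rewrite mulr_ge0 ?fro2_ge0// ltW.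
  by rewrite (le_trans _ h)// mulr_ge0 ?fro2_ge0// ltW.
by rewrite exprMn [X in _ * X <= _]expr2 mulrA mulrC ler_pM2l.
Qed.

Lemma hess_inj K : hess w K = 0 -> K = 0.
Proof.
move=> HK; apply: fro2_eq0; apply/eqP; rewrite eq_le fro2_ge0 andbT.
have := hess_lower K; rewrite HK fro20.
by rewrite pmulr_rle0// exprn_gt0.
Qed.

(** An injective endomorphism of a finite-dimensional space is onto; matrices are flattened so that
    invertibility can be read on a square matrix. *)
Lemma hess_surj B : exists A, hess w A = B.
Proof.
pose f (u : 'rV[R]_(p * p)) := mxvec (hess w (vec_mx u)).
have flin : linear f.
  move=> a u v; rewrite /f; set x := hess w (vec_mx u); set y := hess w (vec_mx v).
  have -> : vec_mx (a *: u + v) = a *: vec_mx u + vec_mx v by rewrite linearP.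
  by rewrite hessD hessZ -/x -/y; clearbody x y; rewrite linearP.
pose fL : {linear 'rV[R]_(p * p) -> 'rV[R]_(p * p)} :=
  HB.pack f (GRing.isLinear.Build _ _ _ _ f flin).
have fu : lin1_mx fL \in unitmx.
  rewrite -row_free_unit -kermx_eq0; apply/eqP/row_matrixP => i.
  set r := row i _; have rk : r *m lin1_mx fL = 0.
    by rewrite /r -row_mul mulmx_ker row0.
  move: rk; rewrite mul_rV_lin1/= => fr.
  have /hess_inj v0 : hess w (vec_mx r) = 0.
    by rewrite -[LHS]mxvecK -/(f r) fr linear0.
  by rewrite row0 -[r]vec_mxK v0 linear0.
exists (vec_mx (mxvec B *m invmx (lin1_mx fL))).
have := mul_rV_lin1 fL (mxvec B *m invmx (lin1_mx fL)).
by rewrite mulmxKV// => /(congr1 vec_mx); rewrite mxvecK /= /f mxvecK.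
Qed.

(** The minimiser is exhibited: [Omega + D], where D solves the stationarity equation. Injectivity
    makes D symmetric, and the bound on the score gives ||D||_F < C0, so the sum remains positive
    definite. *)
Lemma coercive_attained C0 : 0 < C0 -> (Omega s)^T = Omega s ->
  (forall v, C0 * nrm2 v <= dot v (Omega s *m v)) ->
  fro2 (score w) < (c * C0) ^+ 2 -> attained sigma w.
Proof.
move=> C00 OT OC sc.
have [D HD] := hess_surj (score w).
have scT : (score w)^T = score w by rewrite linearB/= moment_mxT hessT OT.
have DT : D^T = D.
  apply/eqP; rewrite -subr_eq0; apply/eqP/hess_inj.
  by rewrite hessB -hessT HD scT subrr.
exists (Omega s + D); apply: stationary_argmin; last first.
  by rewrite hessD HD addrC subrK.
split; first by rewrite linearD/= OT DT.
move=> v v0; rewrite quadE mulmxDl dotDr.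
have vp := nrm2_gt0 v0.
have D1 : fro2 D < C0 ^+ 2.
  rewrite -(ltr_pM2l (exprn_gt0 2 c0)) -exprMn; apply: le_lt_trans sc.
  by rewrite -HD hess_lower.
have : dot v (D *m v) ^+ 2 < (C0 * nrm2 v) ^+ 2.
  have -> : (C0 * nrm2 v) ^+ 2 = nrm2 v * (C0 ^+ 2 * nrm2 v) by ring.
  rewrite (le_lt_trans (cauchy_schwarz_dot _ _))// ltr_pM2l//.
  by rewrite (le_lt_trans (nrm2_mulmx _ _))// ltr_pM2r.
have := OC v; have := mulr_gt0 C00 vp => h1 h2 h3.
suff : - (C0 * nrm2 v) < dot v (D *m v) by lra.
rewrite ltrNl; have [|hn] := leP (- dot v (D *m v)) 0; first by move=> ?; lra.
by rewrite -(@ltr_pXn2r _ 2) ?nnegrE ?ltW// sqrrN.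
Qed.

Lemma coercive_error A g : argmin_loss sigma w A -> 0 <= g ->
  fro2 (score w) <= g ^+ 2 -> opnorm (A - Omega s) <= g / c.
Proof.
move=> HA g0 sg; apply: opnorm_fro2; first by rewrite divr_ge0// ltW.
rewrite expr_div_n ler_pdivlMr ?exprn_gt0// mulrC (le_trans (hess_lower _))//.
by rewrite argmin_score.
Qed.

End coercive_hessian.

Section leading_eigenvector.
Variables (c b g C1 : R).
Hypotheses (L0 : (0 < nL s)%N) (p0 : (0 < dim s)%N) (c0 : 0 < c) (b0 : 0 <= b)
  (g0 : 0 <= g) (C10 : 0 <= C1).
Hypothesis Omega_le : forall v, dot v (Omega s *m v) <= C1 * nrm2 v.
Hypothesis Omega_pd : posdefmx (Omega s).
Hypothesis score_le : fro2 (score w) <= g ^+ 2.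
Hypothesis gram2_le : forall u, nrm2 u = 1 -> dot u (gram2 w *m u) <= b.
Hypothesis gram_ge : forall u, nrm2 u = 1 ->
  c <= L%:R^-1 * \sum_l p%:R^-1 * nrm2 (Xmx l w *m u).

Lemma quad_hess A u : dot u (hess w A *m u) =
  L%:R^-1 * \sum_l p%:R^-2 * dot (gram l w *m u) (A *m (gram l w *m u)).
Proof.
rewrite -mdot_rank1 mdotZr mdot_sumr; congr (_ * _); apply: eq_bigr => l _.
by rewrite mdotZr mdot_rank1 dot_congr// gramT.
Qed.

(** No cancellation between A and [Omega] is sought: both are positive definite, and each is bounded
    by its largest eigenvalue. The factor 2 absorbs the loss in |x - y|^2 <= 2 (|x|^2 + |y|^2). *)
Lemma leading_error A : argmin_loss sigma w A ->
  opnorm (A - Omega s) <= 2 * ((g + C1 * b) / c ^+ 2 + C1).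
Proof.
move=> Amin; have HA := argmin_stationary Amin; have Ap := Amin.1.
have AT := Ap.1.
have [u [lam [u1 Au] Al]] := rayleigh_gt0 p0 AT.
have lam0 : 0 < lam.
  have [m m0 mP] := posdefmx_quad_lb Ap; have := mP u.
  by rewrite Au dotZr dot_nrm2 u1 !mulr1; exact: lt_le_trans.
have lower : lam * c ^+ 2 <= dot u (hess w A *m u).
  rewrite quad_hess.
  apply: (@le_trans _ _ (lam * (L%:R^-1 * \sum_l (p%:R^-1 * nrm2 (Xmx l w *m u)) ^+ 2))).
    rewrite ler_pM2l//; have := @sqr_mean_le _ 'I_(nL s)
      (fun l => p%:R^-1 * nrm2 (Xmx l w *m u)).
    rewrite card_ord => /(_ L0); apply: le_trans.
    rewrite lerXn2r ?nnegrE ?(ltW c0)//; first exact: le_trans (ltW c0) (gram_ge u1).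
    exact: gram_ge.
  rewrite mulrCA ler_wpM2l ?invr_ge0// mulr_sumr; apply: ler_sum => l _.
  rewrite exprMn mulrCA exprVn ler_wpM2l ?invr_ge0 ?exprn_ge0//.
  have := psd_cauchy_schwarz u (gram l w *m u) AT (fun v => posdefmx_ge0 v Ap).
  rewrite [in X in X ^+ 2 <= _](dot_mulmx A u) AT Au dotZl dotZr dot_nrm2 u1 mulr1.
  have -> : dot u (gram l w *m u) = nrm2 (Xmx l w *m u).
    by rewrite /gram -mulmxA dot_mulmx trmxK dot_nrm2.
  by rewrite exprMn [X in X * _ <= _]expr2 -mulrA ler_pM2l.
have upper : dot u (hess w A *m u) <= g + C1 * b.
  rewrite HA -[moment_mx w](subrK (hess w (Omega s))) -/(score w) mulmxDl dotDr.
  apply: lerD.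
    rewrite (le_trans (ler_norm _))// -(@ler_pXn2r _ 2) ?nnegrE//.
    rewrite real_normK ?num_real// (le_trans (cauchy_schwarz_dot _ _))//.
    by rewrite u1 mul1r (le_trans (nrm2_mulmx _ _))// u1 mulr1.
  apply: (@le_trans _ _ (C1 * dot u (gram2 w *m u))); last first.
    by rewrite ler_wpM2l// gram2_le.
  rewrite quad_hess -mdot_rank1 mdotZr mdot_sumr mulrCA ler_wpM2l ?invr_ge0//.
  rewrite mulr_sumr; apply: ler_sum => l _.
  rewrite mdotZr mdot_rank1 -[X in X *m gram l w]mulmx1 dot_congr ?gramT//.
  by rewrite mul1mx dot_nrm2 mulrCA ler_wpM2l.
have lamle : lam <= (g + C1 * b) / c ^+ 2.
  by rewrite ler_pdivlMr ?exprn_gt0// (le_trans lower).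
have CC : 0 <= (g + C1 * b) / c ^+ 2.
  by rewrite divr_ge0 ?exprn_ge0 ?(ltW c0)// addr_ge0// mulr_ge0.
apply: opnorm_le => [|v]; first by rewrite mulr_ge0// addr_ge0.
rewrite mulmxBl (le_trans (nrm2D_le _ _))// nrm2N.
have h1 : nrm2 (A *m v) <= lam ^+ 2 * nrm2 v.
  by apply: psd_nrm2_le => // v'; rewrite posdefmx_ge0//=.
have h2 : nrm2 (Omega s *m v) <= C1 ^+ 2 * nrm2 v.
  by apply: psd_nrm2_le => [|v']; [exact: Omega_pd.1|rewrite posdefmx_ge0//=].
have v0 := nrm2_ge0 v.
apply: (@le_trans _ _ (2 * (lam ^+ 2 + C1 ^+ 2) * nrm2 v)); first by lra.
apply: ler_wpM2r => //.
set k := (g + C1 * b) / c ^+ 2 in lamle CC *.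
have lk : lam ^+ 2 <= k ^+ 2 by rewrite lerXn2r ?nnegrE ?(ltW lam0).
have kC := mulr_ge0 CC C10; have := sqr_ge0 k; have := sqr_ge0 C1; nra.
Qed.

End leading_eigenvector.

End loss_function.

(** * Entries, coefficients and noise as independent sources *)

Lemma measurable_coord (R : realType) m n (i : 'I_m) (j : 'I_n) :
  measurable_fun [set: 'M[R]_(m, n)] (fun M : 'M[R]_(m, n) => M i j).
Proof.
move=> _ B mB; rewrite setTI; apply: sub_sigma_algebra.
by exists i, j, B.
Qed.

Section generated_system.
Context {R : realType} {d d' : measure_display} {T : measurableType d}
  {U : measurableType d'}.

Lemma generatedE (X : T -> U) A :
  generated X A <-> exists2 B, measurable B & A = X @^-1` B.
Proof.
by split=> [[B mB <-]|[B mB ->]]; exists B => //; rewrite setTI.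
Qed.

Lemma generated_setT (X : T -> U) : generated X setT.
Proof. by apply/generatedE; exists setT => //; rewrite preimage_setT. Qed.

Lemma generated_setI (X : T -> U) : setI_closed (generated X).
Proof.
move=> _ _ /generatedE[A mA ->] /generatedE[B mB ->]; apply/generatedE.
by exists (A `&` B); [exact: measurableI|rewrite preimage_setI].
Qed.

Lemma generated_measurable (X : T -> U) : measurable_fun setT X ->
  generated X `<=` measurable.
Proof. by move=> mX _ /generatedE[B mB ->]; rewrite -[X in measurable X]setTI; exact: mX. Qed.

End generated_system.

Section mutual_independence.
Context {R : realType} {d : measure_display} {T : measurableType d}.
Variables (P : probability T R) (K : finType) (F : K -> set (set T)).

(** Subfamilies are recovered by taking the sure event at the remaining indices. *)
Lemma mutually_independentT : (forall k, F k setT) ->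
  (forall a, (forall k, F k (a k)) ->
    (P (\bigcap_(k in setT) a k) = \prod_k P (a k))%E) ->
  mutually_independent P F.
Proof.
move=> FT Fa J A FA.
pose a k := if k \in J then A k else setT.
have Fk k : F k (a k) by rewrite /a; case: ifPn => // kJ; exact: FA.
have -> : \bigcap_(k in [set` J]) A k = \bigcap_(k in setT) a k.
  apply/seteqP; split=> x Ax k /=.
    by move=> _; rewrite /a; case: ifPn => // kJ; exact: Ax.
  by move=> kJ; have := Ax k I; rewrite /a kJ.
rewrite Fa// [RHS]big_mkcond; apply: eq_bigr => k _; rewrite /a; case: ifPn => // _.
by rewrite (probability_setT P).
Qed.

End mutual_independence.

Section sources.
Context {R : realType} {d : measure_display}.
Variables (s : multi_study R d) (sigma M12 : R).
Hypothesis model : model_assumptions s sigma M12.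
Local Notation p := (dim s).
Local Notation L := (nL s).
Local Notation T := (space s).

Definition entry : finType := {l : 'I_L & ('I_(nobs l) * 'I_p)%type}.
Definition source : finType := (entry + 'I_L + 'I_L)%type.

Definition mk_entry l (ij : 'I_(nobs l) * 'I_p) : entry :=
  @Tagged _ l (fun l => ('I_(nobs l) * 'I_p)%type) ij.

Definition Zval (t : entry) (w : T) : R := Zmx (tag t) w (tagged t).1 (tagged t).2.

(** A refinement of the sources of the model: each design is split into the entries of its Z.
    Independence between rows, between studies and between design, coefficients and noise thus
    becomes a single statement about one family. *)
Definition source_system (k : source) : set (set T) :=
  match k with
  | inl (inl t) => generated (Zval t)
  | inl (inr l) => generated (beta l)
  | inr l => generated (noise l)
  end.

Lemma sqrt_unitmx (l : 'I_L) : Sigma_half l \in unitmx.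
Proof.
have [[ST Sp] _] := Sigma_halfP model l.
rewrite -row_free_unit -kermx_eq0; apply/eqP/row_matrixP => i.
rewrite row0; set r := row i _.
have rk : r *m Sigma_half l = 0 by rewrite /r -row_mul mulmx_ker row0.
apply/eqP; apply: contraT => r0.
have /Sp : r^T != 0 by apply: contra_neq r0 => r0; rewrite -[r]trmxK r0 trmx0.
by rewrite trmxK rk mul0mx mxE ltxx.
Qed.

Lemma measurable_Zval t : measurable_fun setT (Zval t).
Proof.
apply: (measurableT_comp (measurable_coord (tagged t).1 (tagged t).2)).
exact: measurable_funP.
Qed.

Lemma source_system_measurable k : source_system k `<=` measurable.
Proof.
case: k => [[t|l]|l]; apply: generated_measurable.
- exact: measurable_Zval.
- exact: measurable_funP.
- exact: measurable_funP.
Qed.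

(** The model states independence for X = Z Sigma^(1/2). As the root is invertible, the entries of Z
    are measurable functions of X. *)
Lemma entries_of_design l (a : 'I_(nobs l) * 'I_p -> set T) :
  (forall ij, generated (Zval (mk_entry ij)) (a ij)) ->
  generated (@Xmx _ _ s l) (\bigcap_(ij in setT) a ij).
Proof.
move=> Fa; have /choice[B BP] ij : exists B, measurable B /\ a ij = Zval (mk_entry ij) @^-1` B.
  by have /generatedE[B mB ->] := Fa ij; exists B.
pose f (ij : 'I_(nobs l) * 'I_p) (M : 'M[R]_(nobs l, p)) :=
  (M *m invmx (Sigma_half l)) ij.1 ij.2.
have mf ij : measurable_fun setT (f ij).
  rewrite /f; under eq_fun do rewrite mxE.
  apply: measurable_sum => k; apply: measurable_funM => //.
  exact: measurable_coord.
apply/generatedE; exists (\bigcap_(ij in setT) (f ij @^-1` B ij)).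
  apply: fin_bigcap_measurable => // ij _.
  by rewrite -[X in measurable X]setTI; apply: mf => //; case: (BP ij).
rewrite preimage_bigcap; apply: eq_bigcapr => ij _.
have [_ ->] := BP ij.
apply/seteqP; split=> w; rewrite /preimage /= /f /Zval /= /Xmx;
  by rewrite mulmxK ?sqrt_unitmx.
Qed.

(** The probability of an intersection factors first over designs, coefficients and noises, then
    over the entries inside each design; the product over all entries is regrouped by study. *)
Lemma sources_independent_sigma : independent_sigma (Pr s) source_system.
Proof.
split.
- exact: source_system_measurable.
- by case=> [[t|l]|l]; exact: generated_setT.
- by case=> [[t|l]|l]; exact: generated_setI.
- apply: mutually_independentT.
    by case=> [[t|l]|l]; exact: generated_setT.
  move=> a Fa.
  pose aX l := \bigcap_(ij in [set: 'I_(nobs l) * 'I_p])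
    a (inl (inl (mk_entry ij))).
  pose B (i : 'I_L + 'I_L + 'I_L) := match i with
    | inl (inl l) => aX l | inl (inr l) => a (inl (inr l)) | inr l => a (inr l) end.
  have FB i : i \in [set: 'I_L + 'I_L + 'I_L]%SET -> source_sigma i (B i).
    move=> _; case: i => [[l|l]|l] /=.
    - by apply: entries_of_design => ij; exact: (Fa (inl (inl _))).
    - exact: (Fa (inl (inr l))).
    - exact: (Fa (inr l)).
  have := sources_independent model FB.
  rewrite (eq_bigl xpredT) => [|i]; last by rewrite inE.
  rewrite !big_sumType/=.
  have -> : \bigcap_(i in [set` [set: 'I_L + 'I_L + 'I_L]%SET]) B i =
      \bigcap_(k in setT) a k.
    apply/seteqP; split=> w Bw.
      case=> [[[l ij]|l]|l] _.
      - by have := Bw (inl (inl l)); rewrite /= inE => /(_ isT ij I).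
      - by have := Bw (inl (inr l)); rewrite /= inE => /(_ isT).
      - by have := Bw (inr l); rewrite /= inE => /(_ isT).
    by case=> [[l|l]|l] _; [move=> ij _|..]; exact: Bw.
  move=> ->; congr (_ * _ * _)%E.
  have E (t : entry) : t = mk_entry (tagged t) by case: t.
  rewrite [RHS](eq_bigr (fun t : entry => Pr s (a (inl (inl (mk_entry (tagged t)))))))
    => [|t _]; last by rewrite -E.
  rewrite -(sig_big_dep (J := fun l : 'I_L => ('I_(nobs l) * 'I_p)%type : finType)
    xpredT (fun _ => xpredT) (fun l ij => Pr s (a (inl (inl (mk_entry ij)))))).
  apply: eq_bigr => l _; rewrite /aX.
  have := @Z_independent _ _ _ _ _ model l [set: 'I_(nobs l) * 'I_p]%SET
    (fun ij => a (inl (inl (mk_entry ij)))).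
  move=> ZI; transitivity (\prod_(ij in [set: 'I_(nobs l) * 'I_p]%SET)
      Pr s (a (inl (inl (mk_entry ij)))))%E; last first.
    by apply: eq_bigl => ij; rewrite inE.
  rewrite -ZI => [|ij _]; last exact: (Fa (inl (inl (mk_entry ij)))).
  congr (Pr s (\bigcap_(ij in _) a (inl (inl (mk_entry ij))))).
  by apply/seteqP; split => // ij _ /=; rewrite inE.
Qed.

End sources.

(** * Moments of the design *)

Section fibers.
Variables (K : finType) (I : eqType) (f : K -> I).

Definition fiber i : {set K} := [set k | f k == i]%SET.

Lemma fiber_disjoint i j : i != j -> [disjoint fiber i & fiber j]%B.
Proof.
move=> ij; rewrite finset.disjoints_subset; apply/fintype.subsetP => k.
by rewrite !inE => /eqP ->.
Qed.

End fibers.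

Lemma expectation_Ex (R : realType) d (T : measurableType d) (P : probability T R)
  (f : T -> R) : fine ('E_P[f])%E = Ex P f.
Proof. by rewrite unlock. Qed.

Lemma mean_le_zero (R : realType) d (T : measurableType d) (P : probability T R)
  c : 0 <= c -> mean_le P (fun=> 0) c.
Proof. by move=> c0; split => //; [exact: integ_cst|rewrite Ex_cst]. Qed.

Section entry_moments.
Context {R : realType} {d : measure_display}.
Variables (s : multi_study R d) (sigma M12 : R).
Hypothesis model : model_assumptions s sigma M12.
Local Notation p := (dim s).
Local Notation L := (nL s).
Local Notation T := (space s).
Local Notation P := (Pr s).
Local Notation F := (@source_system _ _ s).
Local Notation M := (1 + M12).
Implicit Types l : 'I_L.

Let FP : independent_sigma P F := sources_independent_sigma model.

Definition design_row : eqType := {l : 'I_L & 'I_(nobs l)}.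

(** A labelling of the sources: groups are taken as its fibres, hence are disjoint for distinct
    labels. Coefficients and noise share the label [None]. *)
Definition row_of (k : source s) : option design_row :=
  if k is inl (inl t) then Some (Tagged (fun l => 'I_(nobs l)) (tagged t).1)
  else None.

Definition row_set l (i : 'I_(nobs l)) : {set source s} :=
  fiber row_of (Some (Tagged (fun l => 'I_(nobs l)) i)).

Definition Z l (i : 'I_(nobs l)) (j : 'I_p) (w : T) : R := Zmx l w i j.

Definition ent l (i : 'I_(nobs l)) (j : 'I_p) : source s :=
  inl (inl (mk_entry (i, j))).

Lemma dep_entry (J : {set source s}) l (i : 'I_(nobs l)) j :
  ent i j \in J -> dep F J (Z i j).
Proof.
move=> iJ; apply: (dep1 FP iJ) => A mA; apply/generatedE.
by exists A.
Qed.

Lemma dep_Z_row l (i : 'I_(nobs l)) j : dep F (row_set i) (Z i j).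
Proof. by apply: dep_entry; rewrite inE. Qed.

Lemma row_set_disjoint l (i i' : 'I_(nobs l)) : i != i' ->
  [disjoint row_set i & row_set i']%B.
Proof.
by move=> ii; apply: fiber_disjoint; rewrite (inj_eq Some_inj) eq_Tagged.
Qed.

Let dep_entry1 l (i : 'I_(nobs l)) j :
  dep F [set ent i j]%SET (Z i j).
Proof. by apply: dep_entry; rewrite inE. Qed.

Let entry_disjoint l (i : 'I_(nobs l)) j j' : j != j' ->
  [disjoint [set ent i j]%SET & [set ent i j']%SET]%B.
Proof.
move=> jj; rewrite finset.disjoints_subset; apply/fintype.subsetP => k.
rewrite !inE => /eqP ->; apply: contra_neq jj.
by move=> /(congr1 (fun k : source s => if k is inl (inl t) then (tagged t).2 else j)).
Qed.

Lemma measurable_Z l (i : 'I_(nobs l)) j : measurable_fun setT (Z i j).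
Proof. exact: (measurable_Zval (mk_entry (i, j))). Qed.

Lemma mean_Z12 l (i : 'I_(nobs l)) j : mean_le P (fun w => Z i j w ^+ 12) M12.
Proof.
apply: mean_leP; first by apply: measurable_funX; exact: measurable_Z.
  by move=> w; rewrite exprn_even_ge0.
by have := Z_moment12 model i j; rewrite unlock.
Qed.

Lemma M12_ge0 l (i : 'I_(nobs l)) (j : 'I_p) : 0 <= M12.
Proof. exact: mean_le_ge0 (mean_Z12 i j). Qed.

(** From x^n <= 1 + x^12, a single constant [1 + M12] serves for all even moments up to the
    twelfth. *)
Lemma mean_Zpow (n : nat) l (i : 'I_(nobs l)) j : (n <= 12)%N -> ~~ odd n ->
  mean_le P (fun w => Z i j w ^+ n) M.
Proof.
move=> n12 on; apply: (@mean_le_mono _ _ _ P _ (fun w => 1 + Z i j w ^+ 12) M).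
- by apply: measurable_funX; exact: measurable_Z.
- by move=> w; rewrite exprn_even_ge0//= (le_trans (ler_norm _))// norm_pow_le.
- by apply: mean_leD; [exact: mean_le_cst|exact: mean_Z12].
- by [].
Qed.

Lemma integ_Z l (i : 'I_(nobs l)) j : integ P (Z i j).
Proof.
have mZ := measurable_Z i j.
have := @integ_pow_le _ _ _ P 1 12 (Z i j) isT isT mZ.
by apply; case: (mean_Z12 i j).
Qed.

Lemma Ex_Z l (i : 'I_(nobs l)) j : Ex P (Z i j) = 0.
Proof. by rewrite -expectation_Ex (Z_mean model). Qed.

Lemma Ex_Z2 l (i : 'I_(nobs l)) j : Ex P (fun w => Z i j w ^+ 2) = 1.
Proof.
rewrite -expectation_Ex.
have := Z_variance model i j; rewrite /variance unlock (Z_mean model).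
move=> E; transitivity (fine (1%:E : \bar R)); last by [].
rewrite -E; congr fine; rewrite unlock; apply: eq_integral => w _.
by rewrite !fctE /= subr0 expr2.
Qed.

Lemma Ex_ZZ l (i : 'I_(nobs l)) j j' :
  integ P (fun w => Z i j w * Z i j' w) /\
  Ex P (fun w => Z i j w * Z i j' w) = (j == j')%:R.
Proof.
have [<-|jj] := eqVneq j j'.
  have E : (fun w => Z i j w * Z i j w) = (fun w => Z i j w ^+ 2).
    by apply/funext => w; rewrite expr2.
  by rewrite E Ex_Z2; split => //; case: (@mean_Zpow 2 l i j isT isT).
have [? ->] := Ex_mul FP (@entry_disjoint l i j j' jj) (@dep_entry1 l i j) (@dep_entry1 l i j')
  (integ_Z i j) (integ_Z i j').
by rewrite !Ex_Z mulr0.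
Qed.

Definition lin l (i : 'I_(nobs l)) (u : 'cV[R]_p) (w : T) : R :=
  \sum_j Z i j w * u j 0.

Lemma dep_lin l (i : 'I_(nobs l)) u : dep F (row_set i) (lin i u).
Proof.
by apply: dep_sum => j; apply: depM; [exact: dep_Z_row|exact: dep_cst].
Qed.

Lemma measurable_lin l (i : 'I_(nobs l)) u : measurable_fun setT (lin i u).
Proof. exact: (dep_measurable FP (@dep_lin l i u)). Qed.

Lemma Ex_lin l (i : 'I_(nobs l)) u : integ P (lin i u) /\ Ex P (lin i u) = 0.
Proof.
split; first by apply: integ_sum => j _; apply: integZr; exact: integ_Z.
rewrite Ex_sum => [|j _]; last by apply: integZr; exact: integ_Z.
by apply: big1 => j _; rewrite ExZr ?Ex_Z ?mul0r//; exact: integ_Z.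
Qed.

Lemma Ex_lin_lin l (i : 'I_(nobs l)) u v :
  integ P (fun w => lin i u w * lin i v w) /\
  Ex P (fun w => lin i u w * lin i v w) = dot u v.
Proof.
have E : (fun w => lin i u w * lin i v w) =
    (fun w => \sum_j \sum_k (u j 0 * v k 0) * (Z i j w * Z i k w)).
  apply/funext => w; rewrite big_distrlr /=; apply: eq_bigr => j _.
  by apply: eq_bigr => k _; ring.
have ii j k : integ P (fun w => (u j 0 * v k 0) * (Z i j w * Z i k w)).
  by apply: integZ; case: (Ex_ZZ i j k).
rewrite E; split; first by apply: integ_sum => j _; exact: integ_sum.
rewrite Ex_sum => [|j _]; last exact: integ_sum.
apply: eq_bigr => j _; rewrite Ex_sum//.
rewrite (bigD1 j)//= big1 ?addr0 => [|k kj].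
  by have [ij Ej] := Ex_ZZ i j j; rewrite ExZ// Ej eqxx mulr1.
have [ik Ek] := Ex_ZZ i j k.
by rewrite ExZ// Ek eq_sym (negbTE kj) mulr0.
Qed.

Lemma mean_lin2 l (i : 'I_(nobs l)) u : integ P (fun w => lin i u w ^+ 2) /\
  Ex P (fun w => lin i u w ^+ 2) = nrm2 u.
Proof. by under eq_fun do rewrite expr2; rewrite -dot_nrm2; exact: Ex_lin_lin. Qed.

Lemma mean_lin4 l (i : 'I_(nobs l)) u :
  mean_le P (fun w => lin i u w ^+ 4) (3 * (M * nrm2 u) ^+ 2).
Proof.
(* The sign of [M12] is read off an actual entry. Without columns there is none, but then the linear
   form is identically zero. *)
have [j0 _|p0] := pickP 'I_p; last first.
  rewrite (_ : (fun w => _) = fun=> 0).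
    by apply: mean_le_zero; rewrite mulr_ge0// sqr_ge0.
  by apply/funext => w; rewrite /lin big1 ?expr0n// => j; have := p0 j.
have M1 : 1 <= M by rewrite lerDl (M12_ge0 i j0).
have -> : M * nrm2 u = \sum_j M * u j 0 ^+ 2 by rewrite -mulr_sumr.
apply: (@mean_le_pow4_sum _ _ _ P _ F FP _
  (fun j => [set ent i j]%SET) (fun j w => Z i j w * u j 0)
  (fun j => M * u j 0 ^+ 2) _ _ _ (index_enum 'I_p)).
- exact: entry_disjoint.
- by move=> j; apply: depM; [exact: dep_entry1|exact: dep_cst].
- by move=> j; rewrite ExZr ?Ex_Z ?mul0r//; exact: integ_Z.
- exact: index_enum_uniq.
- by move=> j; rewrite mulr_ge0 ?sqr_ge0// (le_trans _ M1).
- move=> j; apply: (@mean_le_mono _ _ _ P _ (fun w => u j 0 ^+ 4 * Z i j w ^+ 4)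
    (u j 0 ^+ 4 * M)).
  + by apply: measurable_funX; apply: measurable_funM => //; exact: measurable_Z.
  + by move=> w; rewrite exprn_even_ge0//= exprMn mulrC.
  + by apply: mean_leZ; [rewrite exprn_even_ge0|exact: mean_Zpow].
  (* Here M >= 1 is used: M u^4 <= (M u^2)^2 puts the fourth moment in the form required for
     sums. *)
  + rewrite exprMn -exprM mulrC ler_wpM2r ?exprn_even_ge0//.
    by rewrite expr2 ler_peMl// (le_trans _ M1).
Qed.

Lemma pow4_sum_le (I : finType) (b : I -> R) :
  (\sum_i b i) ^+ 4 <= #|I|%:R ^+ 3 * \sum_i b i ^+ 4.
Proof.
have h (a : I -> R) : (\sum_i a i) ^+ 2 <= #|I|%:R * \sum_i a i ^+ 2.
  have := cauchy_schwarz_sum (fun=> 1) a.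
  under eq_bigr do rewrite mul1r.
  under [X in _ <= X * _]eq_bigr do rewrite expr1n.
  by rewrite sumr_const.
rewrite (exprM _ 2 2).
apply: (@le_trans _ _ ((#|I|%:R * \sum_i b i ^+ 2) ^+ 2)).
  by rewrite lerXn2r ?nnegrE ?sqr_ge0// mulr_ge0//; apply: sumr_ge0 => i _; exact: sqr_ge0.
rewrite exprMn [_ ^+ 3]exprSr -mulrA ler_wpM2l ?sqr_ge0//.
apply: (le_trans (h _)); rewrite ler_wpM2l//.
by apply: ler_sum => i _; rewrite -exprM.
Qed.

Definition zgram l (w : T) : 'M[R]_p := (Zmx l w)^T *m Zmx l w.

Lemma zgramE l w j j' : zgram l w j j' = \sum_k Z (l := l) k j w * Z k j' w.
Proof. by rewrite mxE; apply: eq_bigr => k _; rewrite mxE. Qed.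

Lemma measurable_zgram l j j' : measurable_fun setT (fun w => zgram l w j j').
Proof.
under eq_fun do rewrite zgramE.
by apply: measurable_sum => k; apply: measurable_funM; exact: measurable_Z.
Qed.

(** Off the diagonal, an entry is a sum of n independent centred products, with fourth moment of
    order n^2. On the diagonal it has size n, and its fourth moment needs the eighth moment of Z.
    Both bounds are written as squares so that Minkowski's inequality applies to the squared
    entries. *)
Lemma mean_zgram4 (l : 'I_L) j j' : (0 < nobs l)%N ->
  mean_le P (fun w => zgram l w j j' ^+ 4)
    ((2 * (nobs l)%:R * M + (j == j')%:R * (nobs l)%:R ^+ 2 * M) ^+ 2).
Proof.
move=> n0; set n := (nobs l)%:R.
have M1 : 1 <= M by rewrite lerDl (M12_ge0 (Ordinal n0) j).
have M0 : 0 <= M by rewrite (le_trans _ M1).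
have nn : 0 <= n :> R by [].
have mz4 : measurable_fun setT (fun w => zgram l w j j' ^+ 4).
  by apply: measurable_funX; exact: measurable_zgram.
have [<-|jj] := eqVneq j j'; rewrite ?mul1r ?mul0r ?addr0.
  apply: (@mean_le_mono _ _ _ P _ (fun w => n ^+ 3 * \sum_k Z (l := l) k j w ^+ 8)
    (n ^+ 3 * \sum_(k < nobs l) M)).
  - by apply: measurable_funX; exact: measurable_zgram.
  - move=> w; rewrite exprn_even_ge0//= zgramE.
    have := pow4_sum_le (fun k => Z (l := l) k j w * Z k j w).
    rewrite card_ord => /le_trans; apply; rewrite ler_wpM2l ?exprn_ge0//.
    by apply: ler_sum => k _; rewrite -expr2 -exprM.
  - apply: mean_leZ; first exact: exprn_ge0.
    by apply: mean_le_sum => k _; exact: mean_Zpow.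
  - rewrite sum_ord_const -/n.
    rewrite (@le_trans _ _ ((n ^+ 2 * M) ^+ 2))//.
      have -> : (n ^+ 2 * M) ^+ 2 = n ^+ 3 * (n * M) * M by ring.
      by rewrite ler_peMr// !mulr_ge0// exprn_ge0.
    rewrite lerXn2r ?nnegrE ?addr_ge0 ?mulr_ge0 ?exprn_ge0// lerDr.
    by rewrite !mulr_ge0.
have h := @mean_le_pow4_sum _ _ _ P _ F FP _ (@row_set l)
  (fun k w => Z k j w * Z k j' w) (fun=> M).
apply: (@mean_le_mono _ _ _ P _ (fun w => (\sum_k Z (l := l) k j w * Z k j' w) ^+ 4)
    (3 * (\sum_(k < nobs l) M) ^+ 2)) => //.
- by move=> w; rewrite exprn_even_ge0//= zgramE.
- apply: h; [exact: row_set_disjoint| | |exact: index_enum_uniq|by []|].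
  + by move=> k; apply: depM; exact: dep_Z_row.
  + by move=> k; have [_ ->] := Ex_ZZ k j j'; rewrite (negbTE jj).
  + move=> k.
    have m4 j0 : mean_le P (fun w => Z k j0 w ^+ 4) M by exact: mean_Zpow.
    have [_ i1 e1] := m4 j; have [_ i2 e2] := m4 j'.
    have [ii E] := Ex_mul FP (@entry_disjoint l k j j' jj)
      (depX 4 (@dep_entry1 l k j)) (depX 4 (@dep_entry1 l k j')) i1 i2.
    rewrite (_ : (fun w => _) = (fun w => Z k j w ^+ 4 * Z k j' w ^+ 4)).
      split=> //; first by move=> w; rewrite mulr_ge0// exprn_even_ge0.
      rewrite E expr2 ler_pM//; apply: Ex_ge0 => w; exact: exprn_even_ge0.
    by apply/funext => w; rewrite exprMn.
- rewrite sum_ord_const -/n.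
  have := sqr_ge0 (n * M); nra.
Qed.

(** Minkowski's inequality sums p^2 contributions of order n and p diagonal ones of order n^2; for n
    comparable to p both totals are of order p^3. *)
Lemma mean_zgram_fro (l : 'I_L) : (0 < nobs l)%N -> mean_le P (fun w => fro2 (zgram l w) ^+ 2)
  ((2 * (nobs l)%:R * p%:R ^+ 2 * M + (nobs l)%:R ^+ 2 * p%:R * M) ^+ 2).
Proof.
move=> n0; set n : R := (nobs l)%:R.
have n1 : 0 < n by rewrite ltr0n.
have [j0 _|p0] := pickP 'I_p; last first.
  rewrite (_ : (fun w => _) = fun=> 0); first by apply: mean_le_zero; exact: sqr_ge0.
  by apply/funext => w; rewrite /fro2 big1 ?expr0n// => j; have := p0 j.
have M1 : 1 <= M by rewrite lerDl (M12_ge0 (Ordinal n0) j0).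
have M0 : 0 < M by rewrite (lt_le_trans _ M1).
have := @mean_le_sum_sqr _ _ _ P ('I_p * 'I_p)%type
  (fun jj w => zgram l w jj.1 jj.2 ^+ 2)
  (fun jj => 2 * n * M + (jj.1 == jj.2)%:R * n ^+ 2 * M).
have -> : \sum_(jj : 'I_p * 'I_p) (2 * n * M + (jj.1 == jj.2)%:R * n ^+ 2 * M) =
    2 * n * p%:R ^+ 2 * M + n ^+ 2 * p%:R * M.
  rewrite -(pair_bigA _ (fun j j' : 'I_p => 2 * n * M + (j == j')%:R * n ^+ 2 * M)) /=.
  transitivity (\sum_(j < p) (2 * n * M * p%:R + n ^+ 2 * M)).
    apply: eq_bigr => j _; rewrite big_split sumr_const card_ord /= mulr_natr.
    congr (_ + _); rewrite (bigD1 j)//= eqxx mul1r big1 ?addr0// => k kj.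
    by rewrite eq_sym (negbTE kj) !mul0r.
  by rewrite sum_ord_const; ring.
under [X in _ -> _ -> _ -> _ -> mean_le P X _]eq_fun do
  rewrite -(pair_bigA _ (fun j j' => zgram l _ j j' ^+ 2)).
apply.
- by move=> jj; apply: measurable_funX; exact: measurable_zgram.
- by move=> jj w; exact: sqr_ge0.
- move=> jj; rewrite ltr_wpDr//; last by rewrite !mulr_gt0.
  by rewrite !mulr_ge0 ?exprn_ge0// ltW.
- by move=> jj; under eq_fun do rewrite -exprM; exact: mean_zgram4.
Qed.

End entry_moments.

Section vector_lln.
Context {R : realType} {d : measure_display} {T : measurableType d}.
Variables (P : probability T R) (K : finType) (F : K -> set (set T)).
Hypothesis FP : independent_sigma P F.

(** Weak law for independent vectors, coordinate by coordinate. It is used for the p^4 coefficients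
    of the Hessian and for the p^2 entries of [gram2] and of the score. *)
Lemma mean_le_lln (L : nat) (Q : finType) (J : 'I_L -> {set K})
    (f : 'I_L -> Q -> T -> R) (c : R) : (0 < L)%N ->
  (forall l l', l != l' -> [disjoint J l & J l']%B) ->
  (forall l q, dep F (J l) (f l q)) ->
  (forall l, mean_le P (fun w => \sum_q f l q w ^+ 2) c) ->
  (forall q, integ P (fun w => L%:R^-1 * \sum_l f l q w)) /\
  mean_le P (fun w => \sum_q (L%:R^-1 * \sum_l f l q w -
    Ex P (fun w => L%:R^-1 * \sum_l f l q w)) ^+ 2) (c / L%:R).
Proof.
move=> L0 dJ fJ fc.
have mf l q : measurable_fun setT (f l q) by exact: (dep_measurable FP (fJ l q)).
have f2 l q : mean_le P (fun w => f l q w ^+ 2) (Ex P (fun w => f l q w ^+ 2)).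
  by split=> // [w|]; [exact: sqr_ge0|case: (coord_integ (mf l q) (fc l))].
have fi l q : integ P (f l q) by case: (coord_integ (mf l q) (fc l)).
have ii q : integ P (fun w => L%:R^-1 * \sum_l f l q w).
  by apply: integZ; exact: integ_sum.
split=> //.
have E q w : L%:R^-1 * \sum_l f l q w - Ex P (fun w => L%:R^-1 * \sum_l f l q w) =
    L%:R^-1 * \sum_l (f l q w - Ex P (f l q)).
  by rewrite ExZ ?Ex_sum//; [rewrite sumrB mulrBr|exact: integ_sum].
have step q : mean_le P (fun w => (\sum_l (f l q w - Ex P (f l q))) ^+ 2)
    (\sum_l Ex P (fun w => f l q w ^+ 2)).
  have cJ l : dep F (J l) (fun w => f l q w - Ex P (f l q)).
    by apply: depB => //; exact: dep_cst.
  have c0 l : Ex P (fun w => f l q w - Ex P (f l q)) = 0.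
    by rewrite (ExB (fi l q) (integ_cst _ _)) Ex_cst subrr.
  have c2 l : mean_le P (fun w => (f l q w - Ex P (f l q)) ^+ 2)
      (Ex P (fun w => f l q w ^+ 2)) := mean_le_center (fi l q) (f2 l q).
  by have [] := mean_le_sqr_sum FP dJ cJ c0 (index_enum_uniq 'I_L) c2.
have -> : (fun w => \sum_q (L%:R^-1 * \sum_l f l q w -
    Ex P (fun w => L%:R^-1 * \sum_l f l q w)) ^+ 2) =
    (fun w => L%:R^-2 * \sum_q (\sum_l (f l q w - Ex P (f l q))) ^+ 2).
  apply/funext => w; rewrite mulr_sumr; apply: eq_bigr => q _.
  by rewrite E exprMn exprVn.
have -> : c / L%:R = L%:R^-2 * \sum_(l < L) c.
  rewrite sum_ord_const; field.
  by rewrite pnatr_eq0 -lt0n.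
have [h0 hi hle] := mean_le_sum (index_enum Q) (fun q (_ : xpredT q) => step q).
apply: mean_leZ; first by rewrite invr_ge0 exprn_ge0.
split=> //; apply: (le_trans hle); rewrite exchange_big; apply: ler_sum => l _.
have [_ _ el] := fc l; apply: le_trans el.
by rewrite Ex_sum => [//|q _]; case: (f2 l q).
Qed.

End vector_lln.

(** Non-asymptotic form of the conditions on one study. At least two observations are required
    because coercivity comes from pairs of distinct rows; the bounds on Sigma are expressed through
    its square root. *)
Record regular_design (R : realType) d (s : multi_study R d) (kap clo chi : R) :
    Prop := {
  L_gt0 : (0 < nL s)%N;
  dim_gt0 : (0 < dim s)%N;
  nobs_gt1 : forall l : 'I_(nL s), (1 < nobs l)%N;
  kap_ge1 : 1 <= kap;
  nobs_le : forall l : 'I_(nL s), (nobs l)%:R <= kap * (dim s)%:R;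
  dim_le : forall l : 'I_(nL s), (dim s)%:R <= kap * (nobs l)%:R;
  clo_gt0 : 0 < clo;
  sqrt_lo : forall (l : 'I_(nL s)) v, clo * nrm2 v <= nrm2 (Sigma_half l *m v);
  sqrt_hi : forall (l : 'I_(nL s)) v, nrm2 (Sigma_half l *m v) <= chi * nrm2 v
}.

Lemma sqr_mul_le (R : realFieldType) (x y : R) :
  (x * y) ^+ 2 <= 2^-1 * (x ^+ 4 + y ^+ 4).
Proof.
rewrite -subr_ge0 (_ : _ - _ = 2^-1 * (x ^+ 2 - y ^+ 2) ^+ 2); last by field.
by rewrite mulr_ge0 ?invr_ge0 ?sqr_ge0.
Qed.

(** * Concentration and coercivity of the Hessian *)

Section gram_moments.
Context {R : realType} {d : measure_display}.
Variables (s : multi_study R d) (sigma M12 kap clo chi : R).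
Hypothesis model : model_assumptions s sigma M12.
Hypothesis reg : regular_design s kap clo chi.
Local Notation p := (dim s).
Local Notation L := (nL s).
Local Notation T := (space s).
Local Notation P := (Pr s).
Local Notation F := (@source_system _ _ s).
Local Notation M := (1 + M12).
Implicit Types l : 'I_L.

Let FP : independent_sigma P F := sources_independent_sigma model.
Let n0 l : (0 < nobs l)%N := ltnW (nobs_gt1 reg l).
Let j0 : 'I_p := Ordinal (dim_gt0 reg).
Let l0 : 'I_L := Ordinal (L_gt0 reg).

Lemma M_ge1 : 1 <= M.
Proof. by rewrite lerDl (M12_ge0 model (Ordinal (n0 l0)) j0). Qed.

Lemma chi_gt0 : 0 < chi.
Proof.
have := le_trans (sqrt_lo reg l0 (delta_mx j0 0)) (sqrt_hi reg l0 (delta_mx j0 0)).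
suff d1 : 0 < nrm2 (delta_mx j0 0 : 'cV[R]_p).
  by rewrite ler_pM2r// => h; exact: lt_le_trans (clo_gt0 reg) h.
rewrite /nrm2 (bigD1 j0)//= mxE !eqxx expr1n ltr_pwDl//.
by apply: sumr_ge0 => i _; exact: sqr_ge0.
Qed.

Lemma sqrtT l : (Sigma_half l)^T = Sigma_half l.
Proof. by have [[]] := Sigma_halfP model l. Qed.

Definition Xset l : {set source s} :=
  [set k | if k is inl (inl t) then tag t == l else false]%SET.

Lemma Xset_disjoint l l' : l != l' -> [disjoint Xset l & Xset l']%B.
Proof.
move=> ll; rewrite finset.disjoints_subset; apply/fintype.subsetP => -[[t|?]|?];
  rewrite !inE //.
by move=> /eqP ->.
Qed.

Lemma row_set_sub l (i : 'I_(nobs l)) : row_set i \subset Xset l.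
Proof.
apply/fintype.subsetP => -[[t|?]|?]; rewrite !inE //=.
by rewrite (inj_eq Some_inj) => /eqP/(congr1 tag)/= ->.
Qed.

Lemma XmxE l w i j : Xmx l w i j = lin i (col j (Sigma_half l)) w.
Proof. by rewrite mxE; apply: eq_bigr => k _; rewrite mxE. Qed.

Lemma Xmx_mulE l w (u : 'cV[R]_p) i : (Xmx l w *m u) i 0 = lin i (Sigma_half l *m u) w.
Proof. by rewrite /Xmx -mulmxA mxE. Qed.

Lemma dep_X_row l (i : 'I_(nobs l)) j : dep F (row_set i) (fun w => Xmx l w i j).
Proof. by under eq_fun do rewrite XmxE; exact: (dep_lin model). Qed.

Lemma dep_X l i j : dep F (Xset l) (fun w => Xmx l w i j).
Proof. exact: (sub_dep FP (row_set_sub i) (@dep_X_row l i j)). Qed.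

Lemma dep_gram l i j : dep F (Xset l) (fun w => gram l w i j).
Proof.
under eq_fun do rewrite mxE.
apply: dep_sum => k; apply: depM; last exact: dep_X.
by under eq_fun do rewrite mxE; exact: dep_X.
Qed.

Lemma measurable_gram l i j : measurable_fun setT (fun w => gram l w i j).
Proof. exact: (dep_measurable FP (@dep_gram l i j)). Qed.

Lemma gramE l w : gram l w = Sigma_half l *m zgram l w *m Sigma_half l.
Proof. by rewrite /gram /zgram /Xmx trmx_mul sqrtT !mulmxA. Qed.

Lemma fro2_sqrt_mul l n (A : 'M[R]_(p, n)) : fro2 (Sigma_half l *m A) <= chi * fro2 A.
Proof. by apply: fro2_mulmx_le; exact: (sqrt_hi reg). Qed.

Lemma gram_fro_le l w : fro2 (gram l w) <= chi ^+ 2 * fro2 (zgram l w).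
Proof.
rewrite gramE -mulmxA (le_trans (fro2_sqrt_mul _ _))// expr2 -mulrA.
rewrite ler_wpM2l ?(ltW chi_gt0)//.
rewrite -fro2_tr trmx_mul sqrtT (le_trans (fro2_sqrt_mul _ _))//.
by rewrite fro2_tr.
Qed.

(** Obtained by inserting n <= kap p into the bound for Z^T Z, where both totals become multiples of
    p^3; the two multiplications by the root of Sigma contribute [chi ^+ 2]. *)
Definition gram_const := (chi ^+ 2 * ((2 * kap + kap ^+ 2) * M)) ^+ 2.

Lemma measurable_fro2 (n m : nat) (A : T -> 'M[R]_(n, m)) :
  (forall i j, measurable_fun setT (fun w => A w i j)) ->
  measurable_fun setT (fun w => fro2 (A w)).
Proof.
move=> mA; apply: measurable_sum => i; apply: measurable_sum => j.
by apply: measurable_funX; exact: mA.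
Qed.

Lemma mean_gram_fro l :
  mean_le P (fun w => fro2 (gram l w) ^+ 2) (gram_const * p%:R ^+ 6).
Proof.
apply: (@mean_le_mono _ _ _ P _ (fun w => (chi ^+ 2) ^+ 2 * fro2 (zgram l w) ^+ 2)).
- by apply: measurable_funX; apply: measurable_fro2 => i j; exact: measurable_gram.
- move=> w; rewrite sqr_ge0/= -exprMn lerXn2r ?nnegrE ?fro2_ge0 ?gram_fro_le//.
  by rewrite mulr_ge0 ?fro2_ge0 ?sqr_ge0.
- by apply: mean_leZ; [exact: sqr_ge0|exact: (mean_zgram_fro model (n0 l))].
- have M0 := le_trans ler01 M_ge1; have k0 := le_trans ler01 (kap_ge1 reg).
  have pp : 0 <= p%:R :> R by []. have nn : 0 <= (nobs l)%:R :> R by [].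
  rewrite -exprMn (_ : gram_const * _ =
     (chi ^+ 2 * ((2 * kap + kap ^+ 2) * M * p%:R ^+ 3)) ^+ 2); last first.
    by rewrite /gram_const; ring.
  rewrite lerXn2r ?nnegrE//.
  - rewrite mulr_ge0 ?sqr_ge0//.
    by rewrite addr_ge0// !mulr_ge0// exprn_ge0.
  - rewrite mulr_ge0 ?sqr_ge0//.
    by rewrite !mulr_ge0 ?exprn_ge0// addr_ge0 ?mulr_ge0 ?exprn_ge0.
  rewrite ler_wpM2l ?sqr_ge0//.
  rewrite (_ : 2 * _ * _ * _ + _ =
     (2 * (nobs l)%:R * p%:R ^+ 2 + (nobs l)%:R ^+ 2 * p%:R) * M); last by ring.
  rewrite [X in _ <= X](_ : _ = ((2 * kap + kap ^+ 2) * p%:R ^+ 3) * M); last by ring.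
  rewrite ler_wpM2r//.
  have h := nobs_le reg l.
  rewrite (_ : (2 * kap + kap ^+ 2) * p%:R ^+ 3 =
    2 * (kap * p%:R) * p%:R ^+ 2 + (kap * p%:R) ^+ 2 * p%:R); last by ring.
  apply: lerD; first by rewrite ler_wpM2r ?exprn_ge0// ler_wpM2l.
  by rewrite ler_wpM2r// lerXn2r ?nnegrE// mulr_ge0.
Qed.

Let pR : (p%:R : R) != 0.
Proof. by rewrite pnatr_eq0 -lt0n (dim_gt0 reg). Qed.

Lemma mdot_conj_sum (A B C D : 'M[R]_p) : mdot A (B *m C *m D) =
  \sum_q A q.1.1 q.1.2 * C q.2.1 q.2.2 * (B q.1.1 q.2.1 * D q.2.2 q.1.2).
Proof.
rewrite -(pair_bigA _ (fun ab cd : 'I_p * 'I_p =>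
  A ab.1 ab.2 * C cd.1 cd.2 * (B ab.1 cd.1 * D cd.2 ab.2))) /=.
rewrite -(pair_bigA _ (fun a b => \sum_cd A a b * C cd.1 cd.2 * (B a cd.1 * D cd.2 b))) /=.
apply: eq_bigr => a _; apply: eq_bigr => b _.
rewrite -(pair_bigA _ (fun c e => A a b * C c e * (B a c * D e b))) /=.
rewrite mxE mulr_sumr exchange_big /=; apply: eq_bigr => e _.
rewrite mxE mulr_suml mulr_sumr; apply: eq_bigr => c _; ring.
Qed.

(** Coefficients of the Hessian as a bilinear form on matrices: the average of the tensors of S_l
    with itself. *)
Definition hess_coef (q : ('I_p * 'I_p) * ('I_p * 'I_p)) (w : T) : R :=
  L%:R^-1 * \sum_l p%:R^-2 * (gram l w q.1.1 q.2.1 * gram l w q.2.2 q.1.2).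

Lemma hess_coefE w K : mdot K (hess w K) =
  \sum_q K q.1.1 q.1.2 * K q.2.1 q.2.2 * hess_coef q w.
Proof.
rewrite mdotZr mdot_sumr /hess_coef.
under [RHS]eq_bigr do rewrite mulrCA mulr_sumr.
rewrite -mulr_sumr [in RHS]exchange_big; congr (_ * _); apply: eq_bigr => l _ /=.
rewrite mdotZr mdot_conj_sum mulr_sumr; apply: eq_bigr => q _; ring.
Qed.

(** The Hilbert-Schmidt norm of the tensor of A with itself is the square of the Frobenius norm of
    A. *)
Lemma fro2_sqr_sum (A : 'M[R]_p) : fro2 A ^+ 2 =
  \sum_q (A q.1.1 q.2.1 * A q.2.2 q.1.2) ^+ 2.
Proof.
rewrite -(pair_bigA _ (fun ab cd : 'I_p * 'I_p => (A ab.1 cd.1 * A cd.2 ab.2) ^+ 2)) /=.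
rewrite -(pair_bigA _ (fun a b => \sum_cd (A a cd.1 * A cd.2 b) ^+ 2)) /=.
rewrite /fro2 expr2 mulr_suml; apply: eq_bigr => a _.
rewrite [in LHS](exchange_big_dep xpredT)//= mulr_sumr; apply: eq_bigr => b _.
rewrite -(pair_bigA _ (fun c e => (A a c * A e b) ^+ 2)) /=.
rewrite big_distrlr; apply: eq_bigr => c _; apply: eq_bigr => e _ /=.
by rewrite exprMn.
Qed.

Lemma hess_coef_lln : (forall q, integ P (hess_coef q)) /\
  mean_le P (fun w => \sum_q (hess_coef q w - Ex P (hess_coef q)) ^+ 2)
    (gram_const * p%:R ^+ 2 / L%:R).
Proof.
apply: (mean_le_lln FP (L_gt0 reg) Xset_disjoint) => [l q|l].
  by apply: depM; [exact: dep_cst|apply: depM; exact: dep_gram].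
rewrite (_ : (fun w => _) = fun w => p%:R ^- 4 * fro2 (gram l w) ^+ 2); last first.
  apply/funext => w; rewrite fro2_sqr_sum mulr_sumr; apply: eq_bigr => q _.
  by rewrite exprMn -exprVn -exprM exprVn.
rewrite (_ : gram_const * _ = p%:R ^- 4 * (gram_const * p%:R ^+ 6)); last by field.
by apply: mean_leZ; [rewrite invr_ge0 exprn_ge0|exact: mean_gram_fro].
Qed.

Let clo0 := clo_gt0 reg.
Let chi0 := chi_gt0.
Let pp : 0 < p%:R :> R.
Proof. by rewrite ltr0n; exact: dim_gt0 reg. Qed.
Let LL : 0 < L%:R :> R.
Proof. by rewrite ltr0n; exact: L_gt0 reg. Qed.
Let k0 : 0 < kap := lt_le_trans ltr01 (kap_ge1 reg).

(** With rows x_i and x_i' of the design, the entry is the product of y = K^T x_i with x_i'. Given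
    x_i, its second moment is |Sigma^(1/2) y|^2 >= clo |y|^2, and the mean of |y|^2 is in turn at
    least clo ||K||_F^2. The bound with [chi] only provides integrability. *)
Lemma mean_cross l (i i' : 'I_(nobs l)) (K : 'M[R]_p) : i != i' ->
  integ P (fun w => (Xmx l w *m K *m (Xmx l w)^T) i i' ^+ 2) /\
  clo ^+ 2 * fro2 K <= Ex P (fun w => (Xmx l w *m K *m (Xmx l w)^T) i i' ^+ 2).
Proof.
move=> ii.
pose y (w : T) : 'cV[R]_p := \col_b lin i (Sigma_half l *m col b K) w.
have yE w b : (Xmx l w *m K) i b = y w b 0.
  by rewrite [RHS]mxE -Xmx_mulE colE mulmxA -colE [RHS]mxE.
pose f (z : T * T) := (\sum_b y z.1 b 0 * Xmx l z.2 i' b) ^+ 2.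
have fdiag w : (Xmx l w *m K *m (Xmx l w)^T) i i' ^+ 2 = f (w, w).
  by rewrite /f mxE; congr (_ ^+ 2); apply: eq_bigr => b _; rewrite yE [X in _ * X = _]mxE.
have fE w w' : f (w, w') = lin i' (Sigma_half l *m y w) w' ^+ 2.
  rewrite /f -Xmx_mulE mxE; congr (_ ^+ 2).
  by apply: eq_bigr => b _; rewrite mulrC.
have my b : dep F (row_set i) (fun w => y w b 0).
  by under eq_fun do rewrite mxE; exact: (dep_lin model).
have mf : measurable_fun [set: gen F (row_set i) * gen F (row_set i')] f.
  apply: measurable_funX; apply: measurable_sum => b; apply: measurable_funM.
    exact: (measurableT_comp (my b)).
  exact: (measurableT_comp (@dep_X_row _ i' b)).
have dJ := row_set_disjoint ii.
have ny w : nrm2 (y w) = \sum_b lin i (Sigma_half l *m col b K) w ^+ 2.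
  by apply: eq_bigr => b _; rewrite mxE.
have iny : integ P (fun w => nrm2 (y w)).
  under eq_fun do rewrite ny.
  by apply: integ_sum => b _; case: (mean_lin2 model i (Sigma_half l *m col b K)).
have Eny : clo * fro2 K <= Ex P (fun w => nrm2 (y w)).
  under eq_fun do rewrite ny.
  rewrite Ex_sum => [|b _]; last by case: (mean_lin2 model i (Sigma_half l *m col b K)).
  rewrite fro2_col mulr_sumr; apply: ler_sum => b _.
  have [_ ->] := mean_lin2 model i (Sigma_half l *m col b K).
  exact: (sqrt_lo reg).
have mSy : measurable_fun setT (fun w => nrm2 (Sigma_half l *m y w)).
  apply: measurable_sum => a; apply: measurable_funX.
  under eq_fun do rewrite mxE.
  apply: measurable_sum => b; apply: measurable_funM => //.
  exact: (dep_measurable FP (my b)).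
have fw w : integ P (fun w' => f (w, w')) /\
    Ex P (fun w' => f (w, w')) = nrm2 (Sigma_half l *m y w).
  have -> : (fun w' => f (w, w')) = (fun w' => lin i' (Sigma_half l *m y w) w' ^+ 2).
    by apply/funext => w'; exact: fE.
  exact: (mean_lin2 model).
have mSyb : mean_le P (fun w => nrm2 (Sigma_half l *m y w))
    (chi * Ex P (fun w => nrm2 (y w))).
  apply: (mean_le_mono mSy (g := fun w => chi * nrm2 (y w)) _ _ (lexx _)).
    by move=> w; rewrite nrm2_ge0 (sqrt_hi reg).
  apply: mean_leZ; first exact: ltW.
  by split => // w; exact: nrm2_ge0.
have [_ fi _] : mean_le P (fun w => f (w, w)) (chi * Ex P (fun w => nrm2 (y w))).
  apply: (mean_le_decoupling FP dJ mf _ _ mSyb).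
    by move=> z; exact: sqr_ge0.
  move=> w; have [fi fe] := fw w; split; [by move=> w'; exact: sqr_ge0|by []|].
  by rewrite fe.
have [_ E] := Ex_decoupling FP dJ mf fi (fun w => (fw w).1).
under eq_fun do rewrite fdiag.
split=> //; rewrite E.
apply: (@le_trans _ _ (clo * Ex P (fun w => nrm2 (y w)))).
  by rewrite expr2 -mulrA ler_wpM2l// ltW.
rewrite -ExZ//; apply: Ex_le; first exact: integZ.
  by under eq_fun do rewrite (fw _).2; case: mSyb.
by move=> w; rewrite (fw w).2; exact: (sqrt_lo reg).
Qed.

(** The factor 1 / (2 kap^2) bounds n (n - 1) / p^2 from below, since p <= kap n and n >= 2. *)
Definition hess_const := clo ^+ 2 / (2 * kap ^+ 2).

Lemma hess_const_gt0 : 0 < hess_const.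
Proof. by rewrite divr_gt0 ?mulr_gt0 ?exprn_gt0. Qed.

(** The diagonal entries of X K X^T, where a row meets itself, are discarded; the n (n - 1) others
    suffice. *)
Lemma Ex_hess_coef_quad K : hess_const * fro2 K <=
  \sum_q K q.1.1 q.1.2 * K q.2.1 q.2.2 * Ex P (hess_coef q).
Proof.
have [ci _] := hess_coef_lln.
have -> : \sum_q K q.1.1 q.1.2 * K q.2.1 q.2.2 * Ex P (hess_coef q) =
    Ex P (fun w => mdot K (hess w K)).
  under [in RHS]eq_fun do rewrite hess_coefE.
  rewrite Ex_sum => [|q _]; last exact: integZ.
  by apply: eq_bigr => q _; rewrite ExZ.
have ih : integ P (fun w => mdot K (hess w K)).
  under eq_fun do rewrite hess_coefE.
  by apply: integ_sum => q _; exact: integZ.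
pose c l (ii : 'I_(nobs l) * 'I_(nobs l)) w :=
  (Xmx l w *m K *m (Xmx l w)^T) ii.1 ii.2 ^+ 2.
pose lower w := L%:R^-1 * \sum_l p%:R^-2 * \sum_(ii | ii.1 != ii.2) @c l ii w.
have ic l ii : ii.1 != ii.2 -> integ P (@c l ii) by move=> /(mean_cross K)[].
have isum l : integ P (fun w => p%:R^-2 * \sum_(ii | ii.1 != ii.2) @c l ii w).
  by apply: integZ; apply: integ_sum => ii; exact: ic.
apply: (@le_trans _ _ (Ex P lower)); last first.
  apply: Ex_le => //; first by apply: integZ; exact: integ_sum.
  move=> w; rewrite hess_quad ler_wpM2l ?invr_ge0//; apply: ler_sum => l _.
  rewrite ler_wpM2l ?invr_ge0 ?exprn_ge0// /fro2 pair_bigA /=.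
  rewrite [leRHS](bigID (fun ii => ii.1 != ii.2)) /=.
  by rewrite lerDl; apply: sumr_ge0 => ii _; exact: sqr_ge0.
rewrite ExZ ?Ex_sum//; last by apply: integ_sum => l _; exact: isum.
apply: (@le_trans _ _ (L%:R^-1 * \sum_(l < L) hess_const * fro2 K)).
  rewrite sum_ord_const mulKf//.
  by rewrite gt_eqF.
rewrite ler_wpM2l ?invr_ge0//; apply: ler_sum => l _.
have iS : integ P (fun w => \sum_(ii | ii.1 != ii.2) @c l ii w).
  by apply: integ_sum => ii; exact: ic.
rewrite (ExZ _ iS) Ex_sum; last by move=> ii; exact: ic.
apply: (@le_trans _ _ (p%:R^-2 * \sum_(ii : 'I_(nobs l) * 'I_(nobs l) | ii.1 != ii.2)
    clo ^+ 2 * fro2 K)); last first.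
  rewrite ler_wpM2l ?invr_ge0 ?exprn_ge0//; apply: ler_sum => ii ii0.
  by case: (mean_cross K ii0).
have -> : \sum_(ii : 'I_(nobs l) * 'I_(nobs l) | ii.1 != ii.2) clo ^+ 2 * fro2 K =
    ((nobs l)%:R * ((nobs l)%:R - 1)) * (clo ^+ 2 * fro2 K).
  rewrite -(pair_big_dep xpredT (fun i i' : 'I_(nobs l) => i != i')
    (fun _ _ => clo ^+ 2 * fro2 K)) /=.
  transitivity (\sum_(i < nobs l) ((nobs l)%:R - 1) * (clo ^+ 2 * fro2 K)).
    apply: eq_bigr => i _.
    rewrite sumr_const (_ : #|_| = (nobs l).-1); last first.
      rewrite -[in RHS](card_ord (nobs l)) -(cardC1 i).
      by apply: eq_card => i'; rewrite !inE eq_sym.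
    by rewrite -[LHS]mulr_natl -subn1 natrB.
  by rewrite sum_ord_const mulrA.
set n : R := (nobs l)%:R.
rewrite [leRHS](_ : _ = (p%:R^-2 * (n * (n - 1)) * clo ^+ 2) * fro2 K); last by ring.
rewrite ler_wpM2r ?fro2_ge0// /hess_const ler_pdivrMr ?mulr_gt0 ?exprn_gt0//.
rewrite [leRHS](_ : _ = clo ^+ 2 * (n * (n - 1) * (2 * kap ^+ 2) / p%:R ^+ 2)); last first.
  by field; exact: lt0r_neq0.
rewrite ler_peMr ?exprn_ge0 ?(ltW clo0)// ler_pdivlMr ?exprn_gt0// mul1r.
have h := dim_le reg l; have n2 : 2 <= n by rewrite ler_nat (nobs_gt1 reg).
apply: (@le_trans _ _ ((kap * n) ^+ 2)).
  by rewrite lerXn2r ?nnegrE// mulr_ge0// ltW.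
rewrite -subr_ge0 [X in 0 <= X](_ : _ = kap ^+ 2 * n * (n - 2)).
  by rewrite !mulr_ge0 ?exprn_ge0 ?(ltW k0)// subr_ge0.
by ring.
Qed.

(** A deviation at most half of the coercivity constant in Hilbert-Schmidt norm costs at most that
    half, for all K at once. *)
Lemma hess_coercive_of (w : T) (K : 'M[R]_p) :
  \sum_q (hess_coef q w - Ex P (hess_coef q)) ^+ 2 <= (hess_const / 2) ^+ 2 ->
  hess_const / 2 * fro2 K <= mdot K (hess w K).
Proof.
move=> hq; have := Ex_hess_coef_quad K; rewrite hess_coefE.
set A := \sum_q _ * _; set B := (X in _ -> _ <= X) => hA.
have f0 := fro2_ge0 K.
have KK : \sum_q (K q.1.1 q.1.2 * K q.2.1 q.2.2) ^+ 2 = fro2 K ^+ 2.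
  rewrite -(pair_bigA _ (fun ab cd : 'I_p * 'I_p => (K ab.1 ab.2 * K cd.1 cd.2) ^+ 2)) /=.
  rewrite /fro2 [in RHS]pair_bigA /= expr2 mulr_suml; apply: eq_bigr => ab _.
  by rewrite mulr_sumr; apply: eq_bigr => cd _; rewrite exprMn.
have D2 : (B - A) ^+ 2 <= (hess_const / 2 * fro2 K) ^+ 2.
  rewrite /A /B -sumrB.
  under eq_bigr do rewrite -mulrBr.
  rewrite (le_trans (cauchy_schwarz_sum _ _))// KK exprMn mulrC.
  by rewrite ler_wpM2r ?sqr_ge0.
have c0 := hess_const_gt0.
have : `|B - A| <= hess_const / 2 * fro2 K.
  rewrite -(@ler_pXn2r _ 2) ?nnegrE ?real_normK ?num_real//.
  by rewrite mulr_ge0// divr_ge0// ltW.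
rewrite ler_norml => /andP[h _]; move: h hA; nra.
Qed.

Definition row_const := 2^-1 * (M + 3 * (M * chi) ^+ 2).
Definition gram2_const := chi * (2 * kap * row_const + 2 * kap ^+ 2 * chi).

(** Coordinate j is a sum over rows with mean n v_j and variance of order n. Hence the total is of
    order n^2 + p n, that is p^2, whereas the Frobenius norm of the matrix would only give p^3. *)
Lemma mean_zgram_vec l (v : 'cV[R]_p) : nrm2 v <= chi ->
  mean_le P (fun w => nrm2 (zgram l w *m v))
    ((2 * kap * row_const + 2 * kap ^+ 2 * chi) * p%:R ^+ 2).
Proof.
move=> v1; set n := (nobs l)%:R : R.
have M0 : 0 <= M := le_trans ler01 M_ge1.
pose r (j : 'I_p) (k : 'I_(nobs l)) w := Z k j w * lin k v w.
have rE w j : (zgram l w *m v) j 0 = \sum_k r j k w.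
  rewrite mxE; under eq_bigr do rewrite zgramE mulr_suml.
  rewrite exchange_big; apply: eq_bigr => k _; rewrite /r mulr_sumr.
  by apply: eq_bigr => j' _; rewrite mulrA.
have ZE k j w : Z (l := l) k j w = lin k (delta_mx j 0) w.
  rewrite /lin (bigD1 j)//= mxE !eqxx mulr1 big1 ?addr0// => j' j'j.
  by rewrite mxE (negbTE j'j) mulr0.
have rdep j k : dep F (row_set k) (r j k).
  by apply: depM; [exact: (dep_Z_row model)|exact: (dep_lin model)].
have Er j k : integ P (r j k) /\ Ex P (r j k) = v j 0.
  have -> : r j k = (fun w => lin k (delta_mx j 0) w * lin k v w).
    by apply/funext => w; rewrite -ZE.
  have [i ->] := Ex_lin_lin model k (delta_mx j 0) v.
  split=> //; rewrite /dot (bigD1 j)//= mxE !eqxx mul1r big1 ?addr0// => j' j'j.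
  by rewrite mxE (negbTE j'j) mul0r.
have r2 j k : mean_le P (fun w => r j k w ^+ 2) row_const.
  apply: (@mean_le_mono _ _ _ P _ (fun w => 2^-1 * (Z k j w ^+ 4 + lin k v w ^+ 4))
     (2^-1 * (M + 3 * (M * nrm2 v) ^+ 2))).
  - by apply: measurable_funX; exact: (dep_measurable FP (rdep j k)).
  - by move=> w; rewrite sqr_ge0/= /r; exact: sqr_mul_le.
  - apply: mean_leZ; first by rewrite invr_ge0.
    by apply: mean_leD; [exact: (mean_Zpow model)|exact: (mean_lin4 model)].
  - rewrite /row_const ler_wpM2l ?invr_ge0// lerD2l ler_wpM2l// lerXn2r ?nnegrE//.
    + by rewrite mulr_ge0// nrm2_ge0.
    + by rewrite mulr_ge0// ltW.
    + by rewrite ler_wpM2l.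
have cr0 : 0 <= row_const.
  by rewrite mulr_ge0 ?invr_ge0// addr_ge0// mulr_ge0// sqr_ge0.
have cent j : mean_le P (fun w => (\sum_k (r j k w - v j 0)) ^+ 2) (n * row_const).
  have cJ k : dep F (row_set k) (fun w => r j k w - v j 0).
    by apply: depB; [exact: rdep|exact: dep_cst].
  have c0 k : Ex P (fun w => r j k w - v j 0) = 0.
    have [i e] := Er j k; by rewrite (ExB i (integ_cst _ _)) Ex_cst e subrr.
  have c2 k : mean_le P (fun w => (r j k w - v j 0) ^+ 2) row_const.
    have [i e] := Er j k; rewrite -e; exact: mean_le_center.
  have [_ _] := mean_le_sqr_sum FP (@row_set_disjoint _ _ s l) cJ c0
    (index_enum_uniq 'I_(nobs l)) c2.
  by rewrite sum_ord_const.
apply: (@mean_le_mono _ _ _ P _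
  (fun w => \sum_j (2 * (\sum_k (r j k w - v j 0)) ^+ 2 + 2 * n ^+ 2 * v j 0 ^+ 2))
  (\sum_j (2 * (n * row_const) + 2 * n ^+ 2 * v j 0 ^+ 2))).
- apply: measurable_sum => j; apply: measurable_funX.
  under eq_fun do rewrite rE.
  by apply: measurable_sum => k; exact: (dep_measurable FP (rdep j k)).
- move=> w; rewrite nrm2_ge0/=; apply: ler_sum => j _; rewrite rE.
  rewrite sumrB sum_ord_const -/n.
  set a := \sum_k _; set b := n * v j 0.
  have -> : 2 * n ^+ 2 * v j 0 ^+ 2 = 2 * b ^+ 2 by rewrite /b; ring.
  have := sqr_ge0 (a - 2 * b); nra.
- apply: mean_le_sum => j _; apply: mean_leD; first by apply: mean_leZ.
  by apply: mean_le_cst; rewrite mulr_ge0 ?sqr_ge0// mulr_ge0// sqr_ge0.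
- rewrite big_split /= sum_ord_const -mulr_sumr -/(nrm2 v).
  have nk : n <= kap * p%:R := nobs_le reg l.
  have nn : 0 <= n by [].
  have h1 : n ^+ 2 <= (kap * p%:R) ^+ 2 by rewrite lerXn2r ?nnegrE// mulr_ge0 ?(ltW k0).
  rewrite [leRHS](_ : _ = p%:R * (2 * ((kap * p%:R) * row_const)) +
    2 * ((kap * p%:R) ^+ 2 * chi)); last by ring.
  apply: lerD; first by rewrite !ler_wpM2l// ler_wpM2r.
  by rewrite -mulrA ler_wpM2l// ler_pM// ?sqr_ge0 ?nrm2_ge0.
Qed.

Lemma gram2_quad (w : T) (u : 'cV[R]_p) : dot u (gram2 w *m u) =
  L%:R^-1 * \sum_l p%:R^-2 * nrm2 (gram l w *m u).
Proof.
rewrite -mdot_rank1 mdotZr mdot_sumr; congr (_ * _); apply: eq_bigr => l _.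
rewrite mdotZr mdot_rank1 -[X in X *m gram l w]mulmx1 dot_congr ?gramT//.
by rewrite mul1mx dot_nrm2.
Qed.

Lemma mean_gram2_quad (u : 'cV[R]_p) : nrm2 u = 1 ->
  mean_le P (fun w => dot u (gram2 w *m u)) gram2_const.
Proof.
move=> u1; under eq_fun do rewrite gram2_quad.
have -> : gram2_const = L%:R^-1 * \sum_(l < L) gram2_const.
  rewrite sum_ord_const mulKf//.
  by rewrite gt_eqF.
apply: mean_leZ; first by rewrite invr_ge0.
apply: mean_le_sum => l _.
have -> : gram2_const = p%:R^-2 * (chi * ((2 * kap * row_const + 2 * kap ^+ 2 * chi) * p%:R ^+ 2)).
  by rewrite /gram2_const; field; exact: lt0r_neq0.
apply: mean_leZ; first by rewrite invr_ge0 exprn_ge0.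
apply: (@mean_le_mono _ _ _ P _ (fun w => chi * nrm2 (zgram l w *m (Sigma_half l *m u)))
  _ _ _ _ _ (lexx _)).
- apply: measurable_sum => j; apply: measurable_funX.
  under eq_fun do rewrite mxE.
  by apply: measurable_sum => k; apply: measurable_funM => //; exact: measurable_gram.
- move=> w; rewrite nrm2_ge0/= gramE -!mulmxA; exact: (sqrt_hi reg).
- apply: mean_leZ; first exact: ltW.
  apply: mean_zgram_vec; rewrite (le_trans (sqrt_hi reg _ _))// u1 mulr1//.
Qed.

Lemma gram2_lln : (forall q : 'I_p * 'I_p, integ P (fun w => gram2 w q.1 q.2)) /\
  mean_le P (fun w => \sum_(q : 'I_p * 'I_p)
      (gram2 w q.1 q.2 - Ex P (fun w => gram2 w q.1 q.2)) ^+ 2)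
    (gram_const * p%:R ^+ 2 / L%:R).
Proof.
pose f l (q : 'I_p * 'I_p) (w : T) := p%:R^-2 * (gram l w *m gram l w) q.1 q.2.
have E (q : 'I_p * 'I_p) : (fun w => gram2 w q.1 q.2) = (fun w => L%:R^-1 * \sum_l f l q w).
  by apply/funext => w; rewrite mxE summxE; congr (_ * _); apply: eq_bigr => l _; rewrite mxE.
have fJ l q : dep F (Xset l) (f l q).
  apply: depM; first exact: dep_cst.
  under eq_fun do rewrite mxE.
  by apply: dep_sum => k; apply: depM; exact: dep_gram.
have fl l : mean_le P (fun w => \sum_q f l q w ^+ 2) (gram_const * p%:R ^+ 2).
  apply: (@mean_le_mono _ _ _ P _ (fun w => p%:R ^- 4 * fro2 (gram l w) ^+ 2)
    (p%:R ^- 4 * (gram_const * p%:R ^+ 6))).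
  - by apply: measurable_sum => q; apply: measurable_funX; exact: (dep_measurable FP (fJ l q)).
  - move=> w; apply/andP; split; first by apply: sumr_ge0 => q _; exact: sqr_ge0.
    under eq_bigr do rewrite exprMn.
    rewrite -mulr_sumr -exprVn -exprM exprVn ler_wpM2l ?invr_ge0 ?exprn_ge0//.
    rewrite expr2; apply: le_trans (fro2_mulmx _ _).
    by rewrite /fro2 pair_bigA.
  - by apply: mean_leZ; [rewrite invr_ge0 exprn_ge0|exact: mean_gram_fro].
  - apply: ler_of_eq; field; exact: lt0r_neq0.
have [ii ll] := mean_le_lln FP (L_gt0 reg) (Xset_disjoint) fJ fl.
split=> [q|]; first by rewrite E.
move: ll; congr mean_le; apply/funext => w; apply: eq_bigr => q _.
by rewrite E (congr1 (fun f => f w) (E q)).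
Qed.

(** For fixed u the mean is bounded by a constant; measuring the deviation in Frobenius norm makes
    the bound uniform over unit vectors. *)
Lemma gram2_le_of (w : T) (b : R) (u : 'cV[R]_p) : 0 <= b -> nrm2 u = 1 ->
  \sum_(q : 'I_p * 'I_p)
      (gram2 w q.1 q.2 - Ex P (fun w => gram2 w q.1 q.2)) ^+ 2 <= b ^+ 2 ->
  dot u (gram2 w *m u) <= gram2_const + b.
Proof.
move=> b0 u1 hq; have [gi _] := gram2_lln.
have E w' : dot u (gram2 w' *m u) =
    \sum_(q : 'I_p * 'I_p) (u q.1 0 * u q.2 0) * gram2 w' q.1 q.2.
  rewrite -(pair_bigA _ (fun i j => (u i 0 * u j 0) * gram2 w' i j)).
  apply: eq_bigr => i _; rewrite mxE mulr_sumr; apply: eq_bigr => j _ /=; ring.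
have [_ _] := mean_gram2_quad u1.
under eq_fun do rewrite E.
rewrite Ex_sum => [|q _]; last exact: integZ.
under eq_bigr do rewrite ExZ//.
rewrite E; set A := \sum_q _; set B := \sum_q _ => hA.
suff : B - A <= b by lra.
rewrite (le_trans (ler_norm _))// -(@ler_pXn2r _ 2) ?nnegrE// real_normK ?num_real//.
apply: le_trans hq; rewrite /A /B -sumrB.
under eq_bigr do rewrite -mulrBr.
rewrite (le_trans (cauchy_schwarz_sum _ _))//.
by rewrite -nrm2_sqr u1 expr1n mul1r.
Qed.

End gram_moments.

(** * The score *)

Section sub_gaussian_moments.
Context {R : realType} {d : measure_display} {T : measurableType d}.
Variable P : probability T R.

Lemma pow4_le_expR (y : R) : y ^+ 4 <= 24 * (expR y + expR (- y)).
Proof.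
have h (x : R) : 0 <= x -> x ^+ 4 <= 24 * expR x.
  move=> x0; have := expR_ge1Dxn 3 x0.
  rewrite (_ : (4`!)%:R = 24 :> R) // => h; nra.
have e1 := expR_ge0 y; have e2 := expR_ge0 (- y).
have [y0|y0] := leP 0 y; first by rewrite (le_trans (h _ y0))// ler_wpM2l// lerDl.
have y1 : 0 <= - y by lra.
have := h _ y1; rewrite exprNn -signr_odd /= expr0 mul1r => /le_trans; apply.
by rewrite ler_wpM2l// lerDr.
Qed.

(** From y^4 <= 24 (e^y + e^(-y)), with the sub-Gaussian bound used at lambda = 1 and lambda =
    -1. *)
Definition subg_const (tau : R) := 48 * expR (tau ^+ 2 / 2).

Lemma subg_const_ge0 tau : 0 <= subg_const tau.
Proof. by rewrite mulr_ge0// expR_ge0. Qed.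

Variables (n : nat) (x : T -> 'cV[R]_n) (tau : R).
Hypothesis mx : forall i, measurable_fun setT (fun w => x w i 0).
Hypothesis x0 : mean_vec P x = 0.
Hypothesis xsub : sub_gaussian P x tau.

Lemma measurable_dot v : measurable_fun setT (fun w => dot v (x w)).
Proof. by apply: measurable_sum => i; apply: measurable_funM => //; exact: mx. Qed.

Lemma sub_gaussian_pow4 v :
  mean_le P (fun w => dot v (x w) ^+ 4) (subg_const tau * nrm2 v ^+ 2).
Proof.
have [v0|v0] := eqVneq (nrm2 v) 0.
  rewrite (_ : (fun w => _) = fun=> 0).
    by apply: mean_le_zero; rewrite mulr_ge0 ?sqr_ge0 ?subg_const_ge0.
  apply/funext => w; rewrite (nrm2_eq0 v0) /dot big1 ?expr0n// => i _.
  by rewrite mxE mul0r.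
have vp : 0 < nrm2 v by rewrite lt_def v0 nrm2_ge0.
pose a := Num.sqrt (nrm2 v); pose u := a^-1 *: v.
have a0 : 0 < a by rewrite sqrtr_gt0.
have aa : a ^+ 2 = nrm2 v by rewrite sqr_sqrtr// ltW.
have u1 : l2norm u = 1.
  by rewrite /l2norm -/(nrm2 u) nrm2Z exprVn aa mulVf// sqrtr1.
have mu := measurable_dot u.
have e (t : R) : t ^+ 2 = 1 ->
    mean_le P (fun w => expR (t * dot u (x w))) (expR (tau ^+ 2 / 2)).
  move=> t1; apply: mean_leP.
  - by apply: measurableT_comp => //; exact: measurable_funM.
  - by move=> w; exact: expR_ge0.
  - have := xsub u1 t; rewrite unlock x0 t1 mul1r.
    by under eq_integral do rewrite subr0 -dotE.
have e1 := e 1 (expr1n _ _).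
have /e e2 : (-1) ^+ 2 = 1 :> R by rewrite sqrrN expr1n.
apply: (@mean_le_mono _ _ _ P _
  (fun w => a ^+ 4 * (24 * (expR (1 * dot u (x w)) + expR (-1 * dot u (x w)))))
  (a ^+ 4 * (24 * (expR (tau ^+ 2 / 2) + expR (tau ^+ 2 / 2))))).
- by apply: measurable_funX; exact: measurable_dot.
- move=> w; rewrite exprn_even_ge0//= mul1r mulN1r.
  have -> : dot v (x w) = a * dot u (x w).
    by rewrite /u dotZl mulrA mulfV ?mul1r// gt_eqF.
  by rewrite exprMn ler_wpM2l ?exprn_even_ge0// pow4_le_expR.
- apply: mean_leZ; first by rewrite exprn_even_ge0.
  by apply: mean_leZ => //; exact: mean_leD.
- by rewrite (exprM a 2 2) aa /subg_const; apply: ler_of_eq; ring.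
Qed.

End sub_gaussian_moments.

Section linear_image.
Context {R : realType} {d : measure_display} {T : measurableType d}.
Variable P : probability T R.
Variables (n : nat) (x : T -> 'cV[R]_n) (K : R).
Hypothesis mx : forall i, measurable_fun setT (fun w => x w i 0).
Hypothesis x4 : forall v, mean_le P (fun w => dot v (x w) ^+ 4) (K * nrm2 v ^+ 2).

Lemma weighted_sqr_sum_le (I : finType) (a t : I -> R) : (forall i, 0 <= a i) ->
  (forall i, a i = 0 -> t i = 0) ->
  (\sum_i t i) ^+ 2 <= (\sum_i a i) * \sum_i (a i)^-1 * t i ^+ 2.
Proof.
move=> a0 at0.
have := cauchy_schwarz_sum (fun i => Num.sqrt (a i)) (fun i => (Num.sqrt (a i))^-1 * t i).
rewrite (eq_bigr t) => [|i _].
  rewrite [X in _ <= X * _](eq_bigr a) => [|i _]; last by rewrite sqr_sqrtr.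
  rewrite [X in _ <= _ * X](eq_bigr (fun i => (a i)^-1 * t i ^+ 2)) => [//|i _].
  by rewrite exprMn exprVn sqr_sqrtr.
have [ai|ai] := eqVneq (a i) 0; first by rewrite (at0 _ ai) !mulr0.
by rewrite mulrA mulfV ?mul1r// sqrtr_eq0 -ltNge lt_def ai a0.
Qed.

(** Cauchy-Schwarz over the rows r_i with weights |r_i|^2 bounds |A x|^4 by fourth powers of linear
    forms. Null rows agree with the convention that the inverse of 0 is 0. *)
Lemma mean_nrm2_mulmx m (A : 'M[R]_(m, n)) :
  mean_le P (fun w => nrm2 (A *m x w) ^+ 2) (K * fro2 A ^+ 2).
Proof.
pose r i : 'cV[R]_n := (row i A)^T.
have AE i w : (A *m x w) i 0 = dot (r i) (x w).
  by rewrite mxE; apply: eq_bigr => j _; rewrite !mxE.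
have rA : fro2 A = \sum_i nrm2 (r i).
  by apply: eq_bigr => i _; apply: eq_bigr => j _; rewrite !mxE.
apply: (@mean_le_mono _ _ _ P _
  (fun w => (\sum_i nrm2 (r i)) * \sum_i (nrm2 (r i))^-1 * dot (r i) (x w) ^+ 4)
  ((\sum_i nrm2 (r i)) * \sum_i (nrm2 (r i))^-1 * (K * nrm2 (r i) ^+ 2))).
- apply: measurable_funX; apply: measurable_sum => i; apply: measurable_funX.
  under eq_fun do rewrite AE.
  exact: measurable_dot.
- move=> w; rewrite sqr_ge0/=.
  have -> : nrm2 (A *m x w) = \sum_i dot (r i) (x w) ^+ 2.
    by apply: eq_bigr => i _; rewrite AE.
  apply: (le_trans (@weighted_sqr_sum_le _ (fun i => nrm2 (r i)) _ _ _)).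
  + by move=> i; exact: nrm2_ge0.
  + move=> i /nrm2_eq0 ->; rewrite /dot big1 ?expr0n// => j _.
    by rewrite mxE mul0r.
  + rewrite ler_wpM2l//; first by apply: sumr_ge0 => i _; exact: nrm2_ge0.
    by apply: ler_sum => i _; rewrite -exprM.
- apply: mean_leZ; first by apply: sumr_ge0 => i _; exact: nrm2_ge0.
  by apply: mean_le_sum => i _; apply: mean_leZ => //; rewrite invr_ge0 nrm2_ge0.
- rewrite rA; apply: ler_of_eq.
  rewrite [in RHS]expr2 mulrCA; congr (_ * _); rewrite mulr_sumr.
  apply: eq_bigr => i _; have [->|n0] := eqVneq (nrm2 (r i)) 0; last by field.
  by rewrite expr0n !mulr0.
Qed.

End linear_image.

Lemma mean_nrm2_mulmx_indep (R : realType) d (T : measurableType d) (P : probability T R)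
    (K : finType) (F : K -> set (set T)) (FP : independent_sigma P F) (J J' : {set K})
    m n (A : T -> 'M[R]_(m, n)) (x : T -> 'cV[R]_n) (k c : R) :
  [disjoint J & J']%B -> (forall i j, dep F J (fun w => A w i j)) ->
  (forall i, dep F J' (fun w => x w i 0)) -> 0 <= k ->
  (forall v, mean_le P (fun w => dot v (x w) ^+ 4) (k * nrm2 v ^+ 2)) ->
  mean_le P (fun w => fro2 (A w) ^+ 2) c ->
  mean_le P (fun w => nrm2 (A w *m x w) ^+ 2) (k * c).
Proof.
move=> dJ AJ xJ k0 x4 Ac; pose f (z : T * T) := nrm2 (A z.1 *m x z.2) ^+ 2.
have mf : measurable_fun [set: gen F J * gen F J'] f.
  apply: measurable_funX; apply: measurable_sum => i; apply: measurable_funX.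
  under eq_fun do rewrite mxE.
  apply: measurable_sum => j; apply: measurable_funM.
    exact: (measurableT_comp (@AJ i j)).
  exact: (measurableT_comp (@xJ j)).
apply: (mean_le_decoupling FP dJ mf (fun z => sqr_ge0 _) _ (mean_leZ k0 Ac)) => w.
rewrite /f /=; apply: mean_nrm2_mulmx => // i; exact: (dep_measurable FP (@xJ i)).
Qed.

Section score_moments.
Context {R : realType} {d : measure_display}.
Variables (s : multi_study R d) (sigma M12 kap clo chi C1 taub taue : R).
Hypothesis model : model_assumptions s sigma M12.
Hypothesis reg : regular_design s kap clo chi.
Hypothesis Omega_hi : forall v, nrm2 (Omega s *m v) <= C1 ^+ 2 * nrm2 v.
Local Notation p := (dim s).
Local Notation L := (nL s).
Local Notation T := (space s).
Local Notation P := (Pr s).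
Local Notation F := (@source_system _ _ s).
Local Notation cg := (gram_const M12 kap chi).
Hypothesis beta_sub : forall l : 'I_L,
  sub_gaussian P (fun w => Num.sqrt p%:R *: beta l w) taub.
Hypothesis noise_sub : forall l : 'I_L, sub_gaussian P (noise l) taue.
Implicit Types l : 'I_L.

Let FP : independent_sigma P F := sources_independent_sigma model.
Let p1 : 1 <= p%:R :> R.
Proof. by rewrite ler1n; exact: dim_gt0 reg. Qed.
Let pp : 0 < p%:R :> R := lt_le_trans ltr01 p1.

Lemma measurable_beta l i : measurable_fun setT (fun w => beta l w i 0).
Proof.
by apply: (measurableT_comp (measurable_coord i 0)); exact: measurable_funP.
Qed.

Lemma measurable_noise l i : measurable_fun setT (fun w => noise l w i 0).
Proof.
by apply: (measurableT_comp (measurable_coord i 0)); exact: measurable_funP.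
Qed.

Lemma beta_prod l i j : integ P (fun w => beta l w i 0 * beta l w j 0) /\
  Ex P (fun w => beta l w i 0 * beta l w j 0) = p%:R^-1 * Omega s i j.
Proof.
have sq k : integ P (fun w => beta l w k 0 ^+ 2).
  have [] // := @mean_leP _ _ _ P (fun w => beta l w k 0 ^+ 2) (p%:R^-1 * Omega s k k).
  - by apply: measurable_funX; exact: measurable_beta.
  - by move=> w; exact: sqr_ge0.
  - have := beta_second_moment model l k k; rewrite unlock.
    by under [X in _ -> (X <= _)%E]eq_integral do rewrite expr2; move=> ->.
split; last by rewrite -expectation_Ex (beta_second_moment model).
by apply: integ_mul => //; exact: measurable_beta.
Qed.

Lemma integ_beta l i : integ P (fun w => beta l w i 0).
Proof.
have := @integ_pow_le _ _ _ P 1 2 (fun w => beta l w i 0) isT isT (@measurable_beta l i).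
apply; under eq_fun do rewrite expr2.
by case: (beta_prod l i i).
Qed.

Lemma Ex_beta l i : Ex P (fun w => beta l w i 0) = 0.
Proof. by rewrite -expectation_Ex (beta_mean model). Qed.

Lemma Ex_noise l i : Ex P (fun w => noise l w i 0) = 0.
Proof. by rewrite -expectation_Ex (noise_mean model). Qed.

Lemma noise_prod l i j : integ P (fun w => noise l w i 0 * noise l w j 0) /\
  Ex P (fun w => noise l w i 0 * noise l w j 0) = sigma ^+ 2 * (i == j)%:R.
Proof.
have cov k k' : (\int[P]_w (noise l w k 0 * noise l w k' 0)%:E =
    (sigma ^+ 2 * (k == k')%:R)%:E)%E.
  have := noise_covariance model k k'; rewrite mxE unlock.
  rewrite !(noise_mean model) unlock mulr_natr => <-.
  by apply: eq_integral => w _; rewrite !fctE /= !subr0.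
have sq k : integ P (fun w => noise l w k 0 ^+ 2).
  have [] // := @mean_leP _ _ _ P (fun w => noise l w k 0 ^+ 2) (sigma ^+ 2 * (k == k)%:R).
  - by apply: measurable_funX; exact: measurable_noise.
  - by move=> w; exact: sqr_ge0.
  - by under eq_integral do rewrite expr2; rewrite cov.
split; last by rewrite /Ex /Rintegral cov.
by apply: integ_mul => //; exact: measurable_noise.
Qed.

Lemma integ_noise l i : integ P (fun w => noise l w i 0).
Proof.
have := @integ_pow_le _ _ _ P 1 2 (fun w => noise l w i 0) isT isT (@measurable_noise l i).
apply; under eq_fun do rewrite expr2.
by case: (noise_prod i i).
Qed.

Lemma beta_pow4 l v :
  mean_le P (fun w => dot v (beta l w) ^+ 4) (subg_const taub / p%:R ^+ 2 * nrm2 v ^+ 2).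
Proof.
pose x w := Num.sqrt p%:R *: beta l w.
have mx i : measurable_fun setT (fun w => x w i 0).
  under eq_fun do rewrite mxE.
  by apply: measurable_funM => //; exact: measurable_beta.
have x0 : mean_vec P x = 0.
  apply/matrixP => i j; rewrite !mxE expectation_Ex.
  under eq_fun do rewrite mxE.
  by rewrite (ExZ _ (@integ_beta l i)) Ex_beta mulr0.
have h := sub_gaussian_pow4 mx x0 (@beta_sub l) v.
have -> : (fun w => dot v (beta l w) ^+ 4) = (fun w => p%:R ^- 2 * dot v (x w) ^+ 4).
  apply/funext => w; rewrite dotZr exprMn (exprM (Num.sqrt _) 2 2) sqr_sqrtr ?(ltW pp)//.
  by rewrite mulrA mulVf ?mul1r// expf_neq0// gt_eqF.
rewrite -mulrA mulrCA; apply: mean_leZ => //.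
Qed.

Lemma noise_pow4 l v :
  mean_le P (fun w => dot v (noise l w) ^+ 4) (subg_const taue * nrm2 v ^+ 2).
Proof.
apply: sub_gaussian_pow4 (@noise_sub l) v; first exact: measurable_noise.
apply/matrixP => i j; rewrite !mxE expectation_Ex; exact: Ex_noise.
Qed.

Definition Jbeta l : {set source s} := [set inl (inr l)]%SET.
Definition Jnoise l : {set source s} := [set inr l]%SET.
Definition Jbn l : {set source s} := (Jbeta l :|: Jnoise l)%SET.

Definition study_of (k : source s) : 'I_L :=
  match k with inl (inl t) => tag t | inl (inr l) => l | inr l => l end.

Lemma dep_coord (J : {set source s}) k n (X : T -> 'cV[R]_n) i : k \in J ->
  source_system k = generated X -> dep F J (fun w => X w i 0).
Proof.
move=> kJ FX; apply: (dep1 FP kJ) => A mA; rewrite FX; apply/generatedE.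
exists ((fun M : 'cV[R]_n => M i 0) @^-1` A) => //.
by rewrite -[X in measurable X]setTI; exact: measurable_coord.
Qed.

Lemma dep_beta (J : {set source s}) l i : inl (inr l) \in J -> dep F J (fun w => beta l w i 0).
Proof. by move=> lJ; exact: dep_coord lJ (erefl _). Qed.

Lemma dep_noise (J : {set source s}) l i : inr l \in J -> dep F J (fun w => noise l w i 0).
Proof. by move=> lJ; exact: dep_coord lJ (erefl _). Qed.

Lemma beta_noise_prod l i k : integ P (fun w => beta l w i 0 * noise l w k 0) /\
  Ex P (fun w => beta l w i 0 * noise l w k 0) = 0.
Proof.
have dJ : [disjoint Jbeta l & Jnoise l]%B.
  by rewrite finset.disjoints_subset; apply/fintype.subsetP => x; rewrite !inE => /eqP ->.
have [? ->] := Ex_mul FP dJ (@dep_beta (Jbeta l) l i (set11 _))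
  (@dep_noise (Jnoise l) l k (set11 _)) (@integ_beta l i) (@integ_noise l k).
by rewrite Ex_beta mul0r.
Qed.

(** Coefficients and noise are stacked into one vector with block-diagonal covariance, so that the
    second moments of S beta + X^T eps come from a single bilinear computation. *)
Definition xi l (q : 'I_p + 'I_(nobs l)) w : R :=
  match q with inl i => beta l w i 0 | inr k => noise l w k 0 end.

Definition xi_cov l (q q' : 'I_p + 'I_(nobs l)) : R :=
  match q, q' with
  | inl i, inl j => p%:R^-1 * Omega s i j
  | inr k, inr k' => sigma ^+ 2 * (k == k')%:R
  | _, _ => 0
  end.

Lemma xi_prod l (q q' : 'I_p + 'I_(nobs l)) :
  integ P (fun w => xi q w * xi q' w) /\
  Ex P (fun w => xi q w * xi q' w) = xi_cov q q'.
Proof.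
case: q q' => [i|k] [j|k'] /=.
- exact: beta_prod.
- exact: beta_noise_prod.
- rewrite (_ : (fun w => noise l w k 0 * _) = (fun w => beta l w j 0 * noise l w k 0)).
    exact: beta_noise_prod.
  by apply/funext => w; rewrite mulrC.
- exact: noise_prod.
Qed.

Definition xi_row l (g : 'M[R]_p) (x : 'M[R]_(nobs l, p)) (a : 'I_p)
  (q : 'I_p + 'I_(nobs l)) : R := match q with inl i => g a i | inr k => x k a end.

Lemma xi_rowE l g x a w : (g *m beta l w + x^T *m noise l w) a 0 =
  \sum_q xi_row g x a q * xi q w.
Proof.
rewrite big_sumType /= !mxE; congr (_ + _).
by apply: eq_bigr => k _; rewrite mxE.
Qed.

Lemma Ex_residual_prod l (g : 'M[R]_p) (x : 'M[R]_(nobs l, p)) a b :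
  let r w := g *m beta l w + x^T *m noise l w in
  integ P (fun w => r w a 0 * r w b 0) /\
  Ex P (fun w => r w a 0 * r w b 0) =
    p%:R^-1 * (g *m Omega s *m g^T) a b + sigma ^+ 2 * (x^T *m x) a b.
Proof.
move=> r.
have E : (fun w => r w a 0 * r w b 0) = (fun w =>
    \sum_q \sum_q' (xi_row g x a q * xi_row g x b q') * (xi q w * xi q' w)).
  apply/funext => w; rewrite /r !xi_rowE big_distrlr; apply: eq_bigr => q _.
  by apply: eq_bigr => q' _ /=; ring.
have ii (q q' : 'I_p + 'I_(nobs l)) :
    integ P (fun w => (xi_row g x a q * xi_row g x b q') * (xi q w * xi q' w)).
  by apply: integZ; case: (xi_prod q q').
rewrite E; split; first by apply: integ_sum => q _; exact: integ_sum.
rewrite Ex_sum => [|q _]; last exact: integ_sum.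
transitivity (\sum_q \sum_q' (xi_row g x a q * xi_row g x b q') * xi_cov q q').
  apply: eq_bigr => q _; rewrite Ex_sum//; apply: eq_bigr => q' _.
  by have [i e] := xi_prod q q'; rewrite ExZ// e.
rewrite big_sumType /=; congr (_ + _).
  transitivity (\sum_i \sum_j p%:R^-1 * (g a i * Omega s i j * g b j)).
    apply: eq_bigr => i _; rewrite big_sumType /= [X in _ + X]big1 ?addr0.
      by apply: eq_bigr => j _; ring.
    by move=> k _; rewrite mulr0.
  rewrite exchange_big mxE mulr_sumr; apply: eq_bigr => j _.
  by rewrite !mxE mulr_suml mulr_sumr.
transitivity (\sum_k sigma ^+ 2 * (x k a * x k b)).
  apply: eq_bigr => k _; rewrite big_sumType /= [X in X + _]big1 ?add0r.
    rewrite (bigD1 k)//= eqxx mulr1 big1 ?addr0 => [|k' kk]; first by ring.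
    by rewrite eq_sym (negbTE kk) !mulr0.
  by move=> i _; rewrite mulr0.
by rewrite -mulr_sumr mxE; congr (_ * _); apply: eq_bigr => k _; rewrite mxE.
Qed.

(** This is X^T y, decomposed according to the model. *)
Definition residual l (w : T) : 'cV[R]_p :=
  gram l w *m beta l w + (Xmx l w)^T *m noise l w.

Definition score_coef l (q : 'I_p * 'I_p) (w : T) : R :=
  p%:R^-1 * (residual l w q.1 0 * residual l w q.2 0 - sigma ^+ 2 * gram l w q.1 q.2)
  - p%:R^-2 * (gram l w *m Omega s *m gram l w) q.1 q.2.

Lemma residualE l w : (Xmx l w)^T *m response l w = residual l w.
Proof. by rewrite /response mulmxDr mulmxA. Qed.

Lemma scoreE w q : score sigma w q.1 q.2 = L%:R^-1 * \sum_l score_coef l q w.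
Proof.
rewrite /score mxE [X in _ + X]mxE /moment_mx /hess.
rewrite mxE [X in _ - X]mxE !summxE -mulrBr -sumrB; congr (_ * _).
apply: eq_bigr => l _; rewrite /score_coef.
rewrite mxE [X in _ - X]mxE; congr (_ * _ - _).
rewrite mulmxBr mulmxBl.
have -> : (Xmx l w)^T *m (response l w *m (response l w)^T) *m Xmx l w =
    residual l w *m (residual l w)^T.
  rewrite -residualE; move: (Xmx l w) (response l w) => x y.
  by rewrite trmx_mul trmxK !mulmxA.
rewrite mxE [X in _ + X]mxE mul_mx_scalar -scalemxAl [X in _ - X]mxE.
by congr (_ - _); rewrite mxE big_ord1 [X in _ * X]mxE.
Qed.

Lemma dep_residual (J : {set source s}) l a : Xset l \subset J ->
  inl (inr l) \in J -> inr l \in J -> dep F J (fun w => residual l w a 0).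
Proof.
move=> XJ bJ nJ; under eq_fun do rewrite !mxE.
apply: depD; apply: dep_sum => i; apply: depM.
- exact: (sub_dep FP XJ (@dep_gram _ _ _ _ _ model l a i)).
- exact: (dep_beta _ bJ).
- under eq_fun do rewrite mxE.
  exact: (sub_dep FP XJ (@dep_X _ _ _ _ _ model l i a)).
- exact: (dep_noise _ nJ).
Qed.

Lemma Xset_disjoint_Jbn l (J : {set source s}) : J \subset Jbn l ->
  [disjoint Xset l & J]%B.
Proof.
move=> JJ; rewrite disjoint_sym finset.disjoints_subset; apply/fintype.subsetP => k.
by move=> /(fintype.subsetP JJ); rewrite !inE => /orP[]/eqP ->.
Qed.

Lemma Xset_study l : Xset l \subset fiber (study_of) l.
Proof. by apply/fintype.subsetP => -[[t|?]|?]; rewrite !inE. Qed.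

Lemma dep_conj (J : {set source s}) l a b : Xset l \subset J ->
  dep F J (fun w => (gram l w *m Omega s *m gram l w) a b).
Proof.
move=> XJ; under eq_fun do rewrite mxE.
apply: dep_sum => k; apply: depM.
  under eq_fun do rewrite mxE.
  apply: dep_sum => j; apply: depM; last exact: dep_cst.
  exact: (sub_dep FP XJ (@dep_gram _ _ _ _ _ model l a j)).
exact: (sub_dep FP XJ (@dep_gram _ _ _ _ _ model l k b)).
Qed.

Lemma dep_score_coef l q : dep F (fiber (study_of) l) (score_coef l q).
Proof.
have XJ := Xset_study l.
apply: depB; apply: depM; first exact: dep_cst.
- apply: depB.
    by apply: depM; apply: dep_residual; rewrite ?inE//.
  apply: depM; first exact: dep_cst.
  exact: (sub_dep FP XJ (@dep_gram _ _ _ _ _ model l q.1 q.2)).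
- exact: dep_cst.
- exact: dep_conj.
Qed.

(** ||X||_F^2 is the trace of S, hence ||X||_F^4 <= p ||S||_F^2 by Cauchy-Schwarz, and p g <= p^4 +
    p^-2 g^2 leads back to the moment of S already known. *)
Lemma mean_design_fro l : mean_le P (fun w => fro2 (Xmx l w) ^+ 2)
  ((1 + cg) * p%:R ^+ 4).
Proof.
have mX i j : measurable_fun setT (fun w => Xmx l w i j).
  exact: (dep_measurable FP (@dep_X _ _ _ _ _ model l i j)).
apply: (@mean_le_mono _ _ _ P _
  (fun w => p%:R ^+ 4 + p%:R ^- 2 * fro2 (gram l w) ^+ 2)
  (p%:R ^+ 4 + p%:R ^- 2 * (cg * p%:R ^+ 6))).
- by apply: measurable_funX; exact: measurable_fro2.
- move=> w; rewrite sqr_ge0/=.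
  have E : fro2 (Xmx l w) = \sum_j 1 * gram l w j j.
    rewrite fro2_col; apply: eq_bigr => j _; rewrite mul1r !mxE.
    by apply: eq_bigr => i _; rewrite !mxE expr2.
  have h : fro2 (Xmx l w) ^+ 2 <= p%:R * fro2 (gram l w).
    rewrite E (le_trans (cauchy_schwarz_sum _ _))//.
    under eq_bigr do rewrite expr1n.
    rewrite sum_ord_const mulr1 ler_wpM2l//; apply: ler_sum => j _.
    by rewrite (bigD1 j)//= lerDl; apply: sumr_ge0 => k _; exact: sqr_ge0.
  apply: (le_trans h).
  set g := fro2 (gram l w); have g0 : 0 <= g := fro2_ge0 _.
  have -> : p%:R ^+ 4 + p%:R ^- 2 * g ^+ 2 =
      (p%:R ^+ 2 - p%:R^-1 * g) ^+ 2 + 2 * (p%:R * g).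
    by field; exact: lt0r_neq0.
  have := sqr_ge0 (p%:R ^+ 2 - p%:R^-1 * g).
  have : 0 <= p%:R * g by rewrite mulr_ge0// ltW.
  lra.
- apply: mean_leD; first by apply: mean_le_cst; rewrite exprn_ge0// ltW.
  apply: mean_leZ; first by rewrite invr_ge0 exprn_ge0// ltW.
  exact: (mean_gram_fro model reg).
- by apply: ler_of_eq; field; exact: lt0r_neq0.
Qed.

Lemma mean_gram_beta l : mean_le P (fun w => nrm2 (gram l w *m beta l w) ^+ 2)
  (subg_const taub * cg * p%:R ^+ 4).
Proof.
rewrite (_ : _ * _ * _ = subg_const taub / p%:R ^+ 2 * (cg * p%:R ^+ 6)); last first.
  by field; exact: lt0r_neq0.
apply: (mean_nrm2_mulmx_indep FP (Xset_disjoint_Jbn (finset.subsetUl (Jbeta l) _))).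
- by move=> i j; exact: (dep_gram model).
- by move=> i; exact: (dep_beta i (set11 _)).
- by rewrite mulr_ge0 ?subg_const_ge0// invr_ge0 exprn_ge0// ltW.
- exact: beta_pow4.
- exact: (mean_gram_fro model reg).
Qed.

Lemma mean_design_noise l : mean_le P (fun w => nrm2 ((Xmx l w)^T *m noise l w) ^+ 2)
  (subg_const taue * ((1 + cg) * p%:R ^+ 4)).
Proof.
apply: (mean_nrm2_mulmx_indep FP (Xset_disjoint_Jbn (finset.subsetUr _ (Jnoise l)))).
- by move=> i j; under eq_fun do rewrite mxE; exact: (dep_X model).
- by move=> i; exact: (dep_noise i (set11 _)).
- exact: subg_const_ge0.
- exact: noise_pow4.
- by under eq_fun do rewrite fro2_tr; exact: mean_design_fro.
Qed.

(** The 3 comes from splitting a summand of the score into its response, noise-correction and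
    Hessian parts, the 8 from |x + y|^4 <= 8 (|x|^4 + |y|^4). *)
Definition score_const := 3 * (8 * (subg_const taub * cg + subg_const taue * (1 + cg))
  + sigma ^+ 4 * (1 + cg) + C1 ^+ 2 * cg).

Lemma mean_score_coef l : mean_le P (fun w => \sum_q score_coef l q w ^+ 2)
  (score_const * p%:R ^+ 2).
Proof.
have mq q : measurable_fun setT (score_coef l q).
  exact: (dep_measurable FP (@dep_score_coef l q)).
pose a w := p%:R ^- 2 * (8 * (nrm2 (gram l w *m beta l w) ^+ 2 +
   nrm2 ((Xmx l w)^T *m noise l w) ^+ 2)).
pose b w := sigma ^+ 4 * p%:R ^- 2 * (p%:R ^+ 4 + p%:R ^- 4 * fro2 (gram l w) ^+ 2).
pose c w := p%:R ^- 4 * (C1 ^+ 2 * fro2 (gram l w) ^+ 2).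
have i0 n : 0 <= (p%:R ^- n : R) by rewrite invr_ge0 exprn_ge0// ltW.
have s4 : 0 <= sigma ^+ 4 * p%:R ^- 2.
  by apply: mulr_ge0 => //; exact: exprn_even_ge0.
apply: (@mean_le_mono _ _ _ P _ (fun w => 3 * (a w + b w + c w))
  (3 * (p%:R ^- 2 * (8 * (subg_const taub * cg * p%:R ^+ 4 +
     subg_const taue * ((1 + cg) * p%:R ^+ 4)))
   + sigma ^+ 4 * p%:R ^- 2 * (p%:R ^+ 4 + p%:R ^- 4 * (cg * p%:R ^+ 6))
   + p%:R ^- 4 * (C1 ^+ 2 * (cg * p%:R ^+ 6))))).
- by apply: measurable_sum => q; apply: measurable_funX; exact: mq.
- move=> w; apply/andP; split; first by apply: sumr_ge0 => q _; exact: sqr_ge0.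
  pose r := residual l w; pose g := gram l w.
  have g0 := fro2_ge0 g.
  apply: (@le_trans _ _ (3 * (p%:R ^- 2 * nrm2 r ^+ 2 +
      sigma ^+ 4 * p%:R ^- 2 * fro2 g + p%:R ^- 4 * fro2 (g *m Omega s *m g)))).
    rewrite nrm2_sqr /fro2 !pair_bigA /= !mulr_sumr -!big_split /= mulr_sumr.
    apply: ler_sum => q _; rewrite /score_coef -/r -/g.
    set x := r q.1 0 * r q.2 0; set y := g q.1 q.2; set z := (_ *m _) q.1 q.2.
    rewrite -[p%:R ^- 2]exprVn -[p%:R ^- 4]exprVn; set v := p%:R^-1.
    have : 0 <= (v * x + sigma ^+ 2 * v * y) ^+ 2 + (v * x + v ^+ 2 * z) ^+ 2 +
      (sigma ^+ 2 * v * y - v ^+ 2 * z) ^+ 2.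
      by rewrite !addr_ge0// sqr_ge0.
    rewrite -subr_ge0 => h; rewrite -subr_ge0; apply: le_trans h _.
    by rewrite subr0; apply: ler_of_eq; ring.
  rewrite ler_wpM2l//; apply: lerD; first apply: lerD.
  + rewrite /a ler_wpM2l//.
    have h := nrm2D_le (g *m beta l w) ((Xmx l w)^T *m noise l w).
    rewrite -/(residual l w) -/r in h.
    set A := nrm2 (_ *m beta l w) in h *; set B := nrm2 (_ *m noise l w) in h *.
    apply: (@le_trans _ _ ((2 * (A + B)) ^+ 2)).
      rewrite lerXn2r ?nnegrE ?nrm2_ge0// mulr_ge0// addr_ge0 ?nrm2_ge0//.
    have := sqr_ge0 (A - B); nra.
  + rewrite /b ler_wpM2l//.
    rewrite -/g; have -> : p%:R ^+ 4 + p%:R ^- 4 * fro2 g ^+ 2 =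
      (p%:R ^+ 2 - p%:R ^- 2 * fro2 g) ^+ 2 + 2 * fro2 g.
      by field; exact: lt0r_neq0.
    have := sqr_ge0 (p%:R ^+ 2 - p%:R ^- 2 * fro2 g); nra.
  + rewrite /c ler_wpM2l// -/g -mulmxA (le_trans (fro2_mulmx _ _))//.
    rewrite expr2 mulrCA ler_wpM2l//.
    exact: (fro2_mulmx_le g Omega_hi).
- have mg := mean_gram_fro model reg l.
  apply: mean_leZ => //; apply: mean_leD; first apply: mean_leD.
  + apply: mean_leZ => //; apply: mean_leZ => //; apply: mean_leD.
      exact: mean_gram_beta.
    exact: mean_design_noise.
  + apply: mean_leZ => //.
    apply: mean_leD; first by apply: mean_le_cst; rewrite exprn_ge0// ltW.
    by apply: mean_leZ.
  + apply: mean_leZ => //; apply: mean_leZ => //; exact: sqr_ge0.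
- rewrite /score_const -subr_ge0.
  rewrite [X in 0 <= X](_ : _ = 3 * (sigma ^+ 4 * cg * (p%:R ^+ 2 - 1))); last first.
    by field; exact: lt0r_neq0.
  apply: mulr_ge0 => //; apply: mulr_ge0; last by rewrite subr_ge0 exprn_ege1.
  by apply: mulr_ge0 => //; exact: exprn_even_ge0.
Qed.

Lemma integ_score_coef l q : integ P (score_coef l q).
Proof.
have mq := dep_measurable FP (@dep_score_coef l q).
by case: (coord_integ mq (mean_score_coef l)).
Qed.

(** Given the design, X^T y has second moment p^-1 S Omega S + sigma^2 S, which is exactly what the
    score subtracts. Integrability, needed for this conditioning, is already known from the
    second-moment bound. *)
Lemma Ex_score_coef l q : Ex P (score_coef l q) = 0.
Proof.
have dJ := Xset_disjoint_Jbn (subxx (Jbn l)).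
pose r (z : T * T) : 'cV[R]_p := gram l z.1 *m beta l z.2 + (Xmx l z.1)^T *m noise l z.2.
pose f (z : T * T) :=
  p%:R^-1 * (r z q.1 0 * r z q.2 0 - sigma ^+ 2 * gram l z.1 q.1 q.2)
  - p%:R^-2 * (gram l z.1 *m Omega s *m gram l z.1) q.1 q.2.
have mr a : measurable_fun [set: gen F (Xset l) * gen F (Jbn l)] (fun z => r z a 0).
  under eq_fun do rewrite !mxE.
  apply: measurable_funD; apply: measurable_sum => i; apply: measurable_funM.
  - exact: (measurableT_comp (@dep_gram _ _ _ _ _ model l a i)).
  - apply: (measurableT_comp (dep_beta i _)) => //.
    by rewrite !inE eqxx.
  - under eq_fun do rewrite mxE.
    exact: (measurableT_comp (@dep_X _ _ _ _ _ model l i a)).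
  - apply: (measurableT_comp (dep_noise i _)) => //.
    by rewrite !inE eqxx.
have mf : measurable_fun [set: gen F (Xset l) * gen F (Jbn l)] f.
  apply: measurable_funB; apply: measurable_funM => //.
    apply: measurable_funB; first exact: measurable_funM.
    apply: measurable_funM => //.
    exact: (measurableT_comp (@dep_gram _ _ _ _ _ model l q.1 q.2)).
  exact: (measurableT_comp (dep_conj q.1 q.2 (subxx (Xset l)))).
have fi : integ P (fun w => f (w, w)).
  exact: integ_score_coef.
have slice w : integ P (fun w' => f (w, w')) /\ Ex P (fun w' => f (w, w')) = 0.
  have [ir er] := Ex_residual_prod (gram l w) (Xmx l w) q.1 q.2.
  pose c := p%:R^-1 * (sigma ^+ 2 * gram l w q.1 q.2) +
    p%:R^-2 * (gram l w *m Omega s *m gram l w) q.1 q.2.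
  have E : (fun w' => f (w, w')) = (fun w' => p%:R^-1 * (r (w, w') q.1 0 * r (w, w') q.2 0) - c).
    by apply/funext => w'; rewrite /f /c; ring.
  rewrite E; split; first by apply: integB; [exact: integZ|exact: integ_cst].
  rewrite (ExB (integZ _ ir) (integ_cst _ _)) Ex_cst (ExZ _ ir) er gramT /c.
  rewrite -/(gram l w) -exprVn; ring.
have [_] := Ex_decoupling FP dJ mf fi (fun w => (slice w).1).
rewrite /Ex => E; rewrite -[RHS](Ex_cst P 0) /Ex [LHS]E.
by congr Ex; apply/funext => w; case: (slice w).
Qed.

Lemma mean_score : mean_le P (fun w => fro2 (score sigma w)) (score_const * p%:R ^+ 2 / L%:R).
Proof.
have dJ l l' : l != l' ->
    [disjoint fiber (study_of) l & fiber (study_of) l']%B.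
  exact: fiber_disjoint.
have [ii ll] := mean_le_lln FP (L_gt0 reg) dJ dep_score_coef mean_score_coef.
move: ll; congr mean_le; apply/funext => w.
rewrite /fro2 pair_bigA /=; apply: eq_bigr => q _; rewrite scoreE.
rewrite [X in _ - X](_ : _ = 0) ?subr0//.
have si l : integ P (score_coef l q) := integ_score_coef l q.
rewrite ExZ; last exact: integ_sum.
by rewrite Ex_sum// big1 ?mulr0// => l _; exact: Ex_score_coef.
Qed.

End score_moments.

(** * Lower bound on the average Gram matrix *)

Section clipping.
Context {R : realType}.
Variable a : R.
Hypothesis a0 : 0 < a.

(** A substitute for t^2 / (2 a) that is bounded and 1-Lipschitz, as contraction demands. *)
Definition clip (t : R) : R := Num.min `|t| a ^+ 2 / (2 * a).

Lemma measurable_clip : measurable_fun setT clip.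
Proof.
apply: measurable_funM => //; apply: measurable_funX; apply: measurable_minr => //.
Qed.

Lemma clip_lipschitz x y : `|clip x - clip y| <= `|x - y|.
Proof.
rewrite /clip -mulrBl normrM (gtr0_norm (_ : 0 < (2 * a)^-1)); last first.
  by rewrite invr_gt0 mulr_gt0.
rewrite ler_pdivrMr ?mulr_gt0// subr_sqr normrM.
have b0 (t : R) : 0 <= Num.min `|t| a <= a.
  by rewrite le_min normr_ge0 (ltW a0) ge_min lexx orbT.
have /andP[x0 xa] := b0 x; have /andP[y0 ya] := b0 y.
apply: ler_pM => //; last by rewrite ger0_norm ?addr_ge0// mulr2n mulrDl mul1r lerD.
have h : `| `|x| - `|y| | <= `|x - y| by exact: ler_dist_dist.
apply: le_trans h; rewrite /Num.min; case: ltP => [xa'|ax]; case: ltP => [ya'|ay] //.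
- rewrite ler_norml in |- *; move: (ler_norm (`|y| - `|x|)).
  rewrite distrC => h; apply/andP; split; lra.
- rewrite ler_norml in |- *; move: (ler_norm (`|x| - `|y|)) => h.
  apply/andP; split; lra.
- by rewrite subrr normr0.
Qed.

Lemma clipM t : 2 * a * clip t = Num.min `|t| a ^+ 2.
Proof. by rewrite /clip; field; exact: lt0r_neq0. Qed.

Lemma clip_le t : 2 * a * clip t <= t ^+ 2.
Proof.
rewrite clipM.
rewrite -[leRHS]real_normK ?num_real// lerXn2r ?nnegrE//.
  by rewrite le_min normr_ge0 ltW.
by rewrite ge_min lexx.
Qed.

(** Beyond the threshold the difference is the square of t^2 / (2 a) - a. The loss due to clipping
    is thus paid by a fourth moment, without any tail estimate. *)
Lemma clip_ge t : t ^+ 2 - t ^+ 4 / (4 * a ^+ 2) <= 2 * a * clip t.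
Proof.
rewrite clipM.
rewrite /Num.min; case: ltP => ta.
  rewrite real_normK ?num_real// lerBlDr lerDl; apply: divr_ge0.
    exact: exprn_even_ge0.
  by apply: mulr_ge0 => //; exact: sqr_ge0.
rewrite -subr_ge0 (_ : _ - _ = (t ^+ 2 / (2 * a) - a) ^+ 2) ?sqr_ge0//.
by field; exact: lt0r_neq0.
Qed.

End clipping.

Section grid.
Context {R : realType}.
Variables (p m : nat).
Hypothesis m0 : (0 < m)%N.

Definition grid := {ffun 'I_p -> 'I_(2 * m).+1}.

Definition grid_vec (g : grid) : 'cV[R]_p := \col_j ((g j)%:R / m%:R - 1).

(** Grid points of squared norm above 4 are sent to 0 instead of being removed: the index type stays
    a plain function type while all vectors lie in the ball of radius 2. *)
Definition grid_ball (g : grid) : 'cV[R]_p :=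
  if nrm2 (grid_vec g) <= 4 then grid_vec g else 0.

Definition grid0 : grid := [ffun=> inord m].

Lemma grid_ball0 : grid_ball grid0 = 0.
Proof.
have E : grid_vec grid0 = 0.
  apply/matrixP => i j; rewrite !mxE ffunE inordK; last by rewrite ltnS leq_pmull.
  by rewrite mulfV ?subrr// pnatr_eq0 -lt0n.
by rewrite /grid_ball E; case: ifP.
Qed.

Lemma grid_ball_le g : nrm2 (grid_ball g) <= 4.
Proof.
rewrite /grid_ball; case: ifPn => // _.
by rewrite /nrm2 big1 // => i _; rewrite mxE expr0n.
Qed.

(** Rounding each coordinate down moves it by at most 1 / m. The rounded vector then has squared
    norm at most 5 / 2, so it is not truncated, and at least 1 / 4 since 1 <= 2 (|u - g|^2 +
    |g|^2). *)
Lemma grid_approx (u : 'cV[R]_p) : nrm2 u = 1 -> p%:R / m%:R ^+ 2 <= (4^-1 : R) ->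
  exists g, [/\ nrm2 (grid_ball g - u) <= p%:R / m%:R ^+ 2 & 4^-1 <= nrm2 (grid_ball g)].
Proof.
move=> u1 pm.
have mR : 0 < m%:R :> R by rewrite ltr0n.
have uj j : -1 <= u j 0 <= 1.
  rewrite -ler_norml -(@ler_pXn2r _ 2) ?nnegrE// real_normK ?num_real// expr1n -u1.
  by rewrite /nrm2 (bigD1 j)//= lerDl; apply: sumr_ge0 => k _; exact: sqr_ge0.
pose g : grid := [ffun j => inord (Num.truncn ((u j 0 + 1) * m%:R))].
have gj j : (grid_vec g j 0 - u j 0) ^+ 2 <= (m%:R^-1) ^+ 2.
  have /andP[ul uh] := uj j.
  have x0 : 0 <= (u j 0 + 1) * m%:R by rewrite mulr_ge0 ?ler0n//; lra.
  have /andP[t1 t2] := truncn_itv x0.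
  rewrite mxE ffunE inordK; last first.
    rewrite ltnS -(@ler_nat R) (le_trans t1)// natrM ler_wpM2r//; lra.
  set k := Num.truncn _ in t1 t2 *.
  have e1 : k%:R / m%:R - 1 - u j 0 <= 0.
    by rewrite subr_le0 lerBlDr ler_pdivrMr.
  have e2 : - (m%:R^-1) <= k%:R / m%:R - 1 - u j 0.
    rewrite -subr_ge0 opprK.
    rewrite (_ : _ + _ = ((k.+1)%:R - (u j 0 + 1) * m%:R) / m%:R).
      by rewrite divr_ge0 ?subr_ge0 ?(ltW t2)// ltW.
    by rewrite -natr1; field; exact: lt0r_neq0.
  rewrite -sqrrN lerXn2r ?nnegrE ?oppr_ge0 ?invr_ge0 ?(ltW mR)//.
  by rewrite lerNl.
have gd : nrm2 (grid_vec g - u) <= p%:R / m%:R ^+ 2.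
  apply: (@le_trans _ _ (\sum_(j < p) (m%:R^-1) ^+ 2)).
    apply: ler_sum => j _; apply: le_trans (gj j).
    by apply: ler_of_eq; rewrite 3!mxE.
  by rewrite sum_ord_const exprVn.
have g4 : nrm2 (grid_vec g) <= 4.
  have := nrm2D_le (grid_vec g - u) u; rewrite subrK u1; lra.
exists g; rewrite /grid_ball g4; split=> //.
have := nrm2D_le (u - grid_vec g) (grid_vec g); rewrite subrK u1.
rewrite -nrm2N opprB; lra.
Qed.

End grid.

Section gram_lower_bound.
Context {R : realType} {d : measure_display}.
Variables (s : multi_study R d) (sigma M12 kap clo chi : R).
Hypothesis model : model_assumptions s sigma M12.
Hypothesis reg : regular_design s kap clo chi.
Local Notation p := (dim s).
Local Notation L := (nL s).
Local Notation T := (space s).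
Local Notation P := (Pr s).
Local Notation F := (@source_system _ _ s).
Local Notation M := (1 + M12).
Implicit Types l : 'I_L.

Let FP : independent_sigma P F := sources_independent_sigma model.
Let clo0 := clo_gt0 reg.
Let chi0 := chi_gt0 reg.
Let pp : 0 < p%:R :> R.
Proof. by rewrite ltr0n; exact: dim_gt0 reg. Qed.
Let LL : 0 < L%:R :> R.
Proof. by rewrite ltr0n; exact: L_gt0 reg. Qed.
Let k0 : 0 < kap := lt_le_trans ltr01 (kap_ge1 reg).
Let M0 : 0 < M := lt_le_trans ltr01 (M_ge1 model reg).

Definition lin4_const : R := 3 * (M * (4 * chi)) ^+ 2.
(** Chosen so that the loss lin4_const / (4 a^2) equals clo / 8, half of the smallest second moment
    clo / 4. *)
Definition clip_at : R := Num.sqrt (2 * lin4_const / clo).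
(** Half of the resulting lower bound for the mean of the clipped variable; the other half is left
    for the deviation. *)
Definition clip_mean : R := clo / 16 / (2 * clip_at).

Let c40 : 0 < lin4_const.
Proof. by rewrite mulr_gt0// exprn_gt0// !mulr_gt0. Qed.
Let a0 : 0 < clip_at.
Proof. by rewrite sqrtr_gt0 divr_gt0// mulr_gt0. Qed.
Let a2 : clip_at ^+ 2 = 2 * lin4_const / clo.
Proof. by rewrite sqr_sqrtr// divr_ge0 ?(ltW clo0)// mulr_ge0// ltW. Qed.

Lemma clip_mean_gt0 : 0 < clip_mean.
Proof. by rewrite !divr_gt0// mulr_gt0. Qed.

Lemma Ex_clip_lin l (i : 'I_(nobs l)) v : clo / 4 <= nrm2 v -> nrm2 v <= 4 * chi ->
  2 * clip_mean <= Ex P (fun w => clip clip_at (lin i v w)).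
Proof.
move=> v1 v2; have [i2 e2] := mean_lin2 model i v.
have [_ i4 e4] := mean_lin4 model i v.
have ml := @measurable_lin _ _ _ _ _ model l i v.
have ic : integ P (fun w => clip clip_at (lin i v w)).
  apply: (integ_phi (measurable_clip clip_at) (clip_lipschitz a0)).
  by case: (Ex_lin model i v).
have : Ex P (fun w => lin i v w ^+ 2 - lin i v w ^+ 4 * (4 * clip_at ^+ 2)^-1) <=
    Ex P (fun w => 2 * clip_at * clip clip_at (lin i v w)).
  apply: Ex_le; [by apply: integB => //; exact: integZr|exact: integZ|].
  by move=> w; exact: clip_ge.
rewrite (ExB i2 (integZr _ i4)) (ExZr _ i4) e2 (ExZ _ ic) => h.
have a20 : 0 < 2 * clip_at by rewrite mulr_gt0.
rewrite /clip_mean mulrA ler_pdivrMr// mulrC [leRHS]mulrC; apply: le_trans h.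
have e4' : Ex P (fun w => lin i v w ^+ 4) <= lin4_const.
  apply: (le_trans e4); rewrite ler_wpM2l// lerXn2r ?nnegrE ?mulr_ge0 ?(ltW M0) ?nrm2_ge0//.
    by rewrite (ltW chi0).
  by rewrite ler_wpM2l// ltW.
have : Ex P (fun w => lin i v w ^+ 4) / (4 * clip_at ^+ 2) <= clo / 8.
  rewrite a2 ler_pdivrMr; last by rewrite mulr_gt0// divr_gt0// mulr_gt0.
  by rewrite (_ : clo / 8 * _ = lin4_const)//; field; exact: lt0r_neq0.
lra.
Qed.

Lemma mean_X2 l (i : 'I_(nobs l)) j : mean_le P (fun w => Xmx l w i j ^+ 2) chi.
Proof.
have [ii e] := mean_lin2 model i (col j (Sigma_half l)).
under eq_fun do rewrite XmxE.
split=> //; first by move=> w; exact: sqr_ge0.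
rewrite e colE (le_trans (sqrt_hi reg _ _))//.
rewrite -[leRHS]mulr1 ler_wpM2l ?(ltW chi0)// /nrm2 (bigD1 j)//= big1.
  by rewrite addr0 mxE !eqxx expr1n.
by move=> k kj; rewrite mxE (negbTE kj) expr0n.
Qed.

Definition row_idx : finType := {l : 'I_L & 'I_(nobs l)}.
Definition nrows : R := #|row_idx|%:R.

Let row_fiber (q : row_idx) : {set source s} := fiber (@row_of _ _ s) (Some (q : design_row s)).

Let row_fiber_disjoint (q q' : row_idx) : q != q' ->
  [disjoint row_fiber q & row_fiber q']%B.
Proof. by move=> qq; apply: fiber_disjoint. Qed.

Lemma row_sum (f : forall l : 'I_L, 'I_(nobs l) -> R) :
  \sum_(q : row_idx) f (tag q) (tagged q) = \sum_l \sum_i f l i.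
Proof.
by rewrite (sig_big_dep (J := fun l : 'I_L => 'I_(nobs l) : finType) xpredT
  (fun _ => xpredT) f).
Qed.

Lemma nrowsE : nrows = \sum_(l < L) (nobs l)%:R.
Proof.
rewrite /nrows -sum1_card natr_sum (row_sum (fun _ _ => 1)).
by apply: eq_bigr => l _; rewrite sumr_const card_ord.
Qed.

Lemma nrows_ge : L%:R * p%:R <= kap * nrows.
Proof.
rewrite nrowsE mulr_sumr -[L in L%:R * _]card_ord -sum1_card natr_sum mulr_suml.
by apply: ler_sum => l _; rewrite mul1r; exact: dim_le reg l.
Qed.

Lemma nrows_gt0 : 0 < nrows.
Proof.
rewrite -(pmulr_rgt0 _ k0); apply: lt_le_trans nrows_ge.
by rewrite mulr_gt0.
Qed.

Section with_grid.
Variable m : nat.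
Hypothesis m0 : (0 < m)%N.
Local Notation G := (grid p m).

Let ell (q : row_idx) (g : G) (w : T) : R :=
  lin (tagged q) (Sigma_half (tag q) *m grid_ball (R := R) g) w.
Let phi := clip clip_at.
Let cen (q : row_idx) g := Ex P (fun w => phi (ell q g w)).

(** One-sided, since only a lower bound on the sums is wanted. It is nonnegative because the base
    point of the grid is the zero vector. *)
Definition clip_dev (w : T) : R :=
  maxf (grid0 p m) (fun g => \sum_(q : row_idx) (cen q g - phi (ell q g w))).

Let dep_ell q g : dep F (row_fiber q) (ell q g).
Proof. exact: (dep_lin model). Qed.

Let integ_ell q g : integ P (ell q g).
Proof. by case: (Ex_lin model (tagged q) (Sigma_half (tag q) *m grid_ball g)). Qed.

Lemma clip_dev_ge0 w : 0 <= clip_dev w.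
Proof.
apply: le_trans (maxf_ge _ _ (grid0 p m)).
rewrite big1// => q _.
have E w' : ell q (grid0 p m) w' = 0.
  by rewrite /ell grid_ball0// mulmx0 /lin big1// => j _; rewrite mxE mulr0.
rewrite /cen; under eq_fun do rewrite E.
by rewrite Ex_cst E subrr.
Qed.

Lemma measurable_clip_dev : measurable_fun setT clip_dev.
Proof.
apply: measurable_maxf => g; apply: measurable_sum => q; apply: measurable_funB => //.
apply: (measurableT_comp (measurable_clip _)).
exact: (dep_measurable FP (@dep_ell q g)).
Qed.

(** After contraction the process is 2 <y, g>, with |g|^2 <= 4 and a mean of |y|^2 at most p N chi,
    where N is the number of rows. Young's inequality with weight N t, and L p <= kap N, give a
    bound that does not involve the size of the grid. *)
Lemma mean_clip_dev t : 0 < t ->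
  mean_le P clip_dev (nrows * (kap * chi / (L%:R * t) + 4 * t)).
Proof.
move=> t0; have N0 := nrows_gt0.
have ipsi q g : integ P (fun w => cen q g - phi (ell q g w)).
  apply: integB; first exact: integ_cst.
  exact: (integ_phi (measurable_clip clip_at) (clip_lipschitz a0)).
have [] := @contraction _ _ _ P _ F FP G (grid0 p m) phi (measurable_clip clip_at)
  (clip_lipschitz a0) _ row_fiber ell row_fiber_disjoint dep_ell integ_ell
  (index_enum row_idx) finset.set0 (fun _ _ => 0) (index_enum_uniq _).
- by move=> q _; rewrite finset.disjoints_subset finset.sub0set.
- by move=> g; exact: dep_cst.
- by move=> g; exact: integ_cst.
move=> eps heps; split; first exact: clip_dev_ge0.
  by apply: integ_maxf => g; exact: integ_sum.
have {heps} : Ex P clip_dev <= Ex P (fun w => maxf (grid0 p m) (fun g =>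
    0 + \sum_(q : row_idx) (-1) ^+ eps q * 2 * ell q g w)).
  apply: le_trans heps; apply: ler_of_eq.
  congr Ex; apply/funext => w; congr maxf; apply/funext => g.
  by rewrite add0r.
move=> /le_trans; apply.
pose y j w := \sum_(q : row_idx) (-1) ^+ eps q * Xmx (tag q) w (tagged q) j.
have XE (q : row_idx) j : (fun w => Xmx (tag q) w (tagged q) j) =
    lin (tagged q) (col j (Sigma_half (tag q))).
  by apply/funext => w; exact: XmxE.
have y2 j : mean_le P (fun w => y j w ^+ 2) (\sum_(q : row_idx) chi).
  have yJ (q : row_idx) : dep F (row_fiber q)
      (fun w => (-1) ^+ eps q * Xmx (tag q) w (tagged q) j).
    apply: depM; first exact: dep_cst.
    exact: (@dep_X_row _ _ _ _ _ model _ (tagged q) j).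
  have y0 (q : row_idx) : Ex P (fun w => (-1) ^+ eps q * Xmx (tag q) w (tagged q) j) = 0.
    have [i e] := Ex_lin model (tagged q) (col j (Sigma_half (tag q))).
    by rewrite ExZ XE// e mulr0.
  have ysq (q : row_idx) : mean_le P
      (fun w => ((-1) ^+ eps q * Xmx (tag q) w (tagged q) j) ^+ 2) chi.
    under eq_fun do rewrite exprMn sqrr_sign mul1r.
    exact: mean_X2.
  by have [] := mean_le_sqr_sum FP row_fiber_disjoint yJ y0 (index_enum_uniq row_idx) ysq.
pose th := nrows * t; have th0 : 0 < th by rewrite mulr_gt0.
pose U w := th^-1 * \sum_j y j w ^+ 2 + 4 * th.
have mU : mean_le P U (th^-1 * \sum_(j < p) (\sum_(q : row_idx) chi) + 4 * th).
  apply: mean_leD; last by apply: mean_le_cst; rewrite mulr_ge0// ltW.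
  by apply: mean_leZ; [rewrite invr_ge0 ltW|apply: mean_le_sum => j _].
have [_ iU eU] := mU.
apply: (@le_trans _ _ (Ex P U)).
  apply: Ex_le => //.
    apply: integ_maxf => g; apply: integD; first exact: integ_cst.
    by apply: integ_sum => q _; exact: integZ.
  move=> w; apply: maxf_leP => g; rewrite add0r.
  have -> : \sum_(q : row_idx) (-1) ^+ eps q * 2 * ell q g w =
      2 * \sum_j y j w * grid_ball (R := R) g j 0.
    rewrite mulr_sumr; under [RHS]eq_bigr do rewrite mulr_suml mulr_sumr.
    rewrite exchange_big; apply: eq_bigr => q _.
    rewrite /ell -Xmx_mulE mxE mulr_sumr; apply: eq_bigr => j _ /=; ring.
  have g4 := grid_ball_le (R := R) g.
  apply: (@le_trans _ _ (\sum_j (th^-1 * y j w ^+ 2 + th * grid_ball (R := R) g j 0 ^+ 2))).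
    rewrite mulr_sumr; apply: ler_sum => j _; rewrite -subr_ge0.
    rewrite (_ : _ - _ = th^-1 * (y j w - th * grid_ball (R := R) g j 0) ^+ 2); last first.
      by field; exact: lt0r_neq0.
    by rewrite mulr_ge0 ?sqr_ge0// invr_ge0 ltW.
  rewrite big_split /= -!mulr_sumr lerD2l mulrC ler_wpM2r// ltW//.
apply: (le_trans eU).
rewrite !sumr_const card_ord /= -[chi *+ _]mulr_natl -[(_ * chi) *+ _]mulr_natl -/nrows.
rewrite mulrDr lerD//; last by rewrite /th mulrCA.
rewrite /th (_ : _ * (p%:R * _) = p%:R * chi / t); last first.
  by field; rewrite !gt_eqF.
rewrite (_ : nrows * _ = (kap * nrows) / L%:R * chi / t); last first.
  by field; rewrite !gt_eqF.
rewrite ler_wpM2r ?invr_ge0 ?(ltW t0)// ler_wpM2r ?(ltW chi0)//.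
by rewrite ler_pdivlMr// mulrC nrows_ge.
Qed.

Lemma grid_lower (w : T) (g : G) : clip_dev w <= nrows * clip_mean ->
  4^-1 <= nrm2 (grid_ball (R := R) g) ->
  nrows * (clo / 16) <= \sum_l nrm2 (Xmx l w *m grid_ball g).
Proof.
move=> hw hg; have g4 := grid_ball_le (R := R) g.
have hc q : 2 * clip_mean <= cen q g.
  apply: Ex_clip_lin; first by apply: le_trans (sqrt_lo reg _ _); rewrite ler_wpM2l// ltW.
  by rewrite (le_trans (sqrt_hi reg _ _))// mulrC ler_wpM2r// ltW.
have := maxf_ge (grid0 p m) (fun g => \sum_(q : row_idx) (cen q g - phi (ell q g w))) g.
rewrite -/(clip_dev w) => /le_trans /(_ hw); rewrite sumrB => h.
have h1 : \sum_(q : row_idx) 2 * clip_mean <= \sum_(q : row_idx) cen q g by apply: ler_sum.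
rewrite sumr_const -[(2 * clip_mean) *+ _]mulr_natl -/nrows in h1.
have h2 : nrows * clip_mean <= \sum_(q : row_idx) phi (ell q g w) by lra.
have -> : \sum_l nrm2 (Xmx l w *m grid_ball g) = \sum_(q : row_idx) ell q g w ^+ 2.
  rewrite (row_sum (fun l i => lin i (Sigma_half l *m grid_ball g) w ^+ 2)).
  apply: eq_bigr => l _; apply: eq_bigr => i _; by rewrite Xmx_mulE.
apply: (@le_trans _ _ (2 * clip_at * \sum_(q : row_idx) phi (ell q g w))).
  rewrite (_ : nrows * _ = 2 * clip_at * (nrows * clip_mean)).
    by rewrite ler_wpM2l// mulr_ge0// ltW.
  by rewrite /clip_mean; field; exact: lt0r_neq0.
by rewrite mulr_sumr; apply: ler_sum => q _; exact: clip_le.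
Qed.

End with_grid.

Lemma mean_design_sum : mean_le P (fun w => \sum_l fro2 (Xmx l w)) (nrows * p%:R * chi).
Proof.
have E l j : mean_le P (fun w => nrm2 (col j (Xmx l w))) ((nobs l)%:R * chi).
  rewrite -sum_ord_const; apply: mean_le_sum => i _.
  by under eq_fun do rewrite mxE; exact: mean_X2.
have -> : nrows * p%:R * chi = \sum_(l < L) \sum_(j < p) (nobs l)%:R * chi.
  rewrite nrowsE !mulr_suml; apply: eq_bigr => l _.
  by rewrite sum_ord_const; ring.
under eq_fun do under eq_bigr do rewrite fro2_col.
by apply: mean_le_sum => l _; apply: mean_le_sum.
Qed.

(** The parameter t governs the deviation on the grid. B caps the sum of the ||X_l||_F^2, a crude
    bound whose loss is compensated by the fineness of the grid. *)
Lemma gram_lower_bound (t B : R) : 0 < t -> 0 < B ->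
  exists bad : set T, [/\ measurable bad,
    (P bad <= ((kap * chi / (L%:R * t) + 4 * t) / clip_mean + chi / B)%:E)%E &
    forall w, ~ bad w -> forall u, nrm2 u = 1 ->
      clo / (64 * kap) <= L%:R^-1 * \sum_l p%:R^-1 * nrm2 (Xmx l w *m u)].
Proof.
move=> t0 B0; have N0 := nrows_gt0.
(* The mesh makes dl = p / m^2 at most 1 / 4, as rounding requires, and dl p B at most clo / 64, as
   the passage from the grid to u requires; the sum of the two demands handles both. *)
pose m := (Num.truncn (p%:R * (4 + 64 * p%:R * B / clo))).+1.
have m0 : (0 < m)%N by [].
pose dl := p%:R / m%:R ^+ 2 : R.
have mR : 0 < m%:R :> R by rewrite ltr0n.
have x0 : 0 <= 64 * p%:R * B / clo.
  by rewrite divr_ge0 ?(ltW clo0)// !mulr_ge0// ltW.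
have mlt : p%:R * (4 + 64 * p%:R * B / clo) < m%:R.
  exact: Num.Theory.truncnS_gt.
have dm : dl * (4 + 64 * p%:R * B / clo) <= 1.
  rewrite /dl mulrAC ler_pdivrMr ?exprn_gt0// mul1r (le_trans (ltW mlt))//.
  by rewrite expr2 ler_peMl// ler1n.
have dl0 : 0 <= dl by rewrite divr_ge0 ?exprn_ge0 ?(ltW mR).
have dl4 : dl <= 4^-1.
  by have : 0 <= dl * (64 * p%:R * B / clo) by [exact: mulr_ge0]; lra.
have dlB : dl * (p%:R * B) <= clo / 64.
  have : dl * (64 * p%:R * B / clo) <= 1 by lra.
  rewrite (_ : dl * _ = (dl * (p%:R * B)) / (clo / 64)); last first.
    by field; exact: lt0r_neq0.
  by rewrite ler_pdivrMr ?mul1r// divr_gt0.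
pose b1 := [set w : T | nrows * clip_mean < clip_dev m w].
pose b2 := [set w : T | nrows * p%:R * B < \sum_l fro2 (Xmx l w)].
have [_ i2 _] := mean_design_sum.
have mb1 : measurable b1 by apply: measurable_gt; exact: measurable_clip_dev.
have mb2 : measurable b2 by apply: measurable_gt; exact: (integ_measurable i2).
exists (b1 `|` b2); split.
- exact: measurableU.
- rewrite EFinD (le_trans (measureU2 _ _ _))// leeD//.
    have := markov_mean (_ : 0 < nrows * clip_mean) (mean_clip_dev m0 t0).
    move=> /(_ (mulr_gt0 N0 clip_mean_gt0)) /le_trans; apply; rewrite lee_fin.
    apply: ler_of_eq; field.
    by rewrite !gt_eqF// clip_mean_gt0.
  have := markov_mean (_ : 0 < nrows * p%:R * B) mean_design_sum.
  move=> /(_ (mulr_gt0 (mulr_gt0 N0 pp) B0)) /le_trans; apply; rewrite lee_fin.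
  by apply: ler_of_eq; field; rewrite !gt_eqF.
move=> w /not_orP[/negP + /negP]; rewrite -!leNgt => h1 h2 u u1.
have [g [gu g1]] := grid_approx m0 u1 dl4.
have hg := grid_lower h1 g1.
(* The grid point gives N clo / 16 <= 2 (sum + N clo / 64), which leaves N clo / 64 for u itself. *)
have key : nrows * (clo / 64) <= \sum_l nrm2 (Xmx l w *m u).
  have : \sum_l nrm2 (Xmx l w *m grid_ball g) <=
     2 * (\sum_l nrm2 (Xmx l w *m u) + dl * \sum_l fro2 (Xmx l w)).
    rewrite mulrDr !mulr_sumr -big_split; apply: ler_sum => l _ /=.
    have := nrm2D_le (Xmx l w *m (grid_ball g - u)) (Xmx l w *m u).
    rewrite -mulmxDr subrK => /le_trans; apply.
    have h := nrm2_mulmx (Xmx l w) (grid_ball g - u).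
    have : fro2 (Xmx l w) * nrm2 (grid_ball g - u) <= dl * fro2 (Xmx l w).
      by rewrite mulrC ler_wpM2r// fro2_ge0.
    lra.
  have : dl * \sum_l fro2 (Xmx l w) <= nrows * (clo / 64).
    apply: (@le_trans _ _ (dl * (nrows * p%:R * B))); first by rewrite ler_wpM2l.
    rewrite (_ : dl * _ = nrows * (dl * (p%:R * B))); last by ring.
    by rewrite ler_wpM2l// ltW.
  lra.
rewrite -mulr_sumr.
rewrite (_ : clo / _ = L%:R^-1 * (p%:R^-1 * ((L%:R * p%:R) / kap * (clo / 64)))); last first.
  by field; rewrite !gt_eqF.
rewrite !ler_wpM2l ?invr_ge0//; apply: le_trans key.
rewrite ler_wpM2r ?divr_ge0 ?(ltW clo0)// ler_pdivrMr// [leRHS]mulrC; exact: nrows_ge.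
Qed.

End gram_lower_bound.

(** * Consistency *)

Lemma mu_ext_le (R : realType) d (T : measurableType d) (P : probability T R)
    (A B : set T) (c : \bar R) :
  A `<=` B -> measurable B -> (P B <= c)%E -> (mu_ext P A <= c)%E.
Proof.
move=> AB mB; apply: le_trans; rewrite -(measurable_mu_extE P mB).
exact: le_mu_ext.
Qed.

Section uniform_bounds.
Context {R : realType} {d : measure_display}.
Variables (sigma M12 kap clo chi C0 C1 taub taue : R).
Hypotheses (C00 : 0 < C0) (C10 : 0 < C1).

(** The hypotheses on one study, with constants shared by all the studies of a sequence. *)
Record admissible (s : multi_study R d) : Prop := {
  adm_model : model_assumptions s sigma M12;
  adm_design : regular_design s kap clo chi;
  adm_Omega_ge : forall v, C0 * nrm2 v <= dot v (Omega s *m v);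
  adm_Omega_le : forall v, dot v (Omega s *m v) <= C1 * nrm2 v;
  adm_beta : forall l : 'I_(nL s), sub_gaussian (Pr s)
    (fun w => Num.sqrt (dim s)%:R *: beta l w) taub;
  adm_noise : forall l : 'I_(nL s), sub_gaussian (Pr s) (noise l) taue
}.

Definition study_rate (s : multi_study R d) : R := (dim s)%:R ^+ 2 / (nL s)%:R.

Let c := hess_const kap clo / 2.
(** One positive constant above those of the score and of the Gram matrices; absolute values avoid
    any discussion of signs. *)
Let K := 1 + `|score_const sigma M12 kap chi C1 taub taue| + `|gram_const M12 kap chi|.

Let K0 : 0 < K.
Proof. by rewrite /K -addrA ltr_pwDl// addr_ge0. Qed.

Section one_study.
Variable s : multi_study R d.
Hypothesis adm : admissible s.
Local Notation r := (study_rate s).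
Local Notation P := (Pr s).
Let model := adm_model adm.
Let reg := adm_design adm.

Lemma study_rate_gt0 : 0 < r.
Proof.
by rewrite divr_gt0 ?exprn_gt0// ltr0n; [exact: dim_gt0 reg|exact: L_gt0 reg].
Qed.

Let c0 : 0 < c.
Proof. by rewrite divr_gt0// (hess_const_gt0 reg). Qed.

Lemma mean_le_rate f a g : `|a| <= K -> 0 < g ->
  mean_le P f (a * (dim s)%:R ^+ 2 / (nL s)%:R) ->
  measurable [set w | g ^+ 2 < f w] /\
  (P [set w | (g ^+ 2 < f w)%R] <= (K * r / g ^+ 2)%:E)%E.
Proof.
move=> aK g0 mf; have [_ fi _] := mf; split.
  by apply: measurable_gt; exact: integ_measurable fi.
apply: (le_trans (markov_mean (exprn_gt0 2 g0) mf)); rewrite lee_fin -mulrA.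
rewrite ler_wpM2r ?invr_ge0 ?sqr_ge0// ler_wpM2r ?(ltW study_rate_gt0)//.
exact: le_trans (ler_norm _) aK.
Qed.

Let score_event g : 0 < g ->
  measurable [set w : space s | g ^+ 2 < fro2 (score sigma w)] /\
  (P [set w : space s | (g ^+ 2 < fro2 (score sigma w))%R] <= (K * r / g ^+ 2)%:E)%E.
Proof.
move=> g0; apply: (mean_le_rate _ g0 (mean_score model reg _ (adm_beta adm) (adm_noise adm))).
  by rewrite /K; have := normr_ge0 (gram_const M12 kap chi); lra.
move=> v; apply: psd_nrm2_le; first exact: (Omega_posdef model).1.
by move=> u; rewrite (adm_Omega_le adm) (posdefmx_ge0 _ (Omega_posdef model)).
Qed.

Let cgramK : `|gram_const M12 kap chi| <= K.
Proof. by rewrite /K; have := normr_ge0 (score_const sigma M12 kap chi C1 taub taue); lra. Qed.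

Let hess_dev (w : space s) : R := \sum_q (hess_coef q w - Ex P (hess_coef q)) ^+ 2.
Let gram2_dev (w : space s) : R := \sum_(q : 'I_(dim s) * 'I_(dim s))
  (gram2 w q.1 q.2 - Ex P (fun w => gram2 w q.1 q.2)) ^+ 2.

(** Two things can go wrong: the Hessian leaves its mean by more than c, or the score exceeds g. Off
    this event the bound holds for every minimiser at once. *)
Lemma small_rate_error g : 0 < g -> exists bad : set (space s),
  [/\ measurable bad, (P bad <= (K * r / c ^+ 2 + K * r / g ^+ 2)%:E)%E &
   forall w, ~ bad w -> (g < c * C0 -> attained sigma w) /\
     forall A, argmin_loss sigma w A -> opnorm (A - Omega s) <= g / c].
Proof.
move=> g0; have [ms Ps] := score_event g0.
have [mh Ph] := mean_le_rate cgramK c0 (hess_coef_lln model reg).2.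
exists ([set w | c ^+ 2 < hess_dev w] `|` [set w | g ^+ 2 < fro2 (score sigma w)]).
split; [exact: measurableU mh ms| |].
  by rewrite EFinD (le_trans (measureU2 _ _ _))// leeD.
move=> w /not_orP[/negP + /negP]; rewrite -!leNgt => h1 h2.
have coer B := hess_coercive_of model reg B h1.
split=> [gc|A Amin]; last exact: (coercive_error c0 coer Amin (ltW g0)).
apply: (coercive_attained c0 coer C00 (Omega_posdef model).1 (adm_Omega_ge adm)).
by rewrite (le_lt_trans h2)// ltrXn2r ?nnegrE// ltW// mulr_gt0.
Qed.

Let lo := clo / (64 * kap).

(** The deviation of [gram2] is compared here with the threshold g of the score, which grows with
    the rate, and not with a fixed constant; hence this event is rare even when the rate is
    large. *)
Lemma large_rate_error t B g : 0 < t -> 0 < B -> 0 < g -> exists bad : set (space s),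
  [/\ measurable bad,
    (P bad <= ((kap * chi / ((nL s)%:R * t) + 4 * t) / clip_mean M12 clo chi + chi / B
               + 2 * (K * r / g ^+ 2))%:E)%E &
   forall w, ~ bad w -> forall A, argmin_loss sigma w A ->
     opnorm (A - Omega s) <= 2 * ((g + C1 * (`|gram2_const M12 kap chi| + g)) / lo ^+ 2 + C1)].
Proof.
move=> t0 B0 g0; have [ms Ps] := score_event g0.
have [mh Ph] := mean_le_rate cgramK g0 (gram2_lln model reg).2.
have [bad [mb Pb hb]] := gram_lower_bound model reg t0 B0.
exists (bad `|` ([set w | g ^+ 2 < gram2_dev w] `|`
  [set w | g ^+ 2 < fro2 (score sigma w)])).
split; [exact: measurableU mb (measurableU _ _ mh ms)| |].
  rewrite EFinD (le_trans (measureU2 _ _ _))//; first exact: measurableU mh ms.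
  rewrite leeD// (le_trans (measureU2 _ _ _))// mulr_natl mulr2n EFinD.
  exact: leeD.
move=> w /not_orP[/hb h0 /not_orP[/negP + /negP]]; rewrite -!leNgt => h1 h2 A.
move=> Amin; apply: (leading_error _ _ _ _ _ _ _ _ h2 _ h0 Amin).
- exact: L_gt0 reg.
- exact: dim_gt0 reg.
- by rewrite divr_gt0 ?(clo_gt0 reg)// mulr_gt0// (lt_le_trans _ (kap_ge1 reg)).
- by rewrite addr_ge0// ltW.
- exact: ltW.
- exact: ltW.
- exact: adm_Omega_le adm.
- exact: Omega_posdef model.
- move=> u u1; apply: (le_trans (gram2_le_of model reg (ltW g0) u1 h1)).
  by rewrite lerD2r ler_norm.
Qed.

End one_study.

Section admissible_sequence.
Variable s0 : multi_study R d.
Hypothesis adm0 : admissible s0.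
Let c0 : 0 < c.
Proof. by rewrite divr_gt0// (hess_const_gt0 (adm_design adm0)). Qed.
Let kap0 : 0 < kap := lt_le_trans ltr01 (kap_ge1 (adm_design adm0)).
Let chi0 : 0 < chi := chi_gt0 (adm_design adm0).
Let cm0 := clip_mean_gt0 (adm_model adm0) (adm_design adm0).

Lemma est_error_small e : 0 < e -> exists2 C, 0 < C &
  forall s, admissible s -> forall Ohat : space s -> 'M[R]_(dim s), is_estimator sigma Ohat ->
    (mu_ext (Pr s) [set w | (e < `|est_error Ohat w|)%R] <= (C * study_rate s)%:E)%E.
Proof.
(* The first bound on g forces the minimum to be attained, without which the estimator is arbitrary;
   the second brings the error below e. *)
move=> e0; pose g := Num.min (c * C0 / 2) (c * e).
have cC := mulr_gt0 c0 C00.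
have g0 : 0 < g by rewrite lt_min (divr_gt0 cC)// (mulr_gt0 c0 e0).
exists (K / c ^+ 2 + K / g ^+ 2).
  by rewrite addr_gt0// divr_gt0// exprn_gt0.
move=> s adm Ohat OhatP; have [bad [mbad Pbad hbad]] := small_rate_error adm g0.
apply: (mu_ext_le _ mbad); last first.
  by rewrite mulrDl ![_ / _ * study_rate s]mulrAC.
move=> w /=; apply: contraPP => /hbad[att err].
have /att /OhatP /err h : g < c * C0.
  apply: (@le_lt_trans _ _ (c * C0 / 2)); first by rewrite ge_min lexx.
  by rewrite ltr_pdivrMr// ltr_pMr ?cC// ltr1n.
apply/negP; rewrite -leNgt ger0_norm ?opnorm_ge0//; apply: (le_trans h).
by rewrite ler_pdivrMr// [_ * c]mulrC ge_min lexx orbT.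
Qed.

Lemma est_error_tight e : 0 < e -> exists2 M, 0 < M & exists N, forall s, admissible s ->
  (N <= nL s)%N -> forall Ohat : space s -> 'M[R]_(dim s), is_estimator sigma Ohat ->
  (mu_ext (Pr s) [set w | (M < `|\1_(attained sigma) w * est_error Ohat w
      / Num.sqrt (study_rate s)|)%R] <= e%:E)%E.
Proof.
move=> e0; set cm := clip_mean M12 clo chi.
(* Below this rate, the probability K r / c^2 that the Hessian deviates is at most e / 2. *)
pose eta := e * c ^+ 2 / (2 * K).
have K20 : 0 < 2 * K by exact: mulr_gt0.
have K80 : 0 < 8 * K by exact: mulr_gt0.
have c20 := exprn_gt0 2 c0.
have eta0 : 0 < eta by rewrite divr_gt0// (mulr_gt0 e0 c20).
(* With g = m sqrt r as threshold for the score, Markov's bound K r / g^2 equals e / 8 whatever the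
   rate. *)
pose m := Num.sqrt (8 * K / e).
have m0 : 0 < m by rewrite sqrtr_gt0 divr_gt0.
have m2 : m ^+ 2 = 8 * K / e by rewrite sqr_sqrtr// ltW// divr_gt0.
pose lo2 := (clo / (64 * kap)) ^+ 2.
have lo20 : 0 < lo2.
  by rewrite exprn_gt0// divr_gt0 ?(clo_gt0 (adm_design adm0))// mulr_gt0.
(* The bound for large rates is affine in g: A1 is its constant term and A2 its slope. *)
pose A1 := 2 * (C1 * `|gram2_const M12 kap chi| / lo2 + C1).
pose A2 := 2 * (1 + C1) / lo2.
have A10 : 0 <= A1.
  by rewrite mulr_ge0// addr_ge0 ?(ltW C10)// divr_ge0 ?(ltW lo20)// mulr_ge0 ?(ltW C10).
have A20 : 0 <= A2 by rewrite divr_ge0 ?(ltW lo20)// mulr_ge0// addr_ge0// ltW.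
(* This t and the next B make 4 t / cm and chi / B both equal to e / 8. The rank N below does the
   same for the term in 1 / L, so that with the two deviation events the total is 5 e / 8. *)
pose t := e * cm / 32; have t0 : 0 < t by rewrite divr_gt0// (mulr_gt0 e0 cm0).
pose B := 8 * chi / e; have B0 : 0 < B by rewrite divr_gt0// mulr_gt0.
pose M1 := m / c; pose M2 := A1 / Num.sqrt eta + A2 * m.
have M10 : 0 < M1 by exact: divr_gt0.
have M20 : 0 <= M2.
  by rewrite addr_ge0 ?(divr_ge0 A10 (sqrtr_ge0 _))// (mulr_ge0 A20 (ltW m0)).
exists (M1 + M2); first exact: ltr_wpDr.
exists (Num.truncn (8 * kap * chi / (t * cm * e))).+1 => s adm NL Ohat OhatP.
have r0 := study_rate_gt0 adm; set r := study_rate s in r0 *.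
have sr0 : 0 < Num.sqrt r by rewrite sqrtr_gt0.
have g0 : 0 < m * Num.sqrt r by rewrite mulr_gt0.
have Kg : K * r / (m * Num.sqrt r) ^+ 2 = e / 8.
  rewrite exprMn m2 sqr_sqrtr ?(ltW r0)//; field.
  by rewrite !gt_eqF// mulr_gt0.
have concl (bad : set (space s)) (M' : R) : M' <= M1 + M2 -> measurable bad ->
    (Pr s bad <= e%:E)%E ->
    (forall w, ~ bad w -> forall A, argmin_loss sigma w A ->
      opnorm (A - Omega s) <= M' * Num.sqrt r) ->
    (mu_ext (Pr s) [set w | (M1 + M2 < `|\1_(attained sigma) w * est_error Ohat w
      / Num.sqrt r|)%R] <= e%:E)%E.
  move=> MM mb Pb hb; apply: (mu_ext_le _ mb Pb) => w /=.
  apply: contraPP => /hb h; apply/negP; rewrite -leNgt indicE.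
  case: (boolP (w \in _)) => [/set_mem/OhatP/h hw|_]; last first.
    by rewrite !mul0r normr0 addr_ge0// ltW.
  rewrite mul1r ger0_norm; last by rewrite divr_ge0 ?sqrtr_ge0 ?opnorm_ge0.
  by apply: le_trans MM; rewrite ler_pdivrMr.
(* Concentration of the Hessian is only available for a small rate; otherwise
   the leading eigenvector gives a bounded error, which the rate dominates. *)
have [reta|/ltW etar] := leP r eta.
  have [bad [mb Pb hb]] := small_rate_error adm g0.
  apply: (concl bad M1) => //; first by rewrite lerDl.
    apply: (le_trans Pb); rewrite lee_fin Kg.
    have : K * r / c ^+ 2 <= e / 2.
      rewrite ler_pdivrMr ?exprn_gt0//.
      apply: (@le_trans _ _ (K * eta)); first by rewrite ler_wpM2l// ltW.
      by rewrite /eta; apply: ler_of_eq; field; exact: lt0r_neq0.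
    by move: (K * r / c ^+ 2) => x; lra.
  by move=> w /hb[_ h] A /h; rewrite /M1 mulrAC.
have [bad [mb Pb hb]] := large_rate_error adm t0 B0 g0.
apply: (concl bad M2) => //; first by rewrite lerDr ltW.
  apply: (le_trans Pb); rewrite lee_fin Kg -/cm.
  have L0 : 0 < (nL s)%:R :> R by rewrite ltr0n; exact: L_gt0 (adm_design adm).
  have h1 : kap * chi / ((nL s)%:R * t) / cm <= e / 8.
    have NR : 8 * kap * chi / (t * cm * e) <= (nL s)%:R.
      apply: ltW; apply: (lt_le_trans (Num.Theory.truncnS_gt _)).
      by rewrite ler_nat.
    rewrite ler_pdivrMr ?(mulr_gt0 (mulr_gt0 t0 cm0) e0)// in NR.
    rewrite ler_pdivrMr// ler_pdivrMr ?(mulr_gt0 L0 t0)//; lra.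
  have h2 : 4 * t / cm = e / 8 by rewrite /t; field; exact: lt0r_neq0.
  have h3 : chi / B = e / 8 by rewrite /B; field; rewrite !gt_eqF.
  rewrite mulrDl h2 h3; lra.
move=> w /hb h A /h /le_trans; apply.
(* Here r >= eta, so that the constant term is absorbed by a multiple of sqrt r. *)
have key : A1 <= A1 / Num.sqrt eta * Num.sqrt r.
  rewrite -mulrA -[leLHS]mulr1 ler_wpM2l// mulrC ler_pdivlMr ?sqrtr_gt0// mul1r.
  by rewrite ler_sqrt// ltW.
rewrite /M2 [leRHS]mulrDl.
apply: (@le_trans _ _ (A1 + A2 * m * Num.sqrt r)); last by rewrite lerD2r.
apply: ler_of_eq; rewrite /A1 /A2 -/lo2; field.
exact: lt0r_neq0.
Qed.

End admissible_sequence.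
End uniform_bounds.

Lemma sqrtmx_nrm2 (R : realType) n (A S : 'M[R]_n) v : is_sqrtmx A S ->
  nrm2 (S *m v) = dot v (A *m v).
Proof.
by move=> [[ST _] <-]; rewrite -dot_nrm2 dot_mulmx ST mulmxA dotC.
Qed.

(** From some rank on every study is [admissible] with constants free of k, because p / n_l
    approaches gamma_l uniformly in l and gamma_l stays between two positive bounds. The one-study
    estimates then apply term by term. *)
Theorem theorem3p1 (R : realType) (d : measure_display)
    (s : nat -> multi_study R d) (gamma : nat -> R)
    (sigma M12 C0 C1 : R)
    (model : forall k, model_assumptions (s k) sigma M12)
    (C0_gt0 : 0 < C0) (C0_lt_C1 : C0 < C1)
    (Omega_spec : forall k,
      C0 < lambda_min (Omega (s k)) /\ lambda_max (Omega (s k)) < C1)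
    (regime : asymptotic_regime s gamma)
    (* hypothesis (a), apart from the limit of L0 / L *)
    (L0 : nat -> nat) (delta : R) (delta_gt0 : 0 < delta)
    (L0_bounds : forall N, (0 < N)%N -> (0 < L0 N <= N)%N)
    (gamma_L0 : forall N l, (l < L0 N)%N -> gamma l <= 1 - delta)
    (* hypothesis (b) *)
    (gamma_lo gamma_hi : R) (gamma_lo_gt0 : 0 < gamma_lo)
    (gamma_bounds : forall l, gamma_lo <= gamma l <= gamma_hi)
    (c_lo c_hi : nat -> R) (cop_lo cop_hi : R)
    (c_lo_gt0 : forall l, 0 < c_lo l)
    (Sigma_spec : forall k (l : 'I_(nL (s k))),
      c_lo l <= lambda_min (Sigma l) /\ lambda_max (Sigma l) <= c_hi l)
    (cop_lo_gt0 : 0 < cop_lo) (cop_hi_gt0 : 0 < cop_hi)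
    (c_hi_sup : (ereal_sup (range (fun l => (c_hi l)%:E)) <= cop_hi%:E)%E)
    (c_lo_inf : (cop_lo%:E < ereal_inf (range (fun l => (c_lo l)%:E)))%E)
    (* hypothesis (c) *)
    (tau_beta tau_eps : R)
    (beta_sub_gaussian : forall k (l : 'I_(nL (s k))),
      sub_gaussian (Pr (s k))
        (fun w => Num.sqrt (dim (s k))%:R *: beta l w) tau_beta)
    (noise_sub_gaussian : forall k (l : 'I_(nL (s k))),
      sub_gaussian (Pr (s k)) (noise l) tau_eps)
    (Omega_hat : forall k, space (s k) -> 'M[R]_(dim (s k)))
    (Omega_hatP : forall k, is_estimator sigma (@Omega_hat k)) :
  [/\ (exists2 c : R, 0 < c & (L0 N)%:R / N%:R @[N --> \oo] --> c) ->
        bigO_P (fun k => Pr (s k))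
          (fun k w => \1_(attained sigma) w * est_error (@Omega_hat k) w)
          (fun k => Num.sqrt (rate s k)),
      (exists2 c : R, 0 < c & (L0 N)%:R / N%:R @[N --> \oo] --> c) ->
        rate s k @[k --> \oo] --> (0 : R) ->
        cvg_P0 (fun k => Pr (s k)) (fun k w => est_error (@Omega_hat k) w),
      (L0 N)%:R / N%:R @[N --> \oo] --> (0 : R) ->
        (nL (s k))%:R / (L0 (nL (s k)))%:R * rate s k @[k --> \oo] --> (0 : R) ->
        cvg_P0 (fun k => Pr (s k)) (fun k w => est_error (@Omega_hat k) w) &
      (exists2 c : R, 0 < c & (L0 N)%:R / N%:R @[N --> \oo] --> c) ->
        forall g, (forall l, gamma l = g) ->
        bigO_P (fun k => Pr (s k))
          (fun k w => \1_(attained sigma) w * est_error (@Omega_hat k) w)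
          (fun k => (1 + Num.sqrt g) ^+ 2 * g ^+ 2 / (1 - Num.sqrt g) ^+ 2
                    * Num.sqrt (rate s k))].
Proof.
(* The three terms ensure in turn kap >= 1, p <= kap n and n <= kap p, once p / n_l is within min(1,
   gamma_lo / 2) of gamma_l. *)
pose kap := Num.max 1 (Num.max (gamma_hi + 1) (2 / gamma_lo)).
have [hL hp hn hg] := regime.
have adm : \forall k \near \oo,
    admissible sigma M12 kap cop_lo cop_hi C0 C1 tau_beta tau_eps (s k).
  have e0 : 0 < Num.min 1 (gamma_lo / 2) by rewrite lt_min ltr01 divr_gt0.
  have hL1 : \forall k \near \oo, (1 <= nL (s k))%N by exact: (hL _ (nbhs_infty_ge 1)).
  have hp1 : \forall k \near \oo, (1 <= dim (s k))%N by exact: (hp _ (nbhs_infty_ge 1)).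
  near=> k.
  have Lpos : (0 < nL (s k))%N by near: k.
  have p0 : (0 < dim (s k))%N by near: k.
  have n2 : forall l : 'I_(nL (s k)), (2 <= nobs l)%N by near: k; exact: hn.
  have hr : forall l : 'I_(nL (s k)),
      `|(dim (s k))%:R / (nobs l)%:R - gamma l| < Num.min 1 (gamma_lo / 2).
    by near: k; exact: hg.
  have n0 (l : 'I_(nL (s k))) : 0 < (nobs l)%:R :> R by rewrite ltr0n; exact: ltnW.
  have [om0 om1] := Omega_spec k; have Opd := Omega_posdef (model k).
  split=> //.
  - split=> //.
    + by rewrite le_max lexx.
    + move=> l; have := hr l; rewrite lt_min ltr_norml => /andP[_].
      rewrite ltr_norml => /andP[h _]; have /andP[gl _] := gamma_bounds l.
      have : gamma_lo / 2 <= (dim (s k))%:R / (nobs l)%:R by lra.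
      rewrite ler_pdivlMr// => h'.
      apply: (@le_trans _ _ (2 / gamma_lo * (dim (s k))%:R)).
        rewrite mulrAC ler_pdivlMr//; lra.
      by rewrite ler_wpM2r// !le_max lexx !orbT.
    + move=> l; have := hr l; rewrite lt_min ltr_norml => /andP[/andP[_ h] _].
      have /andP[_ gl] := gamma_bounds l.
      have : (dim (s k))%:R / (nobs l)%:R <= gamma_hi + 1 by lra.
      rewrite ler_pdivrMr// => /le_trans; apply.
      by rewrite ler_wpM2r ?(ltW (n0 _))// !le_max lexx !orbT.
    + move=> l v; rewrite (sqrtmx_nrm2 v (Sigma_halfP (model k) l)).
      apply: le_trans (lambda_min_quad v (Sigma_posdef (model k) l).1).
      rewrite ler_wpM2r ?nrm2_ge0// (le_trans _ (Sigma_spec k l).1)// -lee_fin.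
      by apply/ltW/(lt_le_trans c_lo_inf)/ereal_inf_lbound; exists (l : nat).
    + move=> l v; rewrite (sqrtmx_nrm2 v (Sigma_halfP (model k) l)).
      apply: (le_trans (lambda_max_quad v (Sigma_posdef (model k) l).1)).
      rewrite ler_wpM2r ?nrm2_ge0// (le_trans (Sigma_spec k l).2)// -lee_fin.
      by apply: le_trans c_hi_sup; apply: ereal_sup_ubound; exists (l : nat).
  - move=> v; apply: le_trans (lambda_min_quad v Opd.1).
    by rewrite ler_wpM2r ?nrm2_ge0// ltW.
  - move=> v; apply: (le_trans (lambda_max_quad v Opd.1)).
    by rewrite ler_wpM2r ?nrm2_ge0// ltW.
have C10 : 0 < C1 := lt_trans C0_gt0 C0_lt_C1.
have [k0 adm0] := filter_ex adm.
have bigO : bigO_P (fun k => Pr (s k))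
    (fun k w => \1_(attained sigma) w * est_error (@Omega_hat k) w)
    (fun k => Num.sqrt (rate s k)).
  move=> e e0; have [M M0 [N hN]] := est_error_tight C0_gt0 C10 adm0 e0.
  exists M => //; near=> k; apply: hN => //.
    by near: k.
  by near: k; exact: (hL _ (nbhs_infty_ge N)).
have cvg0 : rate s k @[k --> \oo] --> (0 : R) ->
    cvg_P0 (fun k => Pr (s k)) (fun k w => est_error (@Omega_hat k) w).
  move=> r0 e e0; have [K K0 hK] := est_error_small C0_gt0 adm0 e0.
  apply: (@squeeze_cvge _ _ _ _ (fun=> 0%E) _ (fun k => (K * rate s k)%:E)).
  - near=> k; rewrite mu_ext_ge0//=; apply: hK => //; by near: k.
  - exact: cvg_cst.
  - by apply: cvg_EFin; [near=> k|rewrite -[X in _ --> X](mulr0 K); exact: cvgMr].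
split.
- by [].
- by [].
(* Since L0 <= L, the ratio L / L0 is at least 1, so the rate is squeezed between 0 and a sequence
   that tends to 0. *)
- move=> _ hr; apply: cvg0; apply: (squeeze_cvgr _ (cvg_cst 0) hr).
  near=> k; have L0k : (0 < nL (s k))%N by near: k; exact: (hL _ (nbhs_infty_ge 1)).
  have /andP[l0 lL] := L0_bounds _ L0k.
  have r0 : 0 <= rate s k by rewrite divr_ge0 ?exprn_ge0.
  rewrite r0/= -[leLHS]mul1r ler_wpM2r// ler_pdivlMr ?ltr0n// mul1r ler_nat//.
(* The common value g lies strictly between 0 and 1, so the extra factor is a positive constant, by
   which the bound M is divided. *)
- move=> _ g gg.
  have g1 : g <= 1 - delta.
    by rewrite -(gg 0%N); apply: (gamma_L0 1%N); have /andP[] := L0_bounds 1%N isT.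
  have g0 : 0 < g.
    by rewrite -(gg 0%N); have /andP[h _] := gamma_bounds 0%N; exact: lt_le_trans h.
  have sg : Num.sqrt g < 1 by rewrite -sqrtr1 ltr_sqrt//; lra.
  set a := (1 + Num.sqrt g) ^+ 2 * g ^+ 2 / (1 - Num.sqrt g) ^+ 2.
  have a0 : 0 < a.
    have h1 : 0 < 1 + Num.sqrt g by rewrite ltr_pwDl// sqrtr_ge0.
    have h2 : 0 < 1 - Num.sqrt g by rewrite subr_gt0.
    by rewrite divr_gt0 ?exprn_gt0// mulr_gt0 ?exprn_gt0.
  move: a a0 => a a0 e e0; have [M M0 hM] := bigO e e0.
  exists (M / a); first exact: divr_gt0.
  apply: filterS hM => k; congr (mu_ext _ _ <= _)%E; apply/funext => w /=.
  have ai : 0 < a^-1 by rewrite invr_gt0.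
  move: (Num.sqrt (rate s k)) (_ * est_error _ _) => r x.
  rewrite (_ : x / (a * r) = a^-1 * (x / r)); last by rewrite invfM mulrCA.
  by rewrite [`|a^-1 * _|]normrM (gtr0_norm ai) [M / a]mulrC ltr_pM2l.
Unshelve. all: by end_near.
Qed.
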